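(* Let $\alpha,\gamma,\kappa,\tau,\ell,\xi$ be positive real numbers. There exists $\beta_0>0$ such that for every $\beta\ge\beta_0$ the delayed thermoelastic system $$\begin{cases} u_{tt}(x,t)-\alpha u_{xx}(x,t-\tau)-\beta u_{xxt}(x,t)+\gamma\theta_x(x,t)=0, & (x,t)\in(0,\ell)\times(0,\infty),\\ \theta_t(x,t)-\kappa\theta_{xx}(x,t)+\gamma u_{xt}(x,t)=0, & (x,t)\in(0,\ell)\times(0,\infty),\\ u(0,t)=u(\ell,t)=0,\quad \theta_x(0,t)=\theta_x(\ell,t)=0, & t\in(0,\infty),\\ u_x(x,t-\tau)=f_0(x,t-\tau), & (x,t)\in(0,\ell)\times(0,\tau),\\ u(x,0)=u_0(x),\ u_t(x,0)=u_1(x),\ \theta(x,0)=\theta_0(x), & x\in(0,\ell), \end{cases}$$ is exponentially stable, i.e. there exist constants $C>0$ and $a_0>0$ such that the energy $E$ defined in the context satisfies $$E(t)\le C\,E(0)\,e^{-a_0t}\qquad\text{for all } t\ge0$$ for every solution with initial data $U_0=(u_0,u_1,f_0(\cdot,-\,\cdot\,\tau),\theta_0)\in\mathcal{H}$.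
   Context: Let $\Omega=(0,\ell)$. All function spaces are real. Put $$\mathcal{H}=\left\{(f,g,p,h)\in H^1_0(\Omega)\times L^2(\Omega)\times L^2(\Omega\times(0,1))\times L^2(\Omega)\ :\ \int_\Omega h(x)\,dx=0\right\},$$ with inner product $$\langle U_1,U_2\rangle_{\mathcal{H}}=\int_\Omega\big(\alpha f_{1x}f_{2x}+g_1g_2+h_1h_2\big)\,dx+\xi\int_\Omega\int_0^1p_1p_2\,d\rho\,dx .$$ (The mean of $\theta$ over $\Omega$ is conserved, and is assumed to be zero.) With $z(x,\rho,t)=u_x(x,t-\tau\rho)$ for $\rho\in(0,1)$ and $U=(u,u_t,z,\theta)$, the system is understood as the abstract Cauchy problem $U'=\mathcal{A}U$, $U(0)=U_0=(u_0,u_1,f_0(\cdot,-\,\cdot\,\tau),\theta_0)$ in $\mathcal{H}$ (third component of $U_0$: $(x,\rho)\mapsto f_0(x,-\tau\rho)$), where $$\mathcal{A}(u,v,z,\theta)=\Big(v,\ \big(\alpha z(\cdot,1)+\beta v_x\big)_x-\gamma\theta_x,\ -\tfrac1\tau z_\rho,\ -\gamma v_x+\kappa\theta_{xx}\Big)$$ with domain $\mathcal{D}(\mathcal{A})$ consisting of all $(u,v,z,\theta)\in\mathcal{H}\cap\big[H^1_0(\Omega)\times H^1_0(\Omega)\times L^2(\Omega;H^1(0,1))\times H^2(\Omega)\big]$ such that $z(\cdot,0)=u_x$, $\alpha z(\cdot,1)+\beta v_x\in H^1(\Omega)$ and $\theta_x(0)=\theta_x(\ell)=0$. The operator $\mathcal{A}$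 generates a $\mathcal{C}_0$-semigroup on $\mathcal{H}$; the solution with initial datum $U_0\in\mathcal{H}$ is the (mild) solution $U(t)=e^{t\mathcal{A}}U_0$. The energy of a solution is $$E(t)=\frac12\int_\Omega\big(u_t^2(x,t)+\alpha u_x^2(x,t)+\theta^2(x,t)\big)\,dx+\xi\int_\Omega\int_0^1u_x^2(x,t-\tau\rho)\,d\rho\,dx,$$ where $u_x(x,t-\tau\rho)$ is read as $z(x,\rho,t)$. *)

(* Defs.v *)
From HB Require Import structures.
From mathcomp Require Import all_boot all_order all_algebra.
From mathcomp Require Import all_classical all_reals all_analysis.

Set Implicit Arguments.
Unset Strict Implicit.
Unset Printing Implicit Defensive.
Import Order.TTheory GRing.Theory Num.Theory.
Import numFieldNormedType.Exports.
Local Open Scope classical_set_scope.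
Local Open Scope ring_scope.

(* Elements of the function spaces are represented by functions; two
   representatives are identified when they agree almost everywhere on the
   domain, i.e. when their distance is 0.  All notions below are invariant
   under this identification.  [measurable_fun] refers to the Borel sets. *)

Definition L2 d (T : measurableType d) (R : realType)
    (mu : {measure set T -> \bar R}) (D : set T) (f : T -> R) : Prop :=
  measurable_fun D f /\ mu.-integrable D (EFin \o (fun x => f x ^+ 2)).

Section Sobolev.
Variable R : realType.
Implicit Types (a b c y : R) (f g w phi : R -> R).
Local Notation mu := (@lebesgue_measure R).

Definition test_fun a b phi : Prop :=
  (forall (n : nat) (x : R), derivable (phi^`(n))%classic x 1) /\
  exists c d, [/\ a < c, d < b & forall x, ~ (`[c, d]%classic x) -> phi x = 0].

Definition is_wderiv a b f g : Prop :=
  [/\ L2 mu `]a, b[ f, L2 mu `]a, b[ g &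
      forall phi, test_fun a b phi ->
        \int[mu]_(x in `]a, b[) (f x * phi^`()%classic x)
        = - \int[mu]_(x in `]a, b[) (g x * phi x)].

(* The weak derivative, drho and slice below are unique almost everywhere when
   they exist, and are then chosen as Borel square-integrable functions. *)
Definition wderiv a b f : R -> R := xget (fun=> 0) [set g | is_wderiv a b f g].

Definition H1 a b : set (R -> R) := [set f | exists g, is_wderiv a b f g].

Definition H2 a b : set (R -> R) := [set f | H1 a b f /\ H1 a b (wderiv a b f)].

Definition H10 a b : set (R -> R) :=
  [set f | H1 a b f /\
    forall e : R, 0 < e -> exists2 phi, test_fun a b phi &
      \int[mu]_(x in `]a, b[) ((f x - phi x) ^+ 2)
      + \int[mu]_(x in `]a, b[) ((wderiv a b f x - phi^`()%classic x) ^+ 2) < e].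

(* y is the value at c, a point of the closed interval, of the continuous
   representative of f *)
Definition has_trace a b f c y : Prop :=
  exists w, [/\ {within `[a, b], continuous w},
    {ae mu, forall x, `]a, b[%classic x -> f x = w x} & w c = y].

End Sobolev.

(* C_0-semigroups on a subspace H of V for a seminorm N; the underlying
   normed space is the quotient of H by the null vectors of N. *)
Section Semigroup.
Variables (R : realType) (V : lmodType R) (H : set V) (N : V -> R).

Definition C0_semigroup (T : R -> V -> V) : Prop :=
  [/\ forall t U, 0 <= t -> H U -> H (T t U),
      forall t (a : R) U W, 0 <= t -> H U -> H W ->
        N (T t (a *: U + W) - (a *: T t U + T t W)) = 0,
      forall t, 0 <= t -> exists M : R, forall U, H U -> N (T t U) <= M * N U,
      (forall U, H U -> N (T 0 U - U) = 0) /\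
      forall s t U, 0 <= s -> 0 <= t -> H U -> N (T (s + t) U - T s (T t U)) = 0
    & forall U, H U -> N (T t U - U) @[t --> (0 : R)^'+] --> (0 : R)].

Definition generator_at (T : R -> V -> V) (U W : V) : Prop :=
  N (t^-1 *: (T t U - U) - W) @[t --> (0 : R)^'+] --> (0 : R).

Definition generates (D : set V) (A : V -> V) (T : R -> V -> V) : Prop :=
  [/\ C0_semigroup T,
      forall U, D U <-> H U /\ exists2 W, H W & generator_at T U W
    & forall U, D U -> generator_at T U (A U)].

End Semigroup.

Section Thermoelastic.
Variable R : realType.
Local Notation mu := (@lebesgue_measure R).

(* (displacement, velocity, history z(x, rho), temperature) *)
Definition state : lmodType R :=
  ((R -> R^o) * (R -> R^o) * (R * R -> R^o) * (R -> R^o))%type.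

Variables (alpha beta gamma kappa tau ell xi : R).
Local Notation Omega := `]0, ell[%classic.
Local Notation I01 := `]0, 1[%classic.
Local Notation L2Omega := (L2 mu Omega).
Local Notation L2Q := (L2 (mu \x mu)%E (Omega `*` I01)).
Local Notation dx := (wderiv 0 ell).

Definition Hspace : set state := [set U |
  let: (f, g, p, h) := U in
  [/\ H10 0 ell f, L2Omega g, L2Q p, L2Omega h & \int[mu]_(x in Omega) h x = 0]].

Definition inner (U1 U2 : state) : R :=
  let: (f1, g1, p1, h1) := U1 in
  let: (f2, g2, p2, h2) := U2 in
  \int[mu]_(x in Omega)
     (alpha * (dx f1 x * dx f2 x) + g1 x * g2 x + h1 x * h2 x)
  + xi * \int[mu]_(x in Omega) (\int[mu]_(r in I01) (p1 (x, r) * p2 (x, r))).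

Definition Hnorm (U : state) : R := Num.sqrt (inner U U).

(* q = z_rho, for z in L^2(Omega; H^1(0,1)) *)
Definition is_drho (z q : R * R -> R) : Prop :=
  [/\ L2Q z, L2Q q &
      {ae mu, forall x, Omega x ->
         is_wderiv 0 1 (fun r => z (x, r)) (fun r => q (x, r))}].

Definition drho (z : R * R -> R) : R * R -> R :=
  xget (fun=> 0) [set q | is_drho z q].

Definition L2H1 : set (R * R -> R) := [set z | exists q, is_drho z q].

(* w = z(., r) in L^2(Omega), for z in L^2(Omega; H^1(0,1)) *)
Definition is_slice (z : R * R -> R) (r : R) (w : R -> R) : Prop :=
  L2Omega w /\
  {ae mu, forall x, Omega x -> has_trace 0 1 (fun s => z (x, s)) r (w x)}.

Definition slice (z : R * R -> R) (r : R) : R -> R :=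
  xget (fun=> 0) [set w | is_slice z r w].

Definition flux (v : R -> R) (z : R * R -> R) (x : R) : R :=
  alpha * slice z 1 x + beta * dx v x.

Definition domA : set state := [set U |
  let: (u, v, z, theta) := U in
  [/\ Hspace U,
      [/\ H10 0 ell u, H10 0 ell v, L2H1 z & H2 0 ell theta],
      is_slice z 0 (dx u),
      H1 0 ell (flux v z)
    & has_trace 0 ell (dx theta) 0 0 /\ has_trace 0 ell (dx theta) ell 0]].

Definition opA (U : state) : state :=
  let: (u, v, z, theta) := U in
  (v,
   fun x => dx (flux v z) x - gamma * dx theta x,
   fun xr => - tau^-1 * drho z xr,
   fun x => - gamma * dx v x + kappa * dx (dx theta) x).

Definition energy (U : state) : R :=
  let: (u, v, z, theta) := U in
  2^-1 * \int[mu]_(x in Omega) (v x ^+ 2 + alpha * dx u x ^+ 2 + theta x ^+ 2)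
  + xi * \int[mu]_(x in Omega) (\int[mu]_(r in I01) (z (x, r) ^+ 2)).

Definition initial_state (u0 u1 : R -> R) (f0 : R -> R -> R) (theta0 : R -> R)
    : state :=
  (u0, u1, fun xr : R * R => f0 xr.1 (- tau * xr.2), theta0).

End Thermoelastic.

(* Main.v *)
(* For large [beta] the quadratic form [lyapunov] is comparable with the energy,
   and its derivative along the generator is bounded by minus a multiple of
   itself.  The viscous term controls [v_x] and, by Poincare, [v]; the heat
   equation controls [theta_x] and, [theta] having mean zero, [theta].  Damping
   of [u_x] comes from [y = beta u_x - alpha tau int_0^1 z]: since
   [y_t = (alpha z(., 1) + beta v_x) - alpha u_x], the product [y y_t] contains
   [- alpha beta u_x^2], and its terms in [u_x v_x] and [u_x z(., 1)] cancel
   those of [beta u v_t].  The weight [2 - rho] in the history term makes the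
   transport equation dissipate both [z] and [z(., 1)].  This yields the decay
   of classical solutions; Riemann averages of orbits show that the domain is
   dense, and the bound passes to mild solutions by continuity. *)

Require Import Defs.
From HB Require Import structures.
From mathcomp Require Import all_boot all_order all_algebra.
From mathcomp Require Import all_classical all_reals all_analysis.
From mathcomp Require Import measurable_realfun.
From mathcomp Require Import ring lra.

Set Implicit Arguments.
Unset Strict Implicit.
Unset Printing Implicit Defensive.
Import Order.TTheory GRing.Theory Num.Theory.
Import numFieldNormedType.Exports.
Local Open Scope classical_set_scope.
Local Open Scope ring_scope.

(** The definition of a semigroup bounds each [T t] separately. A bound uniform over compact time
    intervals, which the orbit averages and the passage from the domain to all of [H] require, comes
    from the uniform boundedness principle; this is why completeness of the state space has to be
    proved. States are functions rather than classes, so everything runs over a seminorm, and the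
    laws of [T] hold only up to null vectors. Orbits are not integrated: dyadic Riemann sums satisfy
    an exact telescoping identity under a shift by one mesh width, which replaces the fundamental
    theorem of calculus. In the Lyapunov form [v] and [theta] carry the same weight [k * beta], so
    that their two [gamma] coupling terms cancel; the only other [gamma] term, from [beta u v_t], is
    absorbed by the damping of [u_x] and the heat dissipation. That absorption fixes [k] from the
    data without [beta], and every remaining condition holds once [beta] is large. [xi] enters only
    the comparison of norms, so [beta0] does not depend on it. *)

(** * Monotonicity from a one-sided derivative *)

Section Gronwall.
Variable R : realType.

(* The supremum of the times up to which [k <= k 0 + e * t] cannot be smaller
   than [t1]: the bound passes to the supremum by continuity, and beyond it by
   the right derivative. *)
Lemma right_dini_nonincreasing (k : R -> R) (t1 : R) : 0 <= t1 ->
  (forall t, 0 <= t -> forall e, 0 < e -> exists2 d, 0 < d &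
     forall s, 0 <= s -> `|s - t| < d -> `|k s - k t| <= e) ->
  (forall t, 0 <= t -> forall e, 0 < e -> exists2 d, 0 < d &
     forall s, t <= s -> s < t + d -> k s - k t <= e * (s - t)) ->
  k t1 <= k 0.
Proof.
move=> t10 kc kd; apply/ler_addgt0Pr => e' e'0.
pose e := e' / (t1 + 1).
have t11 : 0 < t1 + 1 by lra.
have e0 : 0 < e by rewrite divr_gt0.
suff : k t1 <= k 0 + e * t1.
  move=> h; apply: (le_trans h); rewrite lerD2l /e mulrAC ler_pdivrMr//.
  by rewrite ler_pM2l//; lra.
pose A := [set t : R | 0 <= t <= t1 /\ forall s, 0 <= s <= t -> k s <= k 0 + e * s].
have A0 : A 0.
  split; first by rewrite lexx.
  by move=> s s0; have -> : s = 0; [by lra|by rewrite mulr0 addr0].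
have Aub : ubound A t1 by move=> t [] /andP[].
have hsA : has_sup A by split; [exists 0 | exists t1].
pose t := sup A.
have t0 : 0 <= t by apply: ub_le_sup => //; case: hsA.
have tt1 : t <= t1 by apply: ge_sup => //; exists 0.
have below s : 0 <= s < t -> k s <= k 0 + e * s.
  case/andP=> s0 st.
  have ts : 0 < t - s by rewrite subr_gt0.
  have [u Au su] := sup_adherent ts hsA.
  rewrite subKr in su.
  by case: Au => _; apply; rewrite s0 ltW.
have kt : k t <= k 0 + e * t.
  have [->|tn0] := eqVneq t 0; first by rewrite mulr0 addr0.
  have {tn0} tp : 0 < t by rewrite lt_def tn0.
  apply/ler_addgt0Pr => f f0.
  have [d d0 hd] := kc t t0 f f0.
  pose s := Num.max 0 (t - d / 2).
  have s0 : 0 <= s by rewrite /s le_max lexx.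
  have st : s < t by rewrite /s gt_max tp; lra.
  have sd : t - d / 2 <= s by rewrite /s le_max lexx orbT.
  have := hd s s0; rewrite distrC ger0_norm; last lra.
  move=> /(_ ltac:(lra)); rewrite ler_norml => /andP[h1 _].
  have := below s ltac:(lra).
  have : e * s <= e * t by rewrite ler_pM2l//; lra.
  lra.
have At : A t.
  split; first by rewrite t0.
  move=> s /andP[s0]; rewrite le_eqVlt => /orP[/eqP->//|st].
  by apply: below; rewrite s0.
have [tl|] := ltP t t1; last first.
  move=> h; have <- : t = t1 by apply/eqP; rewrite eq_le tt1.
  exact: kt.
have [d d0 hd] := kd t t0 e e0.
pose u := Num.min t1 (t + d / 2).
have tu : t < u by rewrite /u lt_min tl; lra.
have Au : A u.
  split; first by rewrite (le_trans t0 (ltW tu)) /u ge_min lexx.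
  move=> s /andP[s0 su].
  have [st|ts] := leP s t; first by case: At => _; apply; rewrite s0.
  have su' : s <= t + d / 2 by apply: (le_trans su); rewrite /u ge_min lexx orbT.
  have := hd s (ltW ts) ltac:(lra); nra.
have : u <= t by apply: ub_le_sup => //; case: hsA.
by rewrite leNgt tu.
Qed.

End Gronwall.

Lemma half_expn_le (R : realType) (e : R) : 0 < e ->
  exists n0 : nat, forall n, (n0 <= n)%N -> 2^-1 ^+ n <= e :> R.
Proof.
move=> e0; exists (Num.truncn e^-1).+1 => n hn.
rewrite exprVn -[e]invrK lef_pV2 ?posrE ?exprn_gt0 ?invr_gt0//.
apply/ltW/(lt_le_trans (truncnS_gt _)); rewrite -natrX ler_nat.
by apply: (leq_trans hn); apply: ltnW; exact: ltn_expl.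
Qed.

(** * Bounded operators on complete seminormed spaces *)

Section SeminormedSpace.
Variables (R : realType) (V : lmodType R) (H : set V) (N : V -> R).
Implicit Types (U W X Y Z : V) (T : V -> V) (a e : R).

Definition seminormed : Prop :=
  [/\ H 0, forall a U W, H U -> H W -> H (a *: U + W), forall U, 0 <= N U,
      forall a U, H U -> N (a *: U) = `|a| * N U
    & forall U W, H U -> H W -> N (U + W) <= N U + N W].

(** Only sequences with geometrically small steps are tested. Callers arrange this rate themselves,
    by the choice of step lengths or by passing to a subsequence; the limit is determined up to null
    vectors. *)
Definition complete_seminorm : Prop := forall u : nat -> V,
  (forall n, H (u n)) -> (forall n, N (u n.+1 - u n) <= 2^-1 ^+ n) ->
  exists2 U, H U & forall e, 0 < e -> exists n0 : nat,
    forall n, (n0 <= n)%N -> N (u n - U) <= e.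

(* Linearity is only required up to null vectors of [N]. *)
Definition bounded_linear T : Prop :=
  [/\ forall U, H U -> H (T U),
      forall a U W, H U -> H W -> N (T (a *: U + W) - (a *: T U + T W)) = 0
    & exists M : R, forall U, H U -> N (T U) <= M * N U].

Hypothesis HN : seminormed.
Let H0 : H 0. Proof. by case: HN. Qed.
Let N_ge0 U : 0 <= N U. Proof. by case: HN. Qed.
Let NZ a U : H U -> N (a *: U) = `|a| * N U. Proof. by case: HN => ? ? ? + _; apply. Qed.
Let ND U W : H U -> H W -> N (U + W) <= N U + N W.
Proof. by case: HN => ? ? ? _; apply. Qed.

Lemma seminormed_lin a U W : H U -> H W -> H (a *: U + W).
Proof. by case: HN => ? + _ _ _; apply. Qed.

Lemma seminormedD U W : H U -> H W -> H (U + W).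
Proof. by move=> hU hW; rewrite -[U]scale1r; apply: seminormed_lin. Qed.

Lemma seminormedZ a U : H U -> H (a *: U).
Proof. by move=> hU; rewrite -[_ *: _]addr0; apply: seminormed_lin. Qed.

Lemma seminormedB U W : H U -> H W -> H (U - W).
Proof. by move=> hU hW; rewrite addrC -scaleN1r; apply: seminormed_lin. Qed.

Hint Resolve seminormedD seminormedZ seminormedB : core.

Lemma seminorm0 : N 0 = 0.
Proof. by rewrite -(scale0r (0 : V)) NZ// normr0 mul0r. Qed.

Lemma seminormN U : H U -> N (- U) = N U.
Proof. by move=> hU; rewrite -scaleN1r NZ// normrN1 mul1r. Qed.

Lemma seminormBC U W : H U -> H W -> N (U - W) = N (W - U).
Proof. by move=> hU hW; rewrite -opprB seminormN//; apply: seminormedB. Qed.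

Lemma seminorm_triangle U X W : H U -> H X -> H W ->
  N (U - W) <= N (U - X) + N (X - W).
Proof.
move=> hU hX hW; apply: le_trans (ND _ _); rewrite ?addrA ?subrK//; exact: seminormedB.
Qed.

Lemma seminormB_le U W : H U -> H W -> N U <= N (U - W) + N W.
Proof. by move=> hU hW; apply: le_trans (ND _ _); rewrite ?subrK//; apply: seminormedB. Qed.

Lemma seminorm_eq U W : H U -> H W -> N (U - W) = 0 -> N U = N W.
Proof.
move=> hU hW h; apply/eqP; rewrite eq_le.
rewrite (le_trans (seminormB_le hU hW)) ?h ?add0r//=.
by rewrite (le_trans (seminormB_le hW hU)) // seminormBC// h add0r.
Qed.

Section BoundedLinear.
Variable T : V -> V.
Hypothesis bT : bounded_linear T.
Let HT U : H U -> H (T U). Proof. by case: bT => + _ _; apply. Qed.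
Hint Resolve HT : core.

Lemma bounded_linear_null U : H U -> N U = 0 -> N (T U) = 0.
Proof.
case: bT => _ _ [M hM] hU U0; apply/eqP; rewrite eq_le N_ge0 andbT.
by rewrite (le_trans (hM _ hU))// U0 mulr0.
Qed.

Lemma bounded_linear_lin a U W : H U -> H W ->
  N (T (a *: U + W) - (a *: T U + T W)) = 0.
Proof. by case: bT => _ + _; apply. Qed.

(** Linearity is applied with [W = 0], where [T 0] is merely a null vector; hence an equality of
    seminorms instead of vectors. *)
Lemma bounded_linearZ a U : H U -> N (T (a *: U)) = `|a| * N (T U).
Proof.
move=> hU; have HT0 : H (T 0) by exact: HT.
have h := bounded_linear_lin a hU H0.
rewrite addr0 in h; rewrite (seminorm_eq _ _ h); [|by auto..].
rewrite -NZ//; last by auto.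
apply: seminorm_eq; rewrite ?[a *: T U + _]addrC ?addrK; [by auto..|].
by apply: bounded_linear_null => //; rewrite seminorm0.
Qed.

Lemma bounded_linearB U W : H U -> H W -> N (T U - T W) = N (T (U - W)).
Proof.
move=> hU hW; have := bounded_linear_lin (-1) hW hU; rewrite !scaleN1r => h.
by rewrite [T U - _]addrC [U - W]addrC (seminorm_eq _ _ h)// [- _ + _]addrC; auto.
Qed.

Let S := [set r | exists U, [/\ H U, N U <= 1 & r = N (T U)]].

Let hS : has_sup S.
Proof.
split; first by exists (N (T 0)), 0; rewrite seminorm0; split.
have [_ _ [M hM]] := bT.
exists `|M| => _ [U [hU U1 ->]]; apply: (le_trans (hM _ hU)).
by rewrite (le_trans (ler_wpM2r (N_ge0 U) (ler_norm M)))// ler_piMr.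
Qed.

(** [K] is the supremum of [N (T U)] over the unit ball. The clause with a free [e > 0] serves
    estimates where only an upper bound of [N U] is known; scaling by [e] instead of [N U] also
    covers null vectors. *)
Lemma bounded_linear_opnorm : exists K : R, [/\ 0 <= K,
  forall U e, H U -> 0 < e -> N U <= e -> N (T U) <= K * e,
  forall U, H U -> N (T U) <= K * N U
  & forall c, c < K -> exists U, [/\ H U, N U <= 1 & c < N (T U)]].
Proof.
exists (sup S).
have S0 : S 0.
  by exists 0; split; rewrite ?seminorm0// bounded_linear_null// seminorm0.
have scaled U e : H U -> 0 < e -> N U <= e -> N (T U) <= sup S * e.
  move=> hU e0 Ue; rewrite -ler_pdivrMr//.
  have -> : N (T U) / e = N (T (e^-1 *: U)).
    by rewrite bounded_linearZ// mulrC gtr0_norm// invr_gt0.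
  apply: sup_upper_bound => //; exists (e^-1 *: U); split => //; first by auto.
  by rewrite NZ// gtr0_norm ?invr_gt0// mulrC ler_pdivrMr// mul1r.
split => //.
- exact: sup_upper_bound.
- move=> U hU; have [U0|U0] := eqVneq (N U) 0.
    by rewrite bounded_linear_null// U0 mulr0.
  by apply: scaled => //; rewrite lt_def U0 N_ge0.
- move=> c cK; have c0 : 0 < sup S - c by rewrite subr_gt0.
  have [r [U [hU U1 ->]]] := sup_adherent c0 hS.
  by rewrite subKr => h; exists U.
Qed.

End BoundedLinear.

Hypothesis Nc : complete_seminorm.

(* Sokal's proof: one of [x + y], [x - y] has an image at least as large as
   that of [y], so a fast Cauchy sequence can be chosen whose limit has
   arbitrarily large images. *)
Theorem uniform_boundedness (T : nat -> V -> V) :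
  (forall n, bounded_linear (T n)) ->
  (forall U, H U -> exists c : R, forall n, N (T n U) <= c) ->
  exists2 M : R, 1 <= M & forall n U, H U -> N (T n U) <= M * N U.
Proof.
move=> bT pb; have HT n U : H U -> H (T n U) by case: (bT n) => + _ _; apply.
have /choice[K hK] : forall n, exists K : R, [/\ 0 <= K,
  forall U e, H U -> 0 < e -> N U <= e -> N (T n U) <= K * e,
  forall U, H U -> N (T n U) <= K * N U
  & forall c, c < K -> exists U, [/\ H U, N U <= 1 & c < N (T n U)]].
  by move=> n; exact: bounded_linear_opnorm.
apply: contrapT => unb.
have big (c : R) : exists n, c < K n.
  apply: contrapT => /forallNP h; apply: unb; exists (Num.max 1 c).
    by rewrite le_max lexx.
  move=> n U hU; have [_ _ h2 _] := hK n.
  apply: (le_trans (h2 _ hU)); rewrite ler_wpM2r// le_max; apply/orP; right.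
  by have /negP := h n; rewrite -leNgt.
(* With steps [r k = 3^-k], the partial sum after stage [k] has an image of size at least
   [2/3 * r k * K (f k)], while the remaining steps move the limit by at most [r k / 2] and cost at
   most [1/2 * r k * K (f k)]. What is left is [r k * K (f k) / 6], hence the factor [6 * 3 ^+ k],
   which makes it exceed [k]. *)
have /choice[f hf] (k : nat) : exists n, 6 * 3 ^+ k * k%:R < K n by exact: big.
have Kf0 k : 0 < K (f k).
  by apply: le_lt_trans (hf k); rewrite !mulr_ge0// exprn_ge0.
have /choice[v hv] (k : nat) : exists U, [/\ H U, N U <= 1 & 2 / 3 * K (f k) < N (T (f k) U)].
  by have [_ _ _] := hK (f k); apply; have := Kf0 k; lra.
pose r k : R := 3^-1 ^+ k.
have r0 k : 0 < r k by rewrite exprn_gt0// invr_gt0.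
pose step k x := if N (T (f k) (x - r k *: v k)) <= N (T (f k) (x + r k *: v k))
  then x + r k *: v k else x - r k *: v k.
pose x := fix x n := if n is k.+1 then step k (x k) else 0.
have Hv k : H (v k) by case: (hv k).
have Hx n : H (x n) by elim: n => //= n ih; rewrite /step; case: ifP; auto.
have Nrv k : N (r k *: v k) <= r k.
  by rewrite NZ// gtr0_norm// ler_piMr//; [exact: ltW|case: (hv k)].
have dx k : N (x k.+1 - x k) <= r k.
  rewrite /= /step; case: ifP => _; rewrite addrAC subrr add0r//.
  by rewrite seminormN//; auto.
have large k : r k * (2 / 3 * K (f k)) <= N (T (f k) (x k.+1)).
  have [_ _ /ltW hk] := hv k.
  apply: (@le_trans _ _ (r k * N (T (f k) (v k)))); first by rewrite ler_pM2l.
  have -> : r k * N (T (f k) (v k)) = N (T (f k) (r k *: v k)).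
    by rewrite bounded_linearZ// gtr0_norm.
  set y := r k *: v k; have Hy : H y by rewrite /y; auto.
  have : N (T (f k) (2 *: y)) <= N (T (f k) (x k + y)) + N (T (f k) (x k - y)).
    have -> : 2 *: y = (x k + y) - (x k - y).
      by rewrite opprB addrC addrA subrK scaler_nat mulr2n.
    rewrite -bounded_linearB//; try by auto.
    have h1 : H (T (f k) (x k + y)) by auto.
    have h2 : H (T (f k) (x k - y)) by auto.
    by apply: le_trans (ND _ _) _; rewrite ?seminormN//; rewrite -scaleN1r; auto.
  rewrite bounded_linearZ// ger0_norm//= /step -/y.
  by case: ifP => [|/negbT]; rewrite -?ltNge; lra.
have tail k m : N (x (k.+1 + m)%N - x k.+1) <= r k / 2 - r (k + m)%N / 2.
  elim: m => [|m ih]; first by rewrite !addn0 !subrr seminorm0.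
  apply: (le_trans (seminorm_triangle (Hx _) (Hx (k.+1 + m)%N) (Hx _))).
  have := dx (k.+1 + m)%N; rewrite !addnS !addSn => d1.
  have : r (k + m).+1 = r (k + m)%N / 3 by rewrite /r exprS mulrC.
  by move=> h; rewrite h in d1 *; move: ih; rewrite addSn; lra.
have fast n : N (x n.+1 - x n) <= 2^-1 ^+ n.
  apply: (le_trans (dx n)); rewrite /r; apply: lerXn2r; rewrite ?nnegrE ?invr_ge0//.
  by rewrite lef_pV2 ?posrE// ler_nat.
have [X HX hX] := Nc Hx fast.
have close k : N (X - x k.+1) <= r k / 2.
  apply/ler_addgt0Pr => e e0; have [n0 hn] := hX e e0.
  apply: (le_trans (seminorm_triangle HX (Hx (k.+1 + n0)%N) (Hx _))).
  have := tail k n0; have := r0 (k + n0)%N.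
  have := hn (k.+1 + n0)%N (leq_addl _ _); rewrite seminormBC//; lra.
have [c hc] := pb X HX.
suff : exists k : nat, c < k%:R.
  case=> k ck.
  have : N (T (f k) (x k.+1)) <= N (T (f k) (X - x k.+1)) + N (T (f k) X).
    have h1 : H (T (f k) (x k.+1)) by auto.
    have h2 : H (T (f k) X) by auto.
    by rewrite -bounded_linearB// [N (T _ X - _)]seminormBC//; apply: seminormB_le.
  have [_ h1 _ _] := hK (f k).
  have := h1 _ _ (seminormedB HX (Hx k.+1)) (divr_gt0 (r0 k) (ltr0n _ 2)) (close k).
  have := hc (f k); have := large k.
  have : r k * (6 * 3 ^+ k * k%:R) < r k * K (f k) by rewrite ltr_pM2l.
  have -> : r k * (6 * 3 ^+ k * k%:R) = 6 * k%:R :> R.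
    have : r k * 3 ^+ k = 1 by rewrite /r exprVn mulVf// expf_neq0.
    by move=> h; transitivity (6 * k%:R * (r k * 3 ^+ k)); [ring|rewrite h mulr1].
  lra.
exists (Num.truncn (Num.max 0 c)).+1.
apply: le_lt_trans (truncnS_gt _); by rewrite le_max lexx orbT.
Qed.

End SeminormedSpace.

(** * Decay of quadratic forms along a semigroup *)

Section SemigroupDecay.
Variables (R : realType) (V : lmodType R) (H : set V) (N : V -> R).
Implicit Types (t s r h w d e : R) (U W X Y Z : V) (n m : nat).
Hypothesis HN : seminormed H N.
Hypothesis Nc : complete_seminorm H N.
Variable T : R -> V -> V.
Hypothesis sgT : C0_semigroup H N T.

Let H0 : H 0. Proof. by case: HN. Qed.
Let N_ge0 U : 0 <= N U. Proof. by case: HN. Qed.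
Let NZ a U : H U -> N (a *: U) = `|a| * N U. Proof. by case: HN => ? ? ? + _; apply. Qed.
Let ND U W : H U -> H W -> N (U + W) <= N U + N W.
Proof. by case: HN => ? ? ? _; apply. Qed.
Let HD U W := @seminormedD _ _ _ _ HN U W.
Let HZ a U := @seminormedZ _ _ _ _ HN a U.
Let HB U W := @seminormedB _ _ _ _ HN U W.
Let triangle U X W := @seminorm_triangle _ _ _ _ HN U X W.

Let HT t U : 0 <= t -> H U -> H (T t U).
Proof. by case: sgT => + _ _ _ _; apply. Qed.

Hint Resolve HD HZ HB HT : core.

Lemma C0_semigroup_bounded_linear t : 0 <= t -> bounded_linear H N (T t).
Proof.
move=> t0; case: sgT => h1 h2 h3 _ _; split; [|move=> a U W|]; last exact: h3.
  by move=> U; apply: h1.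
exact: h2.
Qed.
Let bT := C0_semigroup_bounded_linear.

Lemma C0_semigroup_add s t U : 0 <= s -> 0 <= t -> H U ->
  N (T (s + t) U - T s (T t U)) = 0.
Proof. by case: sgT => _ _ _ [_ +] _; apply. Qed.

Lemma cvg_at_right0_le (f : R -> R) : f t @[t --> (0 : R)^'+] --> (0 : R) ->
  (forall t, 0 <= f t) ->
  forall e, 0 < e -> exists2 d, 0 < d & forall t, 0 < t < d -> f t <= e.
Proof.
move=> /cvgrPdist_le f0 f_ge0 e e0; have [d /= d0 hd] := f0 e e0.
exists d => // t /andP[t0 td].
have := hd t; rewrite /= sub0r normrN gtr0_norm// => /(_ td t0).
by rewrite sub0r normrN ger0_norm.
Qed.

Lemma le_cvg_at_right0 (f : R -> R) : (forall t, 0 <= f t) ->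
  (forall e, 0 < e -> exists2 d, 0 < d & forall t, 0 < t < d -> f t <= e) ->
  f t @[t --> (0 : R)^'+] --> (0 : R).
Proof.
move=> f_ge0 h; apply/cvgrPdist_le => e e0; have [d d0 hd] := h e e0.
exists d => //= t; rewrite /= !sub0r !normrN => td t0.
by rewrite ger0_norm// hd// t0/= (le_lt_trans (ler_norm t)).
Qed.

Lemma C0_semigroup_small U e : H U -> 0 < e ->
  exists2 d, 0 < d & forall r, 0 <= r <= d -> N (T r U - U) <= e.
Proof.
move=> hU e0; case: sgT => _ _ _ [T0 _] /(_ U hU) /cvg_at_right0_le h.
have [//|d d0 hd] := h _ _ e0; exists (d / 2); first by rewrite divr_gt0.
move=> r /andP[]; rewrite le_eqVlt => /orP[/eqP<- _|r0 rd].
  by rewrite T0// ltW.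
apply: hd; lra.
Qed.

(** Otherwise there are times [t n] tending to 0 at which the operator norms are unbounded, although
    [T (t n) U] tends to [U] for each [U]; the uniform boundedness principle excludes this. *)
Let local_bound : exists d M : R, [/\ 0 < d, 1 <= M &
  forall t U, 0 <= t <= d -> H U -> N (T t U) <= M * N U].
Proof.
apply: contrapT => unb.
have /choice[t ht] (n : nat) : exists t, 0 <= t <= n.+1%:R^-1 /\
    exists2 U, H U & n.+1%:R * N U < N (T t U).
  apply: contrapT => /forallNP h; apply: unb.
  exists n.+1%:R^-1, n.+1%:R; split; [by rewrite invr_gt0|by rewrite ler1n|].
  move=> t U ht hU; have := h t; rewrite not_andP => -[//|/forall2NP /(_ U)].
  by move=> [//|/negP]; rewrite -leNgt.
have t0 n : 0 <= t n by case: (ht n) => /andP[].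
have [||M M1 hM] := @uniform_boundedness _ _ _ _ HN Nc (fun n => T (t n)).
- by move=> n; exact: bT.
- move=> U hU; have [d d0 hd] := C0_semigroup_small hU ltr01.
  have [n0 hn0] : exists n0 : nat, d^-1 < n0%:R.
    exists (Num.truncn d^-1).+1; exact: truncnS_gt.
  have [c hc] : exists c : R, forall n, (n < n0)%N -> N (T (t n) U) <= c.
    elim: n0 {hn0} => [|n0 [c hc]]; first by exists 0.
    exists (Num.max c (N (T (t n0) U))) => n; rewrite ltnS leq_eqVlt.
    by case/orP=> [/eqP->|/hc h]; rewrite le_max ?lexx ?orbT// h.
  exists (Num.max c (1 + N U)) => n; rewrite le_max.
  have [/hc ->//|nn] := ltnP n n0; apply/orP; right.
  have hTU : H (T (t n) U) by auto.
  apply: (le_trans (seminormB_le HN hTU hU)); rewrite lerD2r; apply: hd.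
  rewrite t0/=; case: (ht n) => /andP[_ tn] _; apply: (le_trans tn).
  rewrite -[d]invrK lef_pV2 ?posrE ?invr_gt0//.
  by apply: ltW; apply: (lt_le_trans hn0); rewrite ler_nat (leq_trans nn).
- have [U hU] : exists2 U, H U & (Num.truncn M).+1%:R * N U < N (T (t (Num.truncn M)) U).
    by case: (ht (Num.truncn M)).
  apply/negP; rewrite -leNgt; apply: (le_trans (hM _ _ hU)).
  by rewrite ler_wpM2r//; apply/ltW/truncnS_gt.
Qed.

Lemma C0_semigroup_bounded t1 : exists2 M : R, 1 <= M &
  forall t U, 0 <= t <= t1 -> H U -> N (T t U) <= M * N U.
Proof.
have [d [M [d0 M1 hM]]] := local_bound.
have M0 : 0 <= M by lra.
have step (n : nat) : exists2 M' : R, 1 <= M' &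
    forall t U, 0 <= t <= n%:R * d -> H U -> N (T t U) <= M' * N U.
  elim: n => [|n [M' M'1 hM']].
    exists M => // t U; rewrite mul0r => t0; apply: hM; lra.
  exists (M * M'); first by rewrite mulr_ege1.
  move=> t U; rewrite -natr1 mulrDl mul1r => /andP[t0 tn] hU.
  have [td|dt] := leP t d.
    apply: (le_trans (hM _ _ _ hU)); first by rewrite t0.
    by rewrite ler_wpM2r// ler_peMr.
  have dt' : 0 <= t - d by lra.
  have d0' := ltW d0.
  have := C0_semigroup_add d0' dt' hU; rewrite [d + _]addrC subrK => h.
  rewrite (seminorm_eq HN _ _ h); [|by auto..].
  apply: (le_trans (hM _ _ _ _)); rewrite ?lexx ?d0'//; first by auto.
  rewrite -mulrA ler_wpM2l//; apply: hM' => //; lra.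
have [M' M'1 h] := step (Num.truncn (t1 / d)).+1.
exists M' => // t U /andP[t0 tt] hU; apply: h => //; rewrite t0 /=.
apply: (le_trans tt); rewrite -ler_pdivrMr//; apply/ltW/truncnS_gt.
Qed.

(** Since [T t U] and [T s (T (t - s) U)] agree up to a null vector, the modulus of continuity of an
    orbit at 0 controls it, up to the factor [M], at later times. *)
Lemma C0_semigroup_modulus t1 M s t U :
  (forall t U, 0 <= t <= t1 -> H U -> N (T t U) <= M * N U) ->
  0 <= s -> s <= t -> t <= t1 -> H U ->
  N (T t U - T s U) <= M * N (T (t - s) U - U).
Proof.
move=> hM s0 st tt hU.
have t0 := le_trans s0 st.
have ts : 0 <= t - s by lra.
have st1 : 0 <= s <= t1 by rewrite s0 (le_trans st).
have h : N (T t U - T s (T (t - s) U)) = 0.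
  by have := C0_semigroup_add s0 ts hU; rewrite [s + _]addrC subrK.
apply: (@le_trans _ _ (N (T s (T (t - s) U) - T s U))).
  have := @triangle (T t U) (T s (T (t - s) U)) (T s U); rewrite h add0r; apply; auto.
rewrite (bounded_linearB HN (bT s0)); [|by auto..].
by apply: hM => //; auto.
Qed.

(** * Riemann averages of orbits *)

Section Averages.
Variables (U : V) (M : R).
(** Times up to 3 leave room for an averaging window of length at most 1 and a shift by at most
    1. *)
Hypotheses (hU : H U) (M1 : 1 <= M)
  (hM : forall t U, 0 <= t <= 3 -> H U -> N (T t U) <= M * N U).
Let M0 : 0 <= M. Proof. exact: le_trans M1. Qed.

(* Riemann sum of [r |-> T r U] over [s, s + h] with [2 ^ n] nodes, divided by [h] *)
Fixpoint orbit_average (n : nat) (s h : R) : V :=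
  if n is m.+1 then
    2^-1 *: (orbit_average m s (h / 2) + orbit_average m (s + h / 2) (h / 2))
  else T s U.
Local Notation avg := orbit_average.

Lemma orbit_average_mem n s h : 0 <= s -> 0 <= h -> H (avg n s h).
Proof.
elim: n s h => /= [|n ih] s h s0 h0; first by auto.
by apply: HZ; apply: HD; apply: ih; lra.
Qed.
Hint Resolve orbit_average_mem : core.

Let half_le X Y X' Y' c : H X -> H Y -> H X' -> H Y' ->
  N (X - X') <= c -> N (Y - Y') <= c ->
  N (2^-1 *: (X + Y) - 2^-1 *: (X' + Y')) <= c.
Proof.
move=> hX hY hX' hY' h1 h2.
rewrite -scalerBr NZ; last by auto.
rewrite opprD addrACA ger0_norm ?invr_ge0//.
have := ND (HB hX hX') (HB hY hY'); lra.
Qed.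

Let halfD (X : V) : X = 2^-1 *: (X + X).
Proof. by rewrite -mulr2n -[X *+ 2]scaler_nat scalerA mulVf ?scale1r// pnatr_eq0. Qed.

Let close s s' w d : (forall r, 0 <= r <= d -> N (T r U - U) <= w) ->
  0 <= s' -> s' <= s -> s <= s' + d -> s <= 3 -> N (T s U - T s' U) <= M * w.
Proof.
move=> hw s'0 ss' sd s3; apply: (le_trans (C0_semigroup_modulus hM _ _ _ _)) => //.
by rewrite ler_wpM2l//; apply: hw; lra.
Qed.

Let average_close n s s' h w d : (forall r, 0 <= r <= d -> N (T r U - U) <= w) ->
  0 <= s' -> s' <= s -> 0 <= h -> s + h <= s' + d -> s + h <= 3 ->
  N (avg n s h - T s' U) <= M * w.
Proof.
move=> hw s'0; elim: n s h => /= [|n ih] s h ss' h0 sd s3; first by apply: close hw _ _ _ _; lra.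
have hs : 0 <= s by lra.
rewrite [T s' U]halfD; apply: half_le; try (by auto); try by apply: orbit_average_mem; lra.
  by apply: ih; lra.
by apply: ih; lra.
Qed.

(** After [n] halvings each window is shorter than [d], so all further nodes of a window stay within
    [M * w] of its left node, and averaging preserves this bound. *)
Lemma orbit_average_refine n m s h w d :
  (forall r, 0 <= r <= d -> N (T r U - U) <= w) ->
  0 <= s -> 0 <= h -> s + h <= 3 -> h / 2 ^+ n <= d ->
  N (avg (n + m) s h - avg n s h) <= M * w.
Proof.
move=> hw; elim: n s h => /= [|n ih] s h s0 h0 s3 hd.
  by apply: average_close hw _ _ _ _ _ => //; move: hd; rewrite expr0; lra.
have hd' : h / 2 / 2 ^+ n <= d by rewrite -mulrA -invfM -exprS.
by apply: half_le; try (apply: orbit_average_mem; lra); apply: ih; lra.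
Qed.

Lemma orbit_average_shift_close n s r h w :
  N (T r U - U) <= w -> 0 <= r -> 0 <= s -> 0 <= h -> s + h + r <= 3 ->
  N (avg n (s + r) h - avg n s h) <= M * w.
Proof.
move=> hw r0; elim: n s h => /= [|n ih] s h s0 h0 s3.
  apply: (le_trans (C0_semigroup_modulus hM _ _ _ _)) => //; [lra|lra|].
  by rewrite ler_wpM2l// addrAC subrr add0r.
by rewrite [s + r + _]addrAC; apply: half_le; try (apply: orbit_average_mem; lra); apply: ih; lra.
Qed.

Lemma orbit_average_semigroup n s r h : 0 <= r -> 0 <= s -> 0 <= h ->
  N (T r (avg n s h) - avg n (r + s) h) = 0.
Proof.
move=> r0; elim: n s h => /= [|n ih] s h s0 h0.
  by rewrite (seminormBC HN) ?C0_semigroup_add//; apply: HT; rewrite ?addr_ge0//; auto.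
have h20 : 0 <= h / 2 by lra.
have sh0 : 0 <= s + h / 2 by lra.
have rs0 : 0 <= r + s by lra.
have rsh0 : 0 <= r + (s + h / 2) by lra.
rewrite -[r + s + _]addrA.
set X := avg n s _; set Y := avg n (s + _) _; set X' := avg n _ _; set Y' := avg n _ _.
have [hX hY hX' hY'] : [/\ H X, H Y, H X' & H Y'] by split; apply: orbit_average_mem.
have hXX' : N (T r X - X') = 0 by exact: ih.
have hYY' : N (T r Y - Y') = 0 by exact: ih.
apply/eqP; rewrite eq_le N_ge0 andbT.
have lin1 : N (T r (2^-1 *: X + 2^-1 *: Y) - (2^-1 *: T r X + T r (2^-1 *: Y))) = 0.
  by rewrite (bounded_linear_lin (bT r0))//; auto.
have lin2 : N (T r (2^-1 *: Y) - 2^-1 *: T r Y) = 0.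
  have := bounded_linear_lin (bT r0) 2^-1 hY H0; rewrite addr0 => e.
  apply/eqP; rewrite eq_le N_ge0 andbT.
  apply: (le_trans (triangle _ (X := 2^-1 *: T r Y + T r 0) _ _)); [by auto..|].
  rewrite e add0r addrAC subrr add0r.
  by rewrite (bounded_linear_null HN (bT r0))// (seminorm0 HN).
rewrite scalerDr; apply: (le_trans (triangle _ (X := 2^-1 *: T r X + T r (2^-1 *: Y)) _ _)); [by auto..|].
rewrite lin1 add0r scalerDr.
apply: (le_trans (triangle _ (X := 2^-1 *: T r X + 2^-1 *: T r Y) _ _)); [by auto..|].
rewrite opprD addrACA subrr add0r lin2 add0r -!scalerDr.
by apply: half_le; rewrite ?hXX' ?hYY'//; auto.
Qed.

(** A shift by one mesh width drops the first node and adds the node [s + h]; all others cancel. The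
    identity is exact and plays the part of differentiating an integral in its endpoints. *)
Lemma orbit_average_shift n s h :
  avg n (s + h / 2 ^+ n) h - avg n s h = 2^-1 ^+ n *: (T (s + h) U - T s U).
Proof.
elim: n s h => /= [|n ih] s h; first by rewrite !expr0 divr1 scale1r.
have e : h / 2 ^+ n.+1 = h / 2 / 2 ^+ n by rewrite -mulrA -invfM -exprS.
rewrite -scalerBr opprD addrACA e ih [s + _ + h / 2]addrAC ih -scalerDr.
rewrite scalerA -exprS -[s + h / 2 + _]addrA -splitr; congr (_ *: _).
by rewrite [LHS]addrC subrKA.
Qed.

(** Each of the [m] shifts contributes [2^-n] times an increment of the orbit over length [h].
    Moving this increment back to time 0 costs [M * w] at its right end and [w <= M * w] at its left
    end, whence [2 * M * w]. *)
Let iterated_shift n m h w : 0 <= h ->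
  (forall r, 0 <= r <= m%:R * (h / 2 ^+ n) -> N (T r U - U) <= w) ->
  h + m%:R * (h / 2 ^+ n) <= 3 ->
  N (avg n (m%:R * (h / 2 ^+ n)) h - avg n 0 h - (m%:R / 2 ^+ n) *: (T h U - U))
    <= m%:R / 2 ^+ n * (2 * M * w).
Proof.
move=> h0; set d := h / 2 ^+ n.
have d0 : 0 <= d by rewrite divr_ge0// exprn_ge0.
have p0 : 0 < 2^-1 ^+ n :> R by rewrite exprn_gt0// invr_gt0.
elim: m => [|m ih] hw h3.
  by rewrite !mul0r subrr scale0r subr0 (seminorm0 HN).
have md0 : 0 <= m%:R * d by rewrite mulr_ge0.
have e1 : m.+1%:R * d = m%:R * d + d by rewrite -natr1 mulrDl mul1r.
have e2 : m.+1%:R / 2 ^+ n = m%:R / 2 ^+ n + 2^-1 ^+ n :> R.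
  by rewrite -natr1 mulrDl mul1r exprVn.
rewrite {}e1 {}e2 in hw h3 *.
set X := T h U - U; set c := m%:R / 2 ^+ n.
have Hd : 0 <= m%:R * d + d by lra.
have hmd : 0 <= m%:R * d + h by lra.
have -> : avg n (m%:R * d + d) h - avg n 0 h - (c + 2^-1 ^+ n) *: X =
   (avg n (m%:R * d) h - avg n 0 h - c *: X) +
   2^-1 ^+ n *: ((T (m%:R * d + h) U - T (m%:R * d) U) - X).
  rewrite [2^-1 ^+ n *: (_ - X)]scalerBr -(orbit_average_shift n (m%:R * d) h) -/d scalerDl opprD.
  by rewrite [RHS]addrACA; congr (_ + _); rewrite [RHS]addrC subrKA.
have hX : H X by rewrite /X; auto.
apply: (le_trans (ND _ _)); try by repeat (apply: HB || apply: HZ || apply: orbit_average_mem || apply: HT).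
rewrite mulrDl; apply: lerD; first by apply: ih => [r hr|]; [apply: hw|]; lra.
rewrite [N (2^-1 ^+ n *: _)]NZ; last by auto.
rewrite [`|2^-1 ^+ n|]gtr0_norm// ler_pM2l//.
have -> : T (m%:R * d + h) U - T (m%:R * d) U - X =
    (T (m%:R * d + h) U - T h U) - (T (m%:R * d) U - U).
  by rewrite [in RHS]opprD [RHS]addrACA -opprD.
have hmdd : 0 <= m%:R * d <= m%:R * d + d by lra.
have hh1 : H (T (m%:R * d + h) U - T h U) by auto.
have hh2 : H (T (m%:R * d) U - U) by auto.
apply: (le_trans (ND hh1 _)); first by rewrite -scaleN1r; auto.
rewrite (seminormN HN)//.
have hmd1 : h <= m%:R * d + h by lra.
have hmd2 : m%:R * d + h <= 3 by lra.
have := C0_semigroup_modulus hM h0 hmd1 hmd2 hU; rewrite addrK.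
have hy := hw _ hmdd; have y0 := N_ge0 (T (m%:R * d) U - U).
have := ler_wpM2l M0 hy; have := ler_peMl (le_trans y0 hy) M1; lra.
Qed.

(** [I] stands for the mean of [T r U] over [r] in [[0, h]]. Averages of arbitrarily high level come
    close to it, which is all that is needed, since the limit is taken along a subsequence of
    levels. *)
Lemma orbit_average_limit h : 0 < h <= 1 -> exists I, [/\ H I,
   forall e, 0 < e -> forall n0 : nat, exists2 n, (n0 <= n)%N & N (avg n 0 h - I) <= e
 & forall w, (forall r, 0 <= r <= h -> N (T r U - U) <= w) -> N (I - U) <= M * w ].
Proof.
move=> /andP[h0 h1]; have h0' := ltW h0.
have /choice[f hf] (k : nat) : exists n, forall r, 0 <= r <= h / 2 ^+ n ->
   N (T r U - U) <= 2^-1 ^+ k / M.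
  have [|d d0 hd] := @C0_semigroup_small U (2^-1 ^+ k / M) hU.
    apply: divr_gt0; first by rewrite exprn_gt0// invr_gt0.
    by apply: lt_le_trans M1.
  have [n hn] := half_expn_le d0; exists n => r /andP[r0 rh]; apply: hd; rewrite r0 /=.
  apply: (le_trans rh); rewrite -exprVn; apply: le_trans (hn n _) => //.
  by rewrite ler_piMl// exprn_ge0// invr_ge0.
(* A strictly increasing choice of levels with [f k <= g k]: consecutive averages refine one another
   and differ by at most [2^-k]. *)
pose g := fix g k := if k is j.+1 then maxn (g j).+1 (f j.+1) else f 0%N.
have gS k : (g k < g k.+1)%N by rewrite /= leq_max leqnn.
have fg k : (f k <= g k)%N by case: k => //= k; rewrite leq_max leqnn orbT.
have kg k : (k <= g k)%N by elim: k => // k ih; exact: leq_ltn_trans (gS k).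
have Hg k : H (avg (g k) 0 h) by apply: orbit_average_mem.
have [|I HI hI] := @Nc (fun k => avg (g k) 0 h) Hg.
  move=> k; rewrite -(subnKC (ltnW (gS k))).
  apply: (le_trans (orbit_average_refine _ (hf k) _ _ _ _)) => //; [lra|..]; last first.
    by rewrite mulrCA mulfV ?mulr1// gt_eqF// (lt_le_trans _ M1).
  rewrite ler_pM2l// lef_pV2 ?posrE ?exprn_gt0// ler_weXn2l// ler1n//.
exists I; split => //.
  move=> e e0 n0; have [k0 hk0] := hI e e0.
  exists (g (maxn n0 k0)); first by rewrite (leq_trans _ (kg _))// leq_maxl.
  by apply: hk0; rewrite leq_maxr.
move=> w hw; apply/ler_addgt0Pr => e e0.
have [k0 hk0] := hI e e0; have := hk0 k0 (leqnn _).
have h3 : h <= 3 by lra.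
have := @average_close (g k0) 0 0 h w h hw (lexx 0) (lexx 0) h0'.
rewrite add0r => /(_ (lexx _) h3) a1 a2.
have a3 : N (T 0 U - U) = 0 by case: sgT => _ _ _ [+ _] _; apply.
apply: (le_trans (triangle HI (Hg k0) hU)).
have hT0 : H (T 0 U) by auto.
have := triangle (Hg k0) hT0 hU.
rewrite (seminormBC HN) // in a2; lra.
Qed.

(** Quantitative form of the fact that the generator maps the mean [I] to [(T h U - U) / h]: [t] is
    replaced by a multiple of a fine mesh, to which [iterated_shift] applies. *)
Lemma orbit_average_generator h I t w : 0 < h <= 1 -> H I ->
  (forall e, 0 < e -> forall n0 : nat, exists2 n, (n0 <= n)%N & N (avg n 0 h - I) <= e) ->
  0 < t <= 1 -> (forall r, 0 <= r <= t -> N (T r U - U) <= w) ->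
  N (T t I - I - (t / h) *: (T h U - U)) <= t / h * (2 * M * w).
Proof.
move=> /andP[h0 h1] HI hI /andP[t0 t1] hw.
have h0' := ltW h0; have t0' := ltW t0.
have w0 : 0 <= w by apply: le_trans (hw 0 _); rewrite ?lexx.
set Z := T h U - U; have hZ : H Z by rewrite /Z; auto.
(* Four approximations enter: [I] by an average under [T t] ([M * e]), [t] by a multiple of the mesh
   ([M * e]), [t / h] by the resulting coefficient ([e * N Z]), and [I] by an average again
   ([e]). *)
suff key e : 0 < e -> N (T t I - I - (t / h) *: Z) <=
    t / h * (2 * M * w) + e * (2 * M + N Z + 1).
  apply/ler_addgt0Pr => e e0.
  have c0 : 0 < 2 * M + N Z + 1 by have := N_ge0 Z; have := M0; lra.
  by have := key _ (divr_gt0 e0 c0); rewrite divfK// gt_eqF.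
move=> e0; have [d d0 hd] := C0_semigroup_small hU e0.
have [n1 hn1] := half_expn_le e0; have [n2 hn2] := half_expn_le d0.
have [n hn hIn] := hI e e0 (maxn n1 n2).
have {}hn1 : 2^-1 ^+ n <= e by apply: hn1; rewrite (leq_trans _ hn)// leq_maxl.
have {}hn2 : 2^-1 ^+ n <= d by apply: hn2; rewrite (leq_trans _ hn)// leq_maxr.
pose dl := h / 2 ^+ n.
have p0 : 0 < 2^-1 ^+ n :> R by rewrite exprn_gt0// invr_gt0.
have dl0 : 0 < dl by rewrite /dl -exprVn mulr_gt0.
have dld : dl <= d by rewrite /dl -exprVn; apply: le_trans hn2; rewrite ler_piMl// ltW.
pose m := Num.truncn (t / dl).
have /andP[ml mu] : m%:R <= t / dl < m.+1%:R by apply: truncn_itv; rewrite divr_ge0// ltW.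
rewrite ler_pdivlMr// in ml; rewrite ltr_pdivrMr// -natr1 mulrDl mul1r in mu.
have md0 : 0 <= m%:R * dl by rewrite mulr_ge0// ltW.
set c : R := m%:R / 2 ^+ n.
have ch : c * h = m%:R * dl by rewrite /c /dl; ring.
have cth : c <= t / h by rewrite ler_pdivlMr// ch.
have thc : t / h - c <= 2^-1 ^+ n.
  rewrite lerBlDr ler_pdivrMr// mulrDl ch exprVn [_ * h]mulrC -/dl; lra.
have hA : H (avg n 0 h) by auto.
have hQ : H (avg n t h) by auto.
have hQ' : H (avg n (m%:R * dl) h) by auto.
set A := avg n 0 h in hA hIn *; set Q := avg n t h in hQ *; set Q' := avg n _ h in hQ' *.
have hcZ x : H (x *: Z) by auto.
have hP : H (T t I) by auto.
have subDr (a b x : V) : a + x - (b + x) = a - b by rewrite opprD addrACA subrr addr0.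
have hX0 : H (T t I - I - (t / h) *: Z) by auto.
have hX1 : H (Q - I - (t / h) *: Z) by auto.
have hX2 : H (Q' - I - (t / h) *: Z) by auto.
have hX3 : H (Q' - I - c *: Z) by auto.
have hX4 : H (Q' - A - c *: Z) by auto.
have s0 : N (T t I - Q) <= M * e.
  have hTA : H (T t A) by auto.
  apply: (le_trans (triangle hP hTA hQ)).
  have := orbit_average_semigroup n t0' (lexx 0) h0'; rewrite addr0 -/A -/Q => ->.
  rewrite addr0 (bounded_linearB HN (bT t0'))//.
  apply: (le_trans (hM _ _)); [lra|by auto|].
  by rewrite (seminormBC HN)// ler_wpM2l.
have s1 : N (Q - Q') <= M * e.
  have := @orbit_average_shift_close n (m%:R * dl) (t - m%:R * dl) h e.
  rewrite [m%:R * dl + (t - _)]addrC subrK -/Q -/Q'; apply => //; [apply: hd|..]; lra.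
have s2 : N ((c - t / h) *: Z) <= e * N Z.
  by rewrite NZ// ler_wpM2r// ler_norml; lra.
have s4 : N (Q' - A - c *: Z) <= t / h * (2 * M * w).
  apply: (le_trans (@iterated_shift n m h w _ _ _)) => //; rewrite -/dl.
  - by move=> r hr; apply: hw; lra.
  - lra.
  - by rewrite ler_wpM2r// !mulr_ge0.
have := triangle hX0 hX1 (HB hP hP); rewrite subrr !subr0 => b0.
have := triangle hX1 hX2 (HB hP hP); rewrite subrr !subr0 => b1.
have := triangle hX2 hX3 (HB hP hP); rewrite subrr !subr0 => b2.
have := triangle hX3 hX4 (HB hP hP); rewrite subrr !subr0 => b3.
move: b0 b1 b2 b3.
rewrite !subDr [Q' - I - _ - _]addrC opprB addrA.
have -> : c *: Z - (Q' - I) + (Q' - I) - (t / h) *: Z = (c - t / h) *: Z.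
  by rewrite subrK scalerBl.
have -> : Q' - I - (Q' - A) = A - I by rewrite opprB addrC addrA subrK.
lra.
Qed.

End Averages.

Variables (D : set V) (A : V -> V).
Hypothesis genT : generates H N D A T.

Lemma generator_dense U e : H U -> 0 < e -> exists2 W, D W & N (W - U) <= e.
Proof.
move=> hU e0; have [M M1 hM] := C0_semigroup_bounded 3.
have M0 : 0 < M by lra.
have [d d0 hd] := C0_semigroup_small hU (divr_gt0 e0 M0).
pose h := Num.min 1 d.
have h0 : 0 < h by rewrite lt_min ltr01.
have h1 : h <= 1 by rewrite ge_min lexx.
have hh : 0 < h <= 1 by rewrite h0.
have [I [HI hI hIU]] := orbit_average_limit hU M1 hM hh.
exists I; last first.
  apply: (le_trans (hIU (e / M) _)); last by rewrite mulrC divfK// gt_eqF.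
  by move=> r /andP[r0 rh]; apply: hd; rewrite r0 (le_trans rh)// ge_min lexx orbT.
have hTU : H (T h U - U) by apply: HB => //; apply: HT => //; exact: ltW.
(* [D] consists of the vectors at which the orbit has a right derivative in [H], so it suffices to
   exhibit that derivative at [I]. *)
have [_ DP _] := genT; apply/DP; split => //; exists (h^-1 *: (T h U - U)); first by auto.
apply: le_cvg_at_right0 => // f f0.
have [d' d'0 hd'] := C0_semigroup_small hU (divr_gt0 (mulr_gt0 f0 h0) (mulr_gt0 (ltr0n _ 2) M0)).
exists (Num.min 1 d'); first by rewrite lt_min ltr01.
move=> t /andP[t0]; rewrite lt_min => /andP[t1 td].
have t01 : 0 < t <= 1 by rewrite t0 ltW.
have hTI : H (T t I) by apply: HT => //; exact: ltW.
have := @orbit_average_generator U M hU M1 hM h I t (f * h / (2 * M)) hh HI hI t01.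
have -> : T t I - I - (t / h) *: (T h U - U) =
    t *: (t^-1 *: (T t I - I) - h^-1 *: (T h U - U)).
  by rewrite [RHS]scalerBr !scalerA mulfV ?gt_eqF// scale1r.
rewrite NZ; last by auto.
rewrite gtr0_norm// => hr.
have : t * N (t^-1 *: (T t I - I) - h^-1 *: (T h U - U)) <= t * f.
  apply: (le_trans (hr _)) => [r /andP[r0 rt]|]; first by apply: hd'; lra.
  rewrite -mulrA ler_pM2l//.
  have -> : h^-1 * (2 * M * (f * h / (2 * M))) = f; last by [].
  by field; rewrite !gt_eqF.
by rewrite ler_pM2l.
Qed.

(** [T t] commutes with [T r] up to null vectors, so the difference quotient at [T t U] is [T t] of
    the difference quotient at [U], and boundedness of [T t] carries the limit over. *)
Lemma generator_invariant t U : 0 <= t -> D U -> D (T t U).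
Proof.
have [_ DP _] := genT; move=> t0 /DP[hU [W hW gW]]; apply/DP; split; first by auto.
exists (T t W); first by auto.
have [M M1 hM] := C0_semigroup_bounded t.
have M0 : 0 < M by lra.
apply: le_cvg_at_right0 => // e e0.
have [//|d d0 hd] := cvg_at_right0_le gW _ (divr_gt0 e0 M0).
exists d => // r rd; have r0 : 0 <= r by case/andP: rd => /ltW.
have tr0 : 0 <= t + r by rewrite addr_ge0.
have hY : H (r^-1 *: (T r U - U)) by auto.
apply: (@le_trans _ _ (N (T t (r^-1 *: (T r U - U)) - T t W))); last first.
  rewrite (bounded_linearB HN (bT t0))//.
  apply: (le_trans (hM _ _ _ _)); rewrite ?lexx ?t0//; first by auto.
  by rewrite mulrC -ler_pdivlMr//; apply: hd.
have hYt : H (T t (r^-1 *: (T r U - U))) by auto.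
have hZ1 : H (r^-1 *: (T r (T t U) - T t U)) by auto.
have hW' : H (T t W) by auto.
apply: (le_trans (triangle hZ1 hYt hW')).
suff -> : N (r^-1 *: (T r (T t U) - T t U) - T t (r^-1 *: (T r U - U))) = 0 by rewrite add0r.
apply/eqP; rewrite eq_le N_ge0 andbT.
have hTrU : H (T r U - U) by auto.
have hc : H (T t (T r U - U)) by auto.
have hc' : H (r^-1 *: T t (T r U - U)) by auto.
apply: (le_trans (triangle hZ1 hc' hYt)).
have -> : N (r^-1 *: T t (T r U - U) - T t (r^-1 *: (T r U - U))) = 0.
  have := bounded_linear_lin (bT t0) r^-1 hTrU H0; rewrite addr0 => e'.
  rewrite (seminormBC HN)//; apply/eqP; rewrite eq_le N_ge0 andbT.
  have hx : H (r^-1 *: T t (T r U - U) + T t 0) by auto.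
  apply: (le_trans (triangle hYt hx hc')).
  rewrite e' add0r addrAC subrr add0r.
  by rewrite (bounded_linear_null HN (bT t0))// (seminorm0 HN).
rewrite addr0 -scalerBr NZ; last by auto.
suff -> : N (T r (T t U) - T t U - T t (T r U - U)) = 0 by rewrite mulr0.
apply/eqP; rewrite eq_le N_ge0 andbT.
have hd1 : H (T t (T r U) - T t U) by auto.
apply: (le_trans (triangle (X := T t (T r U) - T t U) _ _ _)); [by auto..|].
have -> : T r (T t U) - T t U - (T t (T r U) - T t U) = T r (T t U) - T t (T r U).
  by rewrite opprD addrACA subrr addr0.
have -> : N (T t (T r U) - T t U - T t (T r U - U)) = 0.
  have := bounded_linear_lin (bT t0) (-1) hU (HT r0 hU); rewrite !scaleN1r => h.
  by rewrite (seminormBC HN)// [T r U - U]addrC [T t (T r U) - _]addrC.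
rewrite addr0.
apply: (le_trans (triangle (X := T (t + r) U) _ _ _)); [by auto..|].
rewrite C0_semigroup_add// addr0 (seminormBC HN); [|by auto..].
by rewrite [t + r]addrC C0_semigroup_add.
Qed.

Variables (B : V -> V -> R) (K a c : R).
Hypotheses (B_lin : forall b U W X, H U -> H W -> H X ->
    B (b *: U + W) X = b * B U X + B W X)
  (B_sym : forall U W, H U -> H W -> B U W = B W U)
  (B_bound : forall U W, H U -> H W -> `|B U W| <= K * N U * N W)
  (a_gt0 : 0 < a)
  (A_mem : forall U, D U -> H (A U))
  (A_diss : forall U, D U -> 2 * B (A U) U <= - a * B U U).

Let BD U W X : H U -> H W -> H X -> B (U + W) X = B U X + B W X.
Proof. by move=> *; rewrite -[U]scale1r B_lin// mul1r scale1r. Qed.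

Let BZ b U X : H U -> H X -> B (b *: U) X = b * B U X.
Proof.
move=> hU hX; rewrite -[b *: U]addr0 B_lin//.
have := B_lin 1 H0 H0 hX; rewrite scale1r addr0 mul1r; lra.
Qed.

Let Q U := B U U.

Let Q_diff U W : H U -> H W -> Q U - Q W = B (U - W) (U - W) + 2 * B (U - W) W.
Proof.
move=> hU hW; have hd : H (U - W) by auto.
have hs : H (U - W + W) by auto.
have -> : Q U = Q (U - W + W) by rewrite subrK.
move: (U - W) hd hs => d hd hs.
rewrite /Q BD// [B d (_ + _)]B_sym// [B W (_ + _)]B_sym// !BD// (B_sym hW hd); lra.
Qed.

Let Q_cont U W : H U -> H W ->
  `|Q U - Q W| <= `|K| * N (U - W) * (N (U - W) + 2 * N W).
Proof.
move=> hU hW; have hd : H (U - W) by auto.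
rewrite Q_diff//; apply: (le_trans (ler_normD _ _)).
have h1 := B_bound hd hd; have h2 := B_bound hd hW.
rewrite normrM [`|2|]ger0_norm//.
have k1 : K * N (U - W) * N (U - W) <= `|K| * N (U - W) * N (U - W).
  by rewrite -!mulrA ler_wpM2r ?ler_norm// mulr_ge0.
have k2 : K * N (U - W) * N W <= `|K| * N (U - W) * N W.
  by rewrite -!mulrA ler_wpM2r ?ler_norm// mulr_ge0.
lra.
Qed.

Let Q_eq U W : H U -> H W -> N (U - W) = 0 -> Q U = Q W.
Proof.
move=> hU hW h; have := Q_cont hU hW; rewrite h mulr0 mul0r normr_le0 subr_eq0.
by move/eqP.
Qed.

Lemma form_null_eq U W : H U -> H W -> N (U - W) = 0 -> B U U = B W W.
Proof. exact: Q_eq. Qed.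

Let orbit_cont U t e : 0 <= t -> H U -> 0 < e -> exists2 d, 0 < d &
  forall s, 0 <= s -> `|s - t| < d -> N (T s U - T t U) <= e.
Proof.
move=> t0 hU e0; have [M M1 hM] := C0_semigroup_bounded (t + 1).
have M0 : 0 < M by lra.
have [d d0 hd] := C0_semigroup_small hU (divr_gt0 e0 M0).
exists (Num.min 1 d); first by rewrite lt_min ltr01.
move=> s s0; rewrite lt_min => /andP[s1 sd].
have := ler_normlW (ltW s1); have := ler_norml (s - t) d; rewrite (ltW sd) => /esym /andP[l1 l2] l3.
have [st|/ltW ts] := leP s t.
  rewrite (seminormBC HN); [|by auto..].
  apply: (le_trans (C0_semigroup_modulus hM _ _ _ _)) => //; first lra.
  by rewrite mulrC -ler_pdivlMr//; apply: hd; lra.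
apply: (le_trans (C0_semigroup_modulus hM _ _ _ _)) => //; first lra.
by rewrite mulrC -ler_pdivlMr//; apply: hd; lra.
Qed.

Let Q_orbit_cont U t e : 0 <= t -> H U -> 0 < e -> exists2 d, 0 < d &
  forall s, 0 <= s -> `|s - t| < d -> `|Q (T s U) - Q (T t U)| <= e.
Proof.
move=> t0 hU e0; pose c0 := `|K| * (1 + 2 * N (T t U)) + 1.
have c00 : 0 < c0 by rewrite /c0 ltr_wpDl// mulr_ge0// addr_ge0// mulr_ge0.
have m0 : 0 < Num.min 1 (e / c0) by rewrite lt_min ltr01 divr_gt0.
have [d d0 hd] := orbit_cont t0 hU m0.
exists d => // s s0 sd; have := hd s s0 sd; rewrite le_min => /andP[h1 h2].
apply: (le_trans (Q_cont _ _)); [by auto..|].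
rewrite ler_pdivlMr// in h2; apply: le_trans h2.
rewrite [`|K| * _]mulrC -mulrA ler_wpM2l// /c0.
have : `|K| * N (T s U - T t U) <= `|K| * 1 by rewrite ler_wpM2l.
by rewrite !mulrDr; lra.
Qed.

(** With [X = T t U] and [T h X = X + h Y], the increment of [Q] is [h * (2 * B Y X + h * B Y Y)].
    Replacing [Y] by [A X] in the first term costs [e / 2], and the quadratic term is at most
    [e / 2] for small [h]. *)
Let Q_right_derivative U t e : 0 <= t -> D U -> 0 < e -> exists2 d, 0 < d &
  forall h, 0 < h < d -> Q (T (t + h) U) - Q (T t U) <= h * (- a * Q (T t U) + e).
Proof.
move=> t0 DU e0; have DX := generator_invariant t0 DU.
have [_ DP gA] := genT; have hU : H U by case/DP: DU.
set X := T t U in DX *; have hX : H X by case/DP: DX.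
have hA := A_mem DX.
pose k := `|K| * (N X + 1); have k0 : 0 <= k by rewrite mulr_ge0// addr_ge0.
have kp : 0 < 4 * k + 4 by lra.
have m0 : 0 < Num.min 1 (e / (4 * k + 4)) by rewrite lt_min ltr01 divr_gt0.
have [//|d d0 hd] := cvg_at_right0_le (gA X DX) _ m0.
pose l := `|K| * (N (A X) + 1) * (N (A X) + 1).
have l0 : 0 <= l by rewrite !mulr_ge0// addr_ge0.
have lp : 0 < 2 * l + 2 by lra.
exists (Num.min d (e / (2 * l + 2))); first by rewrite lt_min d0 divr_gt0.
move=> h /andP[h0]; rewrite lt_min => /andP[hd1 hd2].
have h0' := ltW h0.
have := hd h; rewrite h0 => /(_ hd1); rewrite le_min => /andP[r1 r2].
have hTX : H (T h X) by auto.
set Y := h^-1 *: (T h X - X) in r1 r2; have hY : H Y by rewrite /Y; auto.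
have eY : T h X = h *: Y + X by rewrite /Y scalerA mulfV ?gt_eqF// scale1r subrK.
clearbody Y.
have -> : Q (T (t + h) U) = Q (h *: Y + X).
  rewrite -eY; apply: Q_eq => //; first by apply: HT; rewrite ?addr_ge0.
  by rewrite [t + h]addrC; exact: C0_semigroup_add.
have hhY : H (h *: Y) by auto.
rewrite Q_diff; [|by auto..].
have qY : B (h *: Y) (h *: Y) = h * (h * B Y Y) by rewrite BZ// B_sym// BZ.
rewrite addrK qY BZ//.
have NY : N Y <= N (A X) + 1.
  by apply: (le_trans (seminormB_le HN hY hA)); rewrite addrC lerD2l.
have h1 : B Y X - B (A X) X <= e / 4.
  have hYA : H (Y - A X) by auto.
  have -> : B Y X - B (A X) X = B (Y - A X) X.
    by rewrite -{1}[Y](subrK (A X)) BD// addrK.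
  apply: (le_trans (ler_norm _)); apply: (le_trans (B_bound hYA hX)).
  rewrite ler_pdivlMr// in r2.
  have q1 : K * N (Y - A X) * N X <= N (Y - A X) * k.
    rewrite /k mulrAC [X in _ <= X]mulrC ler_wpM2r//.
    by rewrite (le_trans (ler_wpM2r (N_ge0 X) (ler_norm K)))// ler_wpM2l//; lra.
  have := N_ge0 (Y - A X); lra.
have h2 : h * B Y Y <= e / 2.
  apply: (@le_trans _ _ (h * l)).
    rewrite ler_pM2l//; apply: (le_trans (ler_norm _)); apply: (le_trans (B_bound hY hY)).
    rewrite /l -!mulrA; apply: (@le_trans _ _ (`|K| * (N Y * N Y))).
      by rewrite ler_wpM2r ?ler_norm// mulr_ge0.
    by rewrite ler_wpM2l// ler_pM.
  rewrite ltr_pdivlMr// in hd2; lra.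
have := A_diss DX; rewrite -/(Q X) => h3.
have -> : h * (h * B Y Y) + 2 * (h * B Y X) = h * (h * B Y Y + 2 * B Y X) by ring.
rewrite ler_pM2l//; lra.
Qed.

(** Only a right derivative of the orbit is available, so [expR (a * s) * Q (T s W)] is shown to be
    nonincreasing by [right_dini_nonincreasing] instead of a mean value theorem. *)
Theorem semigroup_decay U t : (forall U, H U -> 0 <= B U U) -> H U -> 0 <= t ->
  B (T t U) (T t U) <= B U U * expR (- a * t).
Proof.
move=> B_ge0.
have onD W : D W -> 0 <= t -> Q (T t W) <= Q W * expR (- a * t).
  move=> DW t0; have hW : H W by have [_ DP _] := genT; case/DP: DW.
  pose k s := expR (a * s) * Q (T s W).
  have : k t <= k 0.
    apply: right_dini_nonincreasing => // {t t0} t t0 e e0.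
    - pose x := expR (a * t); pose q := `|Q (T t W)|.
      have x0 : 0 < x by exact: expR_gt0.
      have q0 : 0 <= q by exact: normr_ge0.
      have f0 : 0 < e / (2 * x + 2) by rewrite divr_gt0//; lra.
      have [d d0 hd] := Q_orbit_cont t0 hW f0.
      have ce : {for t, continuous (fun s : R => expR (a * s))}.
        apply: continuous_comp; last exact: continuous_expR.
        exact: mulrl_continuous.
      have g0 : 0 < Num.min 1 (e / (2 * q + 2)) by rewrite lt_min ltr01 divr_gt0//; lra.
      move/cvgrPdist_le : ce => /(_ _ g0) [d' /= d'0 hd'].
      exists (Num.min d d'); first by rewrite lt_min d0.
      move=> s s0; rewrite lt_min => /andP[sd sd'].
      have := hd s s0 sd; rewrite ler_pdivlMr; last by lra.
      set p := `|_ - _| => hp.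
      have := hd' s; rewrite /= distrC => /(_ sd'); rewrite -/x distrC le_min => /andP[y1].
      rewrite ler_pdivlMr; last by lra.
      have -> : k s - k t = expR (a * s) * (Q (T s W) - Q (T t W)) + (expR (a * s) - x) * Q (T t W).
        by rewrite /k -/x; ring.
      move=> hy; apply: (le_trans (ler_normD _ _)); rewrite !normrM -/q -/p.
      rewrite gtr0_norm ?expR_gt0//.
      have p0 : 0 <= p by rewrite /p.
      have y2 : expR (a * s) <= x + 1 by move: y1; rewrite ler_norml => /andP[_]; lra.
      have : expR (a * s) * p <= (x + 1) * p by rewrite ler_wpM2r.
      have := normr_ge0 (expR (a * s) - x); lra.
    - have x0 : 0 < expR (a * t) * expR a by rewrite mulr_gt0// expR_gt0.
      have [d d0 hd] := Q_right_derivative t0 DW (divr_gt0 e0 x0).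
      exists (Num.min 1 d); first by rewrite lt_min ltr01.
      move=> s; rewrite le_eqVlt => /orP[/eqP <- _|ts st].
        by rewrite !subrr mulr0.
      pose h := s - t; have hs : s = t + h by rewrite /h addrC subrK.
      have h0 : 0 < h by rewrite subr_gt0.
      have : h < Num.min 1 d by rewrite /h; lra.
      rewrite lt_min => /andP[h1 hd'].
      have := hd h; rewrite h0 hd' => /(_ isT).
      clearbody h; rewrite {}hs [t + h - t]addrC addKr /k [a * (t + h)]mulrDr expRD.
      set q := Q (T t W); set q' := Q _ => hq.
      have q0 : 0 <= q by apply: B_ge0; auto.
      set y := expR (a * h).
      have y0 : 0 < y by exact: expR_gt0.
      (* This is [expR (- a h) >= 1 - a h] multiplied by [y]. Keeping the factor [y] on the right
         lets the term cancel exactly against [- a * q], which is also multiplied by [y]. *)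
      have y1 : y - 1 <= a * h * y.
        have : 1 - a * h <= y^-1 by rewrite /y -expRN; have := expR_ge1Dx (- (a * h)); lra.
        by move=> h1'; have : (1 - a * h) * y <= y^-1 * y; [rewrite ler_pM2r|rewrite mulVf ?gt_eqF//; lra].
      have y2 : y <= expR a by rewrite ler_expR ler_piMr ?(ltW a_gt0) ?(ltW h1).
      set x := expR (a * t); have x0' : 0 < x by exact: expR_gt0.
      have -> : x * y * q' - x * q = x * (y * (q' - q) + (y - 1) * q) by ring.
      have b1 : y * (q' - q) <= y * (h * (- a * q + e / (x * expR a))) by rewrite ler_pM2l.
      have b2 : (y - 1) * q <= a * h * y * q by rewrite ler_wpM2r.
      have b3 : y * (q' - q) + (y - 1) * q <= y * (h * (e / (x * expR a))).
        by move: b1; rewrite !mulrDr; lra.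
      apply: (@le_trans _ _ (x * (y * (h * (e / (x * expR a)))))); first by rewrite ler_pM2l.
      apply: (@le_trans _ _ (x * (expR a * (h * (e / (x * expR a)))))).
        by rewrite ler_pM2l// ler_wpM2r// !mulr_ge0// ?invr_ge0 ltW.
      by rewrite le_eqVlt; apply/orP; left; apply/eqP; field; rewrite !gt_eqF ?expR_gt0.
  rewrite /k mulr0 expR0 mul1r mulNr expRN.
  have -> : Q (T 0 W) = Q W.
    by apply: Q_eq => //; [auto|case: sgT => _ _ _ [+ _] _; apply].
  by rewrite mulrC ler_pdivlMr// expR_gt0.
move=> hU t0; apply/ler_addgt0Pr => e e0.
have [M M1 hM] := C0_semigroup_bounded t.
(* [k1 * r] and [k2 * r] bound the change of [Q] at time [t] and at time 0 when [U] is replaced by a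
   vector [W] of the domain at distance [r <= 1]. *)
pose k1 := `|K| * M * (M + 2 * N (T t U)); pose k2 := `|K| * (1 + 2 * N U).
have k10 : 0 <= k1 by rewrite !mulr_ge0//; [lra|rewrite addr_ge0// ?mulr_ge0//; lra].
have k20 : 0 <= k2 by rewrite !mulr_ge0// addr_ge0// mulr_ge0.
have kp : 0 < k1 + k2 + 1 by lra.
have m0 : 0 < Num.min 1 (e / (k1 + k2 + 1)) by rewrite lt_min ltr01 divr_gt0.
have [W DW] := generator_dense hU m0.
rewrite le_min => /andP[r1 r2].
have hW : H W by have [_ DP _] := genT; case/DP: DW.
rewrite ler_pdivlMr// in r2.
set r := N (W - U) in r1 r2; have r0 : 0 <= r by rewrite /r.
have hTW : H (T t W) by auto.
have hTU : H (T t U) by auto.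
have NT : N (T t W - T t U) <= M * r.
  rewrite (bounded_linearB HN (bT t0))//; apply: (le_trans (hM _ _ _ _)); rewrite ?t0 ?lexx//.
  by auto.
have c1 : Q (T t U) - Q (T t W) <= k1 * r.
  have := Q_cont hTW hTU; rewrite distrC => /(le_trans (ler_norm _)) h; apply: (le_trans h).
  have : N (T t W - T t U) * (N (T t W - T t U) + 2 * N (T t U)) <=
      (M * r) * (M + 2 * N (T t U)).
    apply: ler_pM => //; first by rewrite addr_ge0// mulr_ge0.
    by rewrite lerD2r (le_trans NT)// ler_piMr//; lra.
  by move/(ler_wpM2l (normr_ge0 K)); rewrite /k1; lra.
have c2 : Q W - Q U <= k2 * r.
  apply: (le_trans (ler_norm _)); apply: (le_trans (Q_cont hW hU)).
  have : r * (r + 2 * N U) <= r * (1 + 2 * N U) by rewrite ler_wpM2l//; lra.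
  by move/(ler_wpM2l (normr_ge0 K)); rewrite /k2 -/r; lra.
have := onD W DW t0; rewrite -/(Q _) -/(Q _).
set x := expR _; have x0 : 0 < x by exact: expR_gt0.
have x1 : x <= 1 by rewrite -expR0 ler_expR mulNr oppr_le0 mulr_ge0// ltW.
have : (Q W - Q U) * x <= k2 * r.
  apply: (@le_trans _ _ (k2 * r * x)); first by rewrite ler_wpM2r// ltW.
  by rewrite ler_piMr// mulr_ge0.
move: c1 r2; lra.
Qed.

End SemigroupDecay.

(** * Square-integrable functions *)

Section SquareIntegrable.
Context d (T : measurableType d) (R : realType) (mu : {measure set T -> \bar R}).
Variable D : set T.
Hypothesis mD : measurable D.
Implicit Types (f g h : T -> R) (a b s : R).
Local Notation intg f := (mu.-integrable D (EFin \o f)).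

Lemma integrable_EFinD f g : intg f -> intg g -> intg (fun x => f x + g x).
Proof. exact: integrableD. Qed.

Lemma integrable_EFinZ a f : intg f -> intg (fun x => a * f x).
Proof. exact: integrableZl. Qed.

Lemma integrable_EFinB f g : intg f -> intg g -> intg (fun x => f x - g x).
Proof. exact: integrableB. Qed.

Lemma integrable_EFin_measurable f : intg f -> measurable_fun D f.
Proof. by move/measurable_int/measurable_EFinP. Qed.

Lemma le_integrable_EFin f g : measurable_fun D f ->
  (forall x, D x -> `|f x| <= g x) -> intg g -> intg f.
Proof.
move=> mf fg; apply: le_integrable => //; first exact/measurable_EFinP.
by move=> x Dx; rewrite /= lee_fin (le_trans (fg x Dx))// ler_norm.
Qed.

Lemma ae_eq_Rintegral f g : measurable_fun D f -> measurable_fun D g ->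
  {ae mu, forall x, D x -> f x = g x} ->
  \int[mu]_(x in D) f x = \int[mu]_(x in D) g x.
Proof.
move=> mf mg fg; congr fine; apply: ae_eq_integral => //.
- exact/measurable_EFinP.
- exact/measurable_EFinP.
- by apply: filterS fg => x fg Dx; rewrite fg.
Qed.

Lemma Rintegral_lin a f g : intg f -> intg g ->
  \int[mu]_(x in D) (a * f x + g x) = a * \int[mu]_(x in D) f x + \int[mu]_(x in D) g x.
Proof.
by move=> hf hg; rewrite RintegralD ?RintegralZl//; apply: integrable_EFinZ.
Qed.

Lemma L2_measurable f : L2 mu D f -> measurable_fun D f. Proof. by case. Qed.

Lemma L2_sqr f : L2 mu D f -> intg (fun x => f x ^+ 2). Proof. by case. Qed.

Lemma L2_mul f g : L2 mu D f -> L2 mu D g -> intg (fun x => f x * g x).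
Proof.
move=> [mf f2] [mg g2]; apply: (@le_integrable_EFin _ (fun x => f x ^+ 2 + g x ^+ 2)).
- exact: measurable_funM.
- by move=> x _; rewrite ler_norml; have := sqr_ge0 (f x + g x); have := sqr_ge0 (f x - g x); nra.
- exact: integrable_EFinD.
Qed.

Lemma L2_lin a f g : L2 mu D f -> L2 mu D g -> L2 mu D (fun x => a * f x + g x).
Proof.
move=> Lf Lg; have [mf f2] := Lf; have [mg g2] := Lg; split.
  by apply: measurable_funD => //; apply: measurable_funM.
have -> : (fun x => (a * f x + g x) ^+ 2) =
   (fun x => a ^+ 2 * f x ^+ 2 + (2 * a * (f x * g x) + g x ^+ 2)).
  by apply/funext => x; ring.
apply: integrable_EFinD; first exact: integrable_EFinZ.
by apply: integrable_EFinD => //; apply: integrable_EFinZ; exact: L2_mul.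
Qed.

Lemma L2_0 : L2 mu D (fun=> 0).
Proof.
split; first exact: measurable_cst.
by apply: (eq_integrable _ (cst 0%E)) => //=; [move=> x _; rewrite expr0n|exact: integrable0].
Qed.

Lemma L2D f g : L2 mu D f -> L2 mu D g -> L2 mu D (fun x => f x + g x).
Proof.
by move=> Lf Lg; have := L2_lin 1 Lf Lg; under eq_fun do rewrite mul1r.
Qed.

Lemma L2Z a f : L2 mu D f -> L2 mu D (fun x => a * f x).
Proof.
by move=> Lf; have := L2_lin a Lf L2_0; under eq_fun do rewrite addr0.
Qed.

Lemma L2B f g : L2 mu D f -> L2 mu D g -> L2 mu D (fun x => f x - g x).
Proof.
move=> Lf Lg; have := L2_lin (-1) Lg Lf.
by under eq_fun do rewrite mulN1r addrC.
Qed.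

Lemma Rintegral_sqr_ge0 f : 0 <= \int[mu]_(x in D) (f x ^+ 2).
Proof. by apply: Rintegral_ge0 => x _; exact: sqr_ge0. Qed.

Lemma Rintegral_young f g s : 0 < s -> L2 mu D f -> L2 mu D g ->
  \int[mu]_(x in D) (f x * g x) <=
    s / 2 * \int[mu]_(x in D) (f x ^+ 2) + (2 * s)^-1 * \int[mu]_(x in D) (g x ^+ 2).
Proof.
move=> s0 Lf Lg; have [mf f2] := Lf; have [mg g2] := Lg.
have i2 : intg (fun x => (2 * s)^-1 * g x ^+ 2) by exact: integrable_EFinZ.
rewrite -[X in _ <= _ + X]RintegralZl// -Rintegral_lin//.
apply: le_Rintegral => //; first exact: L2_mul.
  by apply: integrable_EFinD => //; exact: integrable_EFinZ.
move=> x _; rewrite -subr_ge0.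
have -> : s / 2 * f x ^+ 2 + (2 * s)^-1 * g x ^+ 2 - f x * g x = (2 * s)^-1 * (s * f x - g x) ^+ 2.
  by field; rewrite gt_eqF.
by rewrite mulr_ge0 ?sqr_ge0// invr_ge0 mulr_ge0// ltW.
Qed.

Lemma Rintegral_cauchy_schwarz f g : L2 mu D f -> L2 mu D g ->
  (\int[mu]_(x in D) (f x * g x)) ^+ 2 <=
    \int[mu]_(x in D) (f x ^+ 2) * \int[mu]_(x in D) (g x ^+ 2).
Proof.
move=> Lf Lg; set a := \int[mu]_(x in D) (f x ^+ 2); set b := \int[mu]_(x in D) (g x ^+ 2).
set c := \int[mu]_(x in D) _.
have a0 : 0 <= a by exact: Rintegral_sqr_ge0.
have b0 : 0 <= b by exact: Rintegral_sqr_ge0.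
have q t : 0 <= t ^+ 2 * a + (2 * t * c + b).
  have := Rintegral_sqr_ge0 (fun x => t * f x + g x).
  have -> : (fun x => (t * f x + g x) ^+ 2) =
   (fun x => t ^+ 2 * f x ^+ 2 + (2 * t * (f x * g x) + g x ^+ 2)).
    by apply/funext => x; ring.
  rewrite !Rintegral_lin//; [exact: L2_mul|exact: L2_sqr|exact: L2_sqr|].
  by apply: integrable_EFinD; [apply: integrable_EFinZ; exact: L2_mul|exact: L2_sqr].
have [a_eq0|an0] := eqVneq a 0.
  have [->|cn0] := eqVneq c 0; first by rewrite a_eq0 expr0n mul0r.
  (* With [a = 0] the quadratic is affine in [t], and at this [t] it equals [-1]. *)
  have := q (- (b + 1) / (2 * c)); rewrite a_eq0.
  have -> : 2 * (- (b + 1) / (2 * c)) * c = - (b + 1) by field.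
  by lra.
have ap : 0 < a by rewrite lt_def an0.
have := q (- c / a).
have -> : (- c / a) ^+ 2 * a + (2 * (- c / a) * c + b) = (a * b - c ^+ 2) / a.
  by field.
by rewrite pmulr_lge0 ?invr_gt0// subr_ge0.
Qed.

(** Cauchy-Schwarz with weights [2^k]: the first factor on the right is the geometric sum of [2^-k]
    for [n <= k < m]. *)
Lemma sqr_weighted_sum_le (u : nat -> R) n m : (n <= m)%N ->
  (\sum_(n <= k < m) u k) ^+ 2 <=
    (2 * 2^-1 ^+ n - 2 * 2^-1 ^+ m) * \sum_(n <= k < m) 2 ^+ k * u k ^+ 2.
Proof.
move=> /subnKC <-; elim: (m - n)%N => [|j ih].
  by rewrite addn0 !big_geq// expr0n subrr mul0r.
rewrite addnS !big_nat_recr ?leq_addr//=; move: ih.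
set s := \sum_(_ <= k < _) u k; set t := \sum_(_ <= k < _) _ * _.
set a := u _; set k := (n + j)%N => ih.
rewrite [2^-1 ^+ k.+1]exprS; set q := 2^-1 ^+ k in ih *; set p := 2 * _ - _ in ih *.
have q0 : 0 < q by rewrite exprn_gt0 ?invr_gt0.
have p0 : 0 <= p.
  rewrite subr_ge0 ler_pM2l// /q /k exprD ler_piMr ?exprn_ge0 ?invr_ge0//.
  by rewrite exprn_ile1// ?invr_ge0// invf_le1// ler1n.
have t0 : 0 <= t.
  by apply: sumr_ge0 => i _; rewrite mulr_ge0 ?sqr_ge0// exprn_ge0.
have -> : 2 * 2^-1 ^+ n - 2 * (2^-1 * q) = p + q by rewrite /p; field.
have -> : 2 ^+ k = q^-1 :> R by rewrite /q exprVn invrK.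
have qq : q * q^-1 = 1 by rewrite mulfV// gt_eqF.
set z := q^-1 * a ^+ 2.
have qz : q * z = a ^+ 2 by rewrite /z mulrA qq mul1r.
have z0 : 0 <= z by rewrite mulr_ge0 ?sqr_ge0// invr_ge0 ltW.
have h : (s * a) ^+ 2 <= (p * z) * (q * t).
  have -> : p * z * (q * t) = p * t * (q * z) by ring.
  by rewrite exprMn -qz ler_wpM2r// mulr_ge0// ltW.
have amgm : 2 * (s * a) <= p * z + q * t.
  have pz0 : 0 <= p * z by rewrite mulr_ge0.
  have qt0 : 0 <= q * t by rewrite mulr_ge0// ltW.
  have : (2 * (s * a)) ^+ 2 <= (p * z + q * t) ^+ 2.
    have := sqr_ge0 (p * z - q * t); nra.
  have [sa0|/ltW sa0] := leP 0 (s * a); last by lra.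
  by rewrite ler_pXn2r// nnegrE ?addr_ge0// mulr_ge0.
by move: amgm ih qz; rewrite !(mulrDl, mulrDr) sqrrD; lra.
Qed.

(* The limit exists wherever [S = sum 2^k (f_{k+1} - f_k)^2] is finite, and
   Cauchy-Schwarz gives [(f - f_n)^2 <= 2^(1-n) S] there, so that no almost
   everywhere statement is needed. *)
Theorem L2_complete (f : nat -> T -> R) (C : R) : 0 <= C -> (forall n, L2 mu D (f n)) ->
  (forall n, \int[mu]_(x in D) ((f n.+1 x - f n x) ^+ 2) <= C * 4^-1 ^+ n) ->
  exists2 g, L2 mu D g & forall n,
    \int[mu]_(x in D) ((f n x - g x) ^+ 2) <= 4 * C * 2^-1 ^+ n.
Proof.
move=> C0 Lf fast.
pose u k x := f k.+1 x - f k x.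
have Lu k : L2 mu D (u k) by exact: L2B.
pose w k x := (2 ^+ k * u k x ^+ 2)%:E.
have w0 k x : (0 <= w k x)%E by rewrite lee_fin mulr_ge0 ?sqr_ge0// exprn_ge0.
have mw k : measurable_fun D (w k).
  by apply/measurable_EFinP; apply: measurable_funM => //; apply: measurable_funX; case: (Lu k).
pose S x := (\sum_(0 <= k <oo) w k x)%E.
have S0 x : (0 <= S x)%E by apply: nneseries_ge0 => ? _ _; exact: w0.
have mS : measurable_fun D S.
  by apply: ge0_emeasurable_sum => // k x _ _; exact: w0.
have partial n x : ((\sum_(0 <= k < n) 2 ^+ k * u k x ^+ 2)%:E <= S x)%E.
  rewrite -sumEFin; apply: nneseries_lim_ge => *; exact: w0.
have IS : (\int[mu]_(x in D) S x <= (2 * C)%:E)%E.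
  rewrite integral_nneseries//.
  apply: (@le_trans _ _ (\sum_(0 <= k <oo) ((C * 2^-1 ^+ k)%:E))%E); last first.
    apply: lime_le.
      by apply: is_cvg_nneseries => n _ _; rewrite lee_fin mulr_ge0// exprn_ge0// invr_ge0.
    apply: nearW => n; rewrite sumEFin lee_fin -mulr_sumr mulrC ler_wpM2r//.
    have : \sum_(0 <= k < n) 2^-1 ^+ k = 2 - 2 * 2^-1 ^+ n :> R.
      elim: n => [|n ih]; first by rewrite big_geq// expr0 mulr1 subrr.
      by rewrite big_nat_recr//= ih exprS; field.
    by move=> ->; rewrite gerBl mulr_ge0// exprn_ge0// invr_ge0.
  apply: lee_nneseries => [k _ _|k _].
    by apply: integral_ge0 => x _; exact: w0.
  have i2 : intg (fun x => 2 ^+ k * u k x ^+ 2).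
    by apply: integrable_EFinZ; case: (Lu k).
  rewrite -[leLHS]fineK; last exact: integrable_fin_num.
  rewrite lee_fin -/(Rintegral mu D (fun x => 2 ^+ k * u k x ^+ 2)).
  rewrite RintegralZl//; last by case: (Lu k).
  apply: (le_trans (ler_wpM2l _ (fast k))); first by rewrite exprn_ge0.
  by rewrite mulrCA -exprMn; have -> : 2 * 4^-1 = 2^-1 :> R by field.
have tele n m x : (n <= m)%N -> f m x - f n x = \sum_(n <= k < m) u k x.
  by move=> nm; rewrite telescope_sumr.
have bound n m x : (n <= m)%N ->
    (((f m x - f n x) ^+ 2)%:E <= (2 * 2^-1 ^+ n)%:E * S x)%E.
  move=> nm; rewrite tele//.
  apply: (@le_trans _ _ ((2 * 2^-1 ^+ n)%:E * (\sum_(0 <= k < m) 2 ^+ k * u k x ^+ 2)%:E)%E); last first.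
    by apply: lee_wpmul2l => //; rewrite lee_fin mulr_ge0// exprn_ge0// invr_ge0.
  rewrite -EFinM lee_fin; apply: (le_trans (sqr_weighted_sum_le _ nm)).
  apply: ler_pM.
  - rewrite subr_ge0 ler_pM2l// ler_wiXn2l// ?invr_ge0// invf_le1// ler1n//.
  - by apply: sumr_ge0 => i _; rewrite mulr_ge0 ?sqr_ge0// exprn_ge0.
  - by rewrite lerBlDr lerDl mulr_ge0// exprn_ge0// invr_ge0.
  - rewrite [leRHS](@big_cat_nat _ _ _ n)//= lerDr.
    by apply: sumr_ge0 => i _; rewrite mulr_ge0 ?sqr_ge0// exprn_ge0.
pose A := D `&` [set x | (S x < +oo)%E].
have cvgA x : A x -> cvgn (f ^~ x : nat -> R).
  move=> [Dx /= Sx].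
  suff /cauchy_cvgP cs : cauchy (series (u ^~ x) n @[n --> \oo]).
    have -> : f ^~ x = (fun n => series (u ^~ x) n + f 0%N x).
      by apply/funext => n; rewrite /series/= -tele// subrK.
    by apply: is_cvgD => //; exact: is_cvg_cst.
  apply/cauchy_seriesP => e e0.
  have Sf : (S x)%E \is a fin_num by rewrite ge0_fin_numE.
  pose s := fine (S x); have s0 : 0 <= s by exact: fine_ge0.
  have e1 : 0 < e ^+ 2 / (2 * (s + 1)) by rewrite divr_gt0 ?exprn_gt0// mulr_gt0// ltr_wpDl.
  have q1 : `|2^-1 : R| < 1 by rewrite ger0_norm ?invr_ge0// invf_lt1// ltr1n.
  have /cvgrPdist_lt /(_ _ e1) [n0 _ hn0] := cvg_expr q1.
  exists ([set n | (n0 <= n)%N], setT) => /=.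
    by split; [exists n0|exact: filterT].
  move=> [n m] /= [nn0 _]; have [mn|/ltnW nm] := leqP m n.
    by rewrite big_geq// normr0.
  have := bound n m x nm; rewrite tele// -[S x]fineK// -EFinM lee_fin -/s => h.
  have := hn0 n nn0; rewrite /= sub0r normrN gtr0_norm ?exprn_gt0 ?invr_gt0//.
  rewrite ltr_pdivlMr ?mulr_gt0 ?ltr_wpDl// => h'.
  rewrite -(@ltr_pXn2r _ 2) ?nnegrE ?(ltW e0)// real_normK ?num_real//.
  apply: (le_lt_trans h); apply: le_lt_trans h'.
  have : 0 <= 2^-1 ^+ n :> R by rewrite exprn_ge0// invr_ge0.
  by rewrite !mulrDr; lra.
(* Outside [A] the limit is replaced by 0; the pointwise bound below survives on the rest of [D]
   because [S x] is infinite there. *)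
pose g := (fun x => limn (f ^~ x)) \_ A.
have mA : measurable A by exact: emeasurable_fun_infty_o.
have gA x : A x -> f n x @[n --> \oo] --> g x.
  by move=> Ax; rewrite /g patchE mem_set//; exact: cvgA.
have mg : measurable_fun D g.
  apply: (@measurable_fun_cvg _ _ _ _ (fun n => f n \_ A)).
    move=> n; apply/measurable_restrict => //; apply: measurable_funS (L2_measurable (Lf n)) => //.
  move=> x Dx; have [Ax|nAx] := pselect (A x).
    have -> : (fun n => (f n \_ A) x) = f ^~ x by apply/funext => n; rewrite patchE mem_set.
    exact: gA.
  have -> : (fun n => (f n \_ A) x) = cst 0 by apply/funext => n; rewrite patchE memNset.
  by rewrite /g patchE memNset//; exact: cvg_cst.
have gbound n x : D x -> (((f n x - g x) ^+ 2)%:E <= (2 * 2^-1 ^+ n)%:E * S x)%E.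
  move=> Dx; have c0 : 0 < 2 * 2^-1 ^+ n :> R by rewrite mulr_gt0// exprn_gt0// invr_gt0.
  have [Sx|] := boolP (S x < +oo)%E; last first.
    by rewrite ltey negbK => /eqP ->; rewrite gt0_muley ?leey// lte_fin.
  have Sf : (S x)%E \is a fin_num by rewrite ge0_fin_numE.
  rewrite -[S x]fineK// -EFinM lee_fin.
  apply: (@ler_cvg_to _ \oo _ _ (fun m => (f n x - f m x) ^+ 2) (cst (2 * 2^-1 ^+ n * fine (S x)))).
  - have hg : f m x @[m --> \oo] --> g x by apply: gA.
    by rewrite expr2; under eq_fun do rewrite expr2; apply: cvgM; apply: cvgB => //; exact: cvg_cst.
  - exact: cvg_cst.
  - exists n => // m /= nm; rewrite /= -lee_fin [leRHS]EFinM fineK// -sqrrN opprB.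
    exact: bound.
have key n : intg (fun x => (f n x - g x) ^+ 2) /\
    \int[mu]_(x in D) ((f n x - g x) ^+ 2) <= 4 * C * 2^-1 ^+ n.
  have c0 : 0 <= 2 * 2^-1 ^+ n :> R by rewrite mulr_ge0// exprn_ge0// invr_ge0.
  have mfg : measurable_fun D (fun x => ((f n x - g x) ^+ 2)%:E).
    by apply/measurable_EFinP; apply: measurable_funX; apply: measurable_funB => //; case: (Lf n).
  have le4 : (\int[mu]_(x in D) ((f n x - g x) ^+ 2)%:E <= (4 * C * 2^-1 ^+ n)%:E)%E.
    apply: (@le_trans _ _ (\int[mu]_(x in D) ((2 * 2^-1 ^+ n)%:E * S x))%E).
      apply: ge0_le_integral => //.
      - by move=> x _; rewrite lee_fin sqr_ge0.
      - exact: measurable_funeM.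
      - by move=> x; exact: gbound.
    rewrite ge0_integralZl//.
    apply: (@le_trans _ _ ((2 * 2^-1 ^+ n)%:E * (2 * C)%:E)%E); first by rewrite lee_wpmul2l.
    by rewrite -EFinM lee_fin; lra.
  have ige0 : (0 <= \int[mu]_(x in D) ((f n x - g x) ^+ 2)%:E)%E.
    by apply: integral_ge0 => x _; rewrite lee_fin sqr_ge0.
  split.
    apply/integrableP; split => //.
    under eq_integral do rewrite /= ger0_norm ?sqr_ge0//.
    by apply: (le_lt_trans le4); rewrite ltry.
  rewrite -lee_fin /Rintegral fineK// ge0_fin_numE//.
  by apply: (le_lt_trans le4); rewrite ltry.
exists g => [|n]; last by case: (key n).
have L0 : L2 mu D (fun x => f 0%N x - g x).
  split; last by case: (key 0%N).
  by apply: measurable_funB => //; case: (Lf 0%N).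
have := L2B (Lf 0%N) L0; congr L2; apply/funext => x.
by rewrite opprB addrC subrK.
Qed.

End SquareIntegrable.

(** * Test functions *)

Section SmoothBumps.
Variable R : realType.
Implicit Types (f g : R -> R) (x y c d r : R) (n m k : nat).

(** Recursion through the first derivative, unlike the iterated derivatives in [smooth], gives
    closure under sums, products and affine substitutions by induction on [n] with the function left
    general. *)
Fixpoint times_derivable n f : Prop :=
  if n is m.+1 then (forall x, derivable f x 1) /\ times_derivable m (f^`())%classic
  else True.

Definition smooth f : Prop := forall n x, derivable (f^`(n))%classic x 1.

Lemma smoothP f : smooth f <-> forall n, times_derivable n f.
Proof.
split=> [sf n|h n].
  elim: n f sf => [//|n ih] f sf; split; first exact: (sf 0%N).
  by apply: ih => m x; rewrite -derive1Sn; exact: sf.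
elim: n f h => [|n ih] f h x; first by case: (h 1%N).
by rewrite derive1Sn; apply: ih => m; case: (h m.+1).
Qed.

Lemma times_derivableW n f : times_derivable n.+1 f -> times_derivable n f.
Proof. by elim: n f => [//|n ih] f [df h]; split => //; exact: ih. Qed.

Lemma times_derivableD n f g : times_derivable n f -> times_derivable n g ->
  times_derivable n (fun x => f x + g x).
Proof.
elim: n f g => [//|n ih] f g [df hf] [dg hg]; split.
  by move=> x; apply: derivableD.
have -> : ((fun x => f x + g x)^`())%classic = (fun x => (f^`())%classic x + (g^`())%classic x).
  by apply/funext => x; rewrite !derive1E deriveD.
exact: ih.
Qed.

Lemma times_derivableZ n r f : times_derivable n f -> times_derivable n (fun x => r * f x).
Proof.
elim: n f => [//|n ih] f [df hf]; split.
  by move=> x; apply: derivableM => //; exact: derivable_cst.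
have -> : ((fun x => r * f x)^`())%classic = (fun x => r * (f^`())%classic x).
  apply/funext => x; rewrite !derive1E.
  by have -> : (fun x => r * f x) = r \*: f by []; rewrite deriveZ.
exact: ih.
Qed.

Lemma times_derivableM n f g : times_derivable n f -> times_derivable n g ->
  times_derivable n (fun x => f x * g x).
Proof.
elim: n f g => [//|n ih] f g [df hf] [dg hg]; split.
  by move=> x; apply: derivableM.
have -> : ((fun x => f x * g x)^`())%classic =
    (fun x => f x * (g^`())%classic x + g x * (f^`())%classic x).
  by apply/funext => x; rewrite !derive1E deriveM.
by apply: times_derivableD; apply: ih => //; apply: times_derivableW; split.
Qed.

Lemma times_derivable_affine n f r c : times_derivable n f ->
  times_derivable n (fun x => f (r * x + c)).
Proof.
elim: n f => [//|n ih] f [df hf].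
have da x : is_derive x 1 (fun x => r * x + c) r.
  have := is_deriveD (is_deriveZ r (is_derive_id x 1)) (is_derive_cst c x 1).
  by rewrite addr0 /GRing.scale/= mulr1.
have dc x : is_derive x 1 (fun x => f (r * x + c)) ((f^`())%classic (r * x + c) * r).
  apply: (@is_derive1_comp _ f (fun x => r * x + c)).
  by rewrite derive1E; apply: DeriveDef.
split => [x|]; first by case: (dc x).
have -> : ((fun x => f (r * x + c))^`())%classic = (fun x => r * (f^`())%classic (r * x + c)).
  by apply/funext => x; rewrite derive1E derive_val mulrC.
by apply: times_derivableZ; exact: ih.
Qed.

(** The flat function [exp (-1/x)] on the positive half line. The powers of [1/x] make the family
    closed under differentiation up to linear combinations, so all of its members are smooth
    together. *)
Definition flat_exp n x : R := if 0 < x then x^-1 ^+ n * expR (- x^-1) else 0.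

(** From [exp y >= y^(n+3) / (n+3)!] at [y = 1/x]. A bound of third order is more than enough for
    the derivative at 0 to exist and vanish. *)
Lemma flat_exp_le n x : 0 <= flat_exp n x <= n.+3`!%:R * x ^+ 2 * `|x|.
Proof.
rewrite /flat_exp; case: (ltP 0 x) => [x0|_]; last first.
  by rewrite lexx/= mulr_ge0// mulr_ge0// sqr_ge0.
rewrite mulr_ge0 ?expR_ge0 ?exprn_ge0 ?invr_ge0 ?(ltW x0)//=.
rewrite expRN gtr0_norm//.
have y0 : 0 < x^-1 by rewrite invr_gt0.
have f0 : (0 : R) < n.+3`!%:R by rewrite ltr0n fact_gt0.
have := expR_ge1Dxn n.+2 (ltW y0); set e := expR _ => h.
have e0 : 0 < e by exact: expR_gt0.
rewrite ler_pdivrMr//.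
have : x^-1 ^+ n.+3 <= n.+3`!%:R * e.
  by rewrite mulrC -ler_pdivrMr//; lra.
have -> : x^-1 ^+ n = x ^+ 3 * x^-1 ^+ n.+3.
  by rewrite -[n.+3]addn3 exprD mulrCA -exprMn mulfV ?gt_eqF// expr1n mulr1.
move=> h'; rewrite -mulrA -exprSr [X in _ <= X]mulrAC [X in _ <= X]mulrC.
by rewrite ler_pM2l// exprn_gt0.
Qed.

Lemma is_derive_flat_exp n x : is_derive x 1 (flat_exp n)
  (- n%:R * flat_exp n.+1 x + flat_exp n.+2 x).
Proof.
have [x0|x0|->] := ltgtP x 0.
- have e0 : flat_exp n.+1 x = 0 /\ flat_exp n.+2 x = 0.
    by rewrite /flat_exp ltNge (ltW x0).
  rewrite e0.1 e0.2 mulr0 addr0.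
  apply: (@near_eq_is_derive _ _ _ (cst 0)).
  near=> y; rewrite /flat_exp ltNge; suff /ltW -> : y < 0 by [].
  near: y; exact: lt_nbhsl.
- have xn0 : x != 0 by rewrite gt_eqF.
  apply: (@near_eq_is_derive _ _ _ (fun y => y^-1 ^+ n * expR (- y^-1))).
    near=> y; rewrite /flat_exp; suff -> : 0 < y by [].
    near: y; exact: lt_nbhsr.
  have dV : is_derive x 1 (fun y : R => y^-1) (- x^-1 ^+ 2).
    have := is_deriveV xn0 (is_derive_id x 1).
    by rewrite /GRing.scale/= mulr1 exprVn.
  have dE : is_derive x 1 (fun y : R => expR (- y^-1)) (expR (- x^-1) * x^-1 ^+ 2).
    apply: (@is_derive1_comp _ expR (fun y => - y^-1)).
    by rewrite -[x^-1 ^+ 2]opprK; exact: is_deriveN.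
  have -> : (fun y => y^-1 ^+ n * expR (- y^-1)) =
      (fun y => y^-1) ^+ n * (fun y : R => expR (- y^-1)).
    by apply/funext => y; rewrite /= !fctE.
  apply: (is_derive_eq (is_deriveM (is_deriveX n dV) dE)).
  have -> : ((fun y : R => y^-1) ^+ n) x = x^-1 ^+ n by rewrite !fctE.
  rewrite /flat_exp x0 /GRing.scale/=; case: n => [|n].
    by rewrite !expr0 mulr0n; move: (x^-1) (expR _) => y e; ring.
  rewrite /= !exprS; move: (x^-1) (expR _) => y e.
  by move: (y ^+ n) (n.+1%:R) => yn c; ring.
- have -> : flat_exp n.+1 0 = 0 by rewrite /flat_exp ltxx.
  have -> : flat_exp n.+2 0 = 0 by rewrite /flat_exp ltxx.
  have f0 : flat_exp n 0 = 0 by rewrite /flat_exp ltxx.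
  (* The slope function is [flat_exp n z / z], whose value at [z = 0] is 0 because [0^-1 = 0]; the
     cubic bound makes it continuous there. *)
  rewrite mulr0 addr0; apply/is_derive1_caratheodory.
  exists (fun z => flat_exp n z / z); rewrite invr0 mulr0; split => //.
    move=> z; rewrite f0 !subr0; have [->|z0] := eqVneq z 0; first by rewrite f0 mulr0.
    by rewrite divfK.
  apply/cvgrPdist_le => e e0.
  have c0 : (0 : R) < n.+3`!%:R by rewrite ltr0n fact_gt0.
  near=> z; rewrite invr0 mulr0 sub0r normrN normrM.
  have /andP[z1 z2] := flat_exp_le n z.
  have [->|z0] := eqVneq z 0; first by rewrite invr0 normr0 mulr0 ltW.
  rewrite normfV ler_pdivrMr ?normr_gt0// ger0_norm//; apply: (le_trans z2).
  rewrite ler_wpM2r// -real_normK ?num_real// expr2.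
  have h1 : `|z| <= 1.
    near: z; have /cvgrPdist_le /(_ 1 ltr01) : (z : R) @[z --> (0 : R)] --> (0 : R) by exact: cvg_id.
    by apply: filterS => z; rewrite sub0r normrN.
  have h2 : `|z| <= e / n.+3`!%:R.
    near: z; have /cvgrPdist_le /(_ _ (divr_gt0 e0 c0)) : (z : R) @[z --> (0 : R)] --> (0 : R) by exact: cvg_id.
    by apply: filterS => z; rewrite sub0r normrN.
  rewrite ler_pdivlMr// in h2; apply: le_trans h2.
  by rewrite mulrCA ler_wpM2l// mulrC ler_piMl// ltW.
Unshelve. all: by end_near.
Qed.

End SmoothBumps.

Section TestFunctions.
Variable R : realType.
Local Notation mu := (@lebesgue_measure R).
Implicit Types (a b c d x r : R) (f g phi : R -> R) (n k : nat).

Lemma smooth_flat_exp n : smooth (@flat_exp R n).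
Proof.
apply/smoothP => k; elim: k n => [//|k ih] n; split => [x|].
  by case: (is_derive_flat_exp n x).
have -> : ((@flat_exp R n)^`())%classic =
    (fun x => - n%:R * flat_exp n.+1 x + flat_exp n.+2 x).
  by apply/funext => x; rewrite derive1E; case: (is_derive_flat_exp n x).
by apply: times_derivableD => //; exact: times_derivableZ.
Qed.

Lemma smooth_lin r f g : smooth f -> smooth g -> smooth (fun x => r * f x + g x).
Proof.
move=> /smoothP sf /smoothP sg; apply/smoothP => n.
by apply: times_derivableD => //; exact: times_derivableZ.
Qed.

Lemma smoothM f g : smooth f -> smooth g -> smooth (fun x => f x * g x).
Proof.
by move=> /smoothP sf /smoothP sg; apply/smoothP => n; exact: times_derivableM.
Qed.

Lemma smooth_affine r c f : smooth f -> smooth (fun x => f (r * x + c)).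
Proof. by move=> /smoothP sf; apply/smoothP => n; exact: times_derivable_affine. Qed.

Lemma smooth_derive1 f : smooth f -> smooth (f^`())%classic.
Proof. by move=> sf n x; rewrite -derive1Sn; exact: sf. Qed.

Lemma smooth_is_derive f x : smooth f -> is_derive x 1 f ((f^`())%classic x).
Proof. by move=> sf; rewrite derive1E; apply: DeriveDef; have := sf 0%N x. Qed.

Lemma smooth_continuous f : smooth f -> continuous f.
Proof. by move=> sf x; apply/differentiable_continuous/derivable1_diffP; exact: (sf 0%N). Qed.

Lemma smooth_measurable f (D : set R) : measurable D -> smooth f -> measurable_fun D f.
Proof. by move=> mD sf; apply: measurable_funTS; apply: continuous_measurable_fun; exact: smooth_continuous. Qed.

(* As [k] grows, [bump c d k] increases to the indicator of [(c, d)]. *)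
Definition bump c d k x : R :=
  flat_exp 0 (k.+1%:R * x + - (k.+1%:R * c)) * flat_exp 0 (- k.+1%:R * x + k.+1%:R * d).

Lemma flat_exp0_le1 x : 0 <= flat_exp 0 x <= 1.
Proof.
rewrite /flat_exp; case: (ltP 0 x) => [x0|_]; last by rewrite lexx ler01.
by rewrite expr0 mul1r expR_ge0/= -expR0 ler_expR lerNl oppr0 invr_ge0 ltW.
Qed.

Lemma bump_bound c d k x : 0 <= bump c d k x <= 1.
Proof.
have /andP[h1 h2] := flat_exp0_le1 (k.+1%:R * x + - (k.+1%:R * c)).
have /andP[h3 h4] := flat_exp0_le1 (- k.+1%:R * x + k.+1%:R * d).
by rewrite /bump mulr_ge0//= mulr_ile1.
Qed.

Lemma smooth_bump c d k : smooth (bump c d k).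
Proof. by apply: smoothM; apply: smooth_affine; exact: smooth_flat_exp. Qed.

Lemma bump_out c d k x : ~~ (c < x < d) -> bump c d k x = 0.
Proof.
have k0 : (0 : R) < k.+1%:R by rewrite ltr0n.
rewrite negb_and -!leNgt /bump /flat_exp -mulrN -mulrDr mulNr [- _ + _]addrC -mulrBr.
rewrite !pmulr_rgt0// !subr_gt0.
by case/orP => h; [rewrite [c < x]ltNge h mul0r|rewrite [x < d]ltNge h mulr0].
Qed.

Lemma cvg_bump c d x : bump c d k x @[k --> \oo] --> (if c < x < d then 1 else 0 : R).
Proof.
case: ifPn => h; last first.
  by under eq_fun do rewrite bump_out//; exact: cvg_cst.
have flat y : 0 < y -> flat_exp 0 (k.+1%:R * y) @[k --> \oo] --> (1 : R).
  move=> y0.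
  have -> : (fun k => flat_exp 0 (k.+1%:R * y)) = (fun k => expR (- (y^-1 * k.+1%:R^-1))).
    apply/funext => k; rewrite /flat_exp pmulr_rgt0// y0 expr0 mul1r invfM.
    by rewrite [y^-1 * _]mulrC.
  rewrite -[X in _ --> X](@expR0 R).
  have e0 : - (y^-1 * k.+1%:R^-1) @[k --> \oo] --> - (y^-1 * 0).
    apply: cvgN; apply: cvgM; first exact: cvg_cst.
    exact: cvg_harmonic.
  rewrite mulr0 oppr0 in e0.
  apply: (continuous_cvg _ _ e0); exact: continuous_expR.
case/andP: h => h1 h2; rewrite -[X in _ --> X](mulr1 (1 : R)); apply: cvgM.
  have -> : (fun k => flat_exp 0 (k.+1%:R * x + - (k.+1%:R * c))) = (fun k => flat_exp 0 (k.+1%:R * (x - c))).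
    by apply/funext => k; rewrite mulrBr.
  by apply: flat; rewrite subr_gt0.
have -> : (fun k => flat_exp 0 (- k.+1%:R * x + k.+1%:R * d)) = (fun k => flat_exp 0 (k.+1%:R * (d - x))).
  by apply/funext => k; rewrite mulNr addrC mulrBr.
by apply: flat; rewrite subr_gt0.
Qed.

Lemma test_funP a b phi : test_fun a b phi <-> smooth phi /\
  exists c d, [/\ a < c, d < b & forall x, ~~ (c <= x <= d) -> phi x = 0].
Proof.
split=> -[sp [c [d [ac db h]]]]; split => //; exists c, d; split => // x hx; apply: h.
  by move: hx => /negP; rewrite /= in_itv.
by move/negP: hx; rewrite /= in_itv.
Qed.

Lemma test_fun_bump a b c d k : a < c -> d < b -> test_fun a b (bump c d k).
Proof.
move=> ac db; apply/test_funP; split; first exact: smooth_bump.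
exists c, d; split => // x h; apply: bump_out; apply: contra h.
by case/andP => /ltW -> /ltW ->.
Qed.

Lemma test_fun_lin a b r f g : test_fun a b f -> test_fun a b g ->
  test_fun a b (fun x => r * f x + g x).
Proof.
move=> /test_funP[sf [c [d [ac db h]]]] /test_funP[sg [c' [d' [ac' db' h']]]].
apply/test_funP; split; first exact: smooth_lin.
exists (Num.min c c'), (Num.max d d'); split.
- by rewrite lt_min ac.
- by rewrite gt_max db.
- move=> x hx; rewrite h ?h' ?mulr0 ?addr0//; apply: contra hx => /andP[h1 h2].
    by rewrite ge_min h1 le_max h2 !orbT.
  by rewrite ge_min h1 le_max h2.
Qed.

Lemma test_fun0 a b : a < b -> test_fun a b (fun=> 0).
Proof.
move=> ab; apply/test_funP; split; last by exists ((a + b) / 2), ((a + b) / 2); split => //; lra.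
apply/smoothP; elim=> [//|n ih]; split => [x|]; first exact: derivable_cst.
by have -> : ((fun _ : R => 0 : R)^`())%classic = (fun=> 0) by apply/funext => x; rewrite derive1_cst.
Qed.

Lemma test_fun_derive1 a b phi : test_fun a b phi -> test_fun a b (phi^`())%classic.
Proof.
move=> /test_funP[sp [c [d [ac db h]]]]; apply/test_funP; split.
  exact: smooth_derive1.
exists c, d; split => // x hx; rewrite derive1E.
rewrite (@near_eq_derive _ _ _ _ (cst 0)) ?derive_cst//.
move: hx; rewrite negb_and -!ltNge => /orP[xc|dx].
  near=> y; rewrite h// negb_and -!ltNge; apply/orP; left.
  by near: y; exact: lt_nbhsl.
near=> y; rewrite h// negb_and -!ltNge; apply/orP; right.
by near: y; exact: lt_nbhsr.
Unshelve. all: by end_near. Qed.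

Lemma test_fun_bounded a b phi : test_fun a b phi -> exists2 M : R, 0 < M & forall x, `|phi x| <= M.
Proof.
move=> /test_funP[sp [c [d [ac db h]]]].
have [cd|dc] := leP c d; last first.
  exists 1 => // x; rewrite h ?normr0//; apply/negP => /andP[h1 h2].
  by have := le_trans h1 h2; rewrite leNgt dc.
have cp : {within `[c, d], continuous (fun x => `|phi x|)}.
  apply: continuous_subspaceT => x; apply: continuous_comp; first exact: smooth_continuous.
  exact: norm_continuous.
have [e _ he] := EVT_max cd cp.
exists (`|phi e| + 1) => [|x]; first by rewrite ltr_wpDl.
have [hx|hx] := boolP (c <= x <= d).
  by rewrite (le_trans (he x _))// ?lerDl// in_itv.
by rewrite h// normr0 addr_ge0.
Qed.

Let mItv (i : interval R) : measurable ([set` i] : set (measurableTypeR R)) :=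
  measurable_itv i.

Lemma test_fun_measurable a b phi (D : set R) : measurable D ->
  test_fun a b phi -> measurable_fun D phi.
Proof. by move=> mD /test_funP[sp _]; exact: smooth_measurable. Qed.

Lemma integrable_test_funM a b phi (D : set (measurableTypeR R)) f : measurable D ->
  test_fun a b phi -> mu.-integrable D (EFin \o f) ->
  mu.-integrable D (EFin \o (fun x => f x * phi x)).
Proof.
move=> mD tp intf; have [M M0 hM] := test_fun_bounded tp.
apply: (@le_integrable_EFin _ _ _ _ _ mD _ (fun x => M * `|f x|)).
- apply: measurable_funM; first exact: (integrable_EFin_measurable intf).
  exact: test_fun_measurable tp.
- by move=> x _; rewrite normrM mulrC ler_wpM2r.
- by apply: integrable_EFinZ => //; exact: integrable_norm.
Qed.

Lemma integrable_itv_cst a b r : mu.-integrable `]a, b[ (EFin \o (fun=> r)).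
Proof.
apply/integrableP; split; first by apply/measurable_EFinP; exact: measurable_cst.
rewrite /= (integral_cst mu (mItv _)).
have m_lty : (mu (`]a, b[)%classic < +oo)%E.
  by rewrite lebesgue_measure_itv/=; case: ifP => _; rewrite ?ltry// -EFinD ltry.
by apply: lte_mul_pinfty => //; rewrite lee_fin.
Qed.

Lemma L2_bounded a b f M : measurable_fun `]a, b[ f -> (forall x, `|f x| <= M) -> L2 mu `]a, b[ f.
Proof.
move=> mf hM; split => //.
apply: (@le_integrable_EFin _ _ _ _ _ (mItv _) _ (fun=> M ^+ 2)).
- exact: measurable_funX.
- move=> x _; rewrite normrX; apply: lerXn2r => //; rewrite nnegrE//.
  exact: le_trans (hM x).
- exact: integrable_itv_cst.
Qed.

Lemma L2_test_fun a b phi : test_fun a b phi -> L2 mu `]a, b[ phi.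
Proof.
move=> tp; have [M _ hM] := test_fun_bounded tp; apply: L2_bounded hM.
exact: test_fun_measurable tp.
Qed.

Lemma L2_integrable a b f : L2 mu `]a, b[ f -> mu.-integrable `]a, b[ (EFin \o f).
Proof.
move=> Lf; have L1 : L2 mu `]a, b[ (fun=> 1).
  by apply: (@L2_bounded _ _ _ 1) => [|x]; [exact: measurable_cst|rewrite normr1].
have e : (fun x => f x * 1) = f by apply/funext => x; rewrite mulr1.
by have := L2_mul (mItv _) Lf L1; rewrite e.
Qed.

(** The bumps on [(c, d)] are test functions on [(a, b)]; [f] times a bump is dominated by [|f|] and
    converges to [f] restricted to [(c, d)]. *)
Lemma Rintegral_test_fun0 a b c d f : a < c -> d < b ->
  mu.-integrable `]a, b[ (EFin \o f) ->
  (forall phi, test_fun a b phi -> \int[mu]_(x in `]a, b[) (f x * phi x) = 0) ->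
  \int[mu]_(x in `]c, d[) f x = 0.
Proof.
move=> ac db intf f0.
have sub : `]c, d[ `<=` `]a, b[.
  by move=> x /=; rewrite !in_itv/= => /andP[/(lt_trans ac) -> /lt_trans]; apply.
have mf := integrable_EFin_measurable intf.
pose g := f \_ `]c, d[.
have gE x : g x = f x * (if c < x < d then 1 else 0).
  rewrite /g patchE; have [h|h] := boolP (c < x < d).
    by rewrite mem_set ?mulr1//= in_itv.
  by rewrite memNset ?mulr0//=; rewrite in_itv/=; exact/negP.
have [|||||_ _] := @dominated_convergence _ _ _ mu `]a, b[ (mItv _)
  (fun k x => (f x * bump c d k x)%:E) (EFin \o g) (fun x => `|f x|%:E).
- by move=> k; apply/measurable_EFinP; apply: measurable_funM => //; apply: smooth_measurable; [exact: mItv|exact: smooth_bump].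
- apply/measurable_EFinP; apply/measurable_restrict => //.
  by apply: measurable_funS mf => // x [].
- apply: aeW => x _; apply: cvg_EFin; first by apply: nearW.
  rewrite /comp/= gE; apply: cvgM; [exact: cvg_cst|exact: cvg_bump].
- exact: integrable_norm.
- apply: aeW => x k _; rewrite lee_fin normrM ler_piMr// ler_norml.
  by have /andP[h1 h2] := bump_bound c d k x; rewrite h2 (le_trans _ h1)// oppr_le0.
have -> : (fun k => \int[mu]_(x in `]a, b[) (f x * bump c d k x)%:E)%E = cst 0%E.
  apply/funext => k; have := f0 _ (test_fun_bump k ac db).
  rewrite /Rintegral => h0; rewrite -[LHS]fineK ?h0//.
  apply: integrable_fin_num => //.
  exact: integrable_test_funM (test_fun_bump k ac db) intf.
move=> h; have := cvg_unique (@ereal_hausdorff R) h (cvg_cst _).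
rewrite -(setIidr sub) Rintegral_mkcondr /Rintegral -/g.
by move=> ->.
Qed.

End TestFunctions.

(** * Product integrals and primitives *)

Section ProductIntegral.
Context d1 d2 (T1 : measurableType d1) (T2 : measurableType d2) (R : realType).
Variables (m1 : {sigma_finite_measure set T1 -> \bar R}).
Variables (m2 : {sigma_finite_measure set T2 -> \bar R}).
Variables (D1 : set T1) (D2 : set T2).
Hypotheses (mD1 : measurable D1) (mD2 : measurable D2).
Implicit Types F : T1 * T2 -> R.
Local Notation Q := (D1 `*` D2).

Let mQ : measurable Q. Proof. exact: measurableX. Qed.

Let restrE F x : D1 x -> (fun y => (F \_ Q) (x, y)) = (fun y => F (x, y)) \_ D2.
Proof.
move=> Dx; apply/funext => y; rewrite !patchE.
have [D2y|D2y] := pselect (D2 y); first by rewrite !mem_set.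
by rewrite !memNset// => -[].
Qed.

Let restrN F x : ~ D1 x -> (fun y => (F \_ Q) (x, y)) = fun=> 0.
Proof. by move=> Dx; apply/funext => y; rewrite patchE memNset// => -[]. Qed.

Section Integrable.
Variable F : T1 * T2 -> R.
Hypothesis iF : (m1 \x m2)%E.-integrable Q (EFin \o F).

Let iG : (m1 \x m2)%E.-integrable setT (EFin \o (F \_ Q)).
Proof. by rewrite -restrict_EFin; apply/(integrable_mkcond _ mQ); exact: iF. Qed.

Lemma ae_integrable_section :
  {ae m1, forall x, D1 x -> m2.-integrable D2 (EFin \o (fun y => F (x, y)))}.
Proof.
apply: filterS (ae_integrable1 iG) => x ix Dx.
by apply/integrable_mkcond => //; rewrite restrict_EFin -restrE.
Qed.

Let fubiniE x : \int[m2]_(y in D2) F (x, y) = fine (fubini_F m2 (EFin \o (F \_ Q)) x) \/ ~ D1 x.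
Proof.
have [Dx|nDx] := pselect (D1 x); [left|by right].
by rewrite Rintegral_mkcond -restrE.
Qed.

Let mfine : measurable_fun D1 (fun x => \int[m2]_(y in D2) F (x, y)).
Proof.
apply: (eq_measurable_fun (fun x => fine (fubini_F m2 (EFin \o (F \_ Q)) x))).
  by move=> x /set_mem Dx; case: (fubiniE x) => // ->.
apply: measurableT_comp => //; apply: measurable_funTS.
exact: (measurable_int _ (integrable_fubini_F iG)).
Qed.

(** The real-valued inner integral is [fine] of the extended one, and [fine] loses infinite values.
    They occur only on a null set, so Fubini passes to real integrals through this almost everywhere
    identity. *)
Let ae_fin : {ae m1, forall x, D1 x ->
  fubini_F m2 (EFin \o (F \_ Q)) x = (\int[m2]_(y in D2) F (x, y))%:E}.
Proof.
apply: filterS (ae_integrable1 iG) => x ix Dx.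
case: (fubiniE x) => // ->; rewrite fineK//.
exact: integrable_fin_num.
Qed.

Lemma integrable_section_Rintegral :
  m1.-integrable D1 (EFin \o (fun x => \int[m2]_(y in D2) F (x, y))).
Proof.
have iF1 : m1.-integrable D1 (fubini_F m2 (EFin \o (F \_ Q))).
  exact: (integrableS measurableT mD1 (@subsetT _ _) (integrable_fubini_F iG)).
apply/integrableP; split; first exact/measurable_EFinP.
case/integrableP : iF1 => mf; apply: le_lt_trans.
rewrite le_eqVlt; apply/orP; left; apply/eqP; apply: ae_eq_integral => //.
- by apply: measurableT_comp => //; exact/measurable_EFinP.
- exact: measurableT_comp.
- by apply: filterS ae_fin => x /= h Dx; rewrite h.
Qed.

Lemma Rintegral_product :
  \int[m1]_(x in D1) (\int[m2]_(y in D2) F (x, y)) = \int[(m1 \x m2)%E]_(z in Q) F z.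
Proof.
rewrite [RHS]Rintegral_mkcond /Rintegral -(integral12_prod_meas1 iG); congr fine.
have mf := measurable_int _ (integrable_fubini_F iG).
rewrite [RHS](_ : _ = \int[m1]_(x in D1) fubini_F m2 (EFin \o (F \_ Q)) x)%E; last first.
  rewrite [RHS]integral_mkcond; apply: eq_integral => x _; rewrite patchE.
  case: ifPn => // /negP nDx; rewrite /fubini_F /=.
  have := restrN F (fun Dx => nDx (mem_set Dx)) => e.
  transitivity (\int[m2]_y (0%:E : \bar R))%E; last exact: integral0.
  by apply: eq_integral => y _; rewrite (congr1 (fun g => g y) e).
apply: ae_eq_integral => //.
- exact/measurable_EFinP.
- exact: measurable_funTS.
- by apply: filterS ae_fin => x h Dx; rewrite h.
Qed.

End Integrable.
End ProductIntegral.

Section ProductSwap.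
Context d1 d2 (T1 : measurableType d1) (T2 : measurableType d2) (R : realType).
Variables (m1 : {sigma_finite_measure set T1 -> \bar R}).
Variables (m2 : {sigma_finite_measure set T2 -> \bar R}).

Lemma Rintegral_swap (F : T1 * T2 -> R) :
  (m1 \x m2)%E.-integrable setT (EFin \o F) ->
  \int[m1]_x (\int[m2]_y F (x, y)) = \int[m2]_y (\int[m1]_x F (x, y)).
Proof.
move=> iF.
have iF' : (m1 \x m2)%E.-integrable ([set: T1] `*` [set: T2]) (EFin \o F) by rewrite setXTT.
rewrite (Rintegral_product measurableT measurableT iF') setXTT /Rintegral -(integral21_prod_meas1 iF); congr fine.
have mf := measurable_fubini_G iF.
apply: ae_eq_integral => //.
- apply/measurable_EFinP; apply: measurableT_comp => //.
- apply: filterS (ae_integrable2 iF) => y iy _.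
  by rewrite /fubini_G/= fineK//; exact: integrable_fin_num.
Qed.

(** [g] will be the indicator of the half plane [y <= x], on which Fubini yields integration by
    parts. *)
Lemma integrable_product_mul (p : T1 -> R) (q : T2 -> R) (g : T1 * T2 -> R) :
  measurable_fun setT g -> (forall z, `|g z| <= 1) ->
  m1.-integrable setT (EFin \o p) -> m2.-integrable setT (EFin \o q) ->
  (m1 \x m2)%E.-integrable setT (EFin \o (fun z => p z.1 * q z.2 * g z)).
Proof.
move=> mg g1 ip iq.
have mp := integrable_EFin_measurable ip; have mq := integrable_EFin_measurable iq.
have mpq : measurable_fun setT (fun z : T1 * T2 => p z.1 * q z.2).
  by apply: measurable_funM; apply: measurableT_comp.
have mall : measurable_fun setT (fun z : T1 * T2 => p z.1 * q z.2 * g z).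
  exact: measurable_funM.
apply: (@le_integrable_EFin _ _ _ _ _ _ _ (fun z => `|p z.1 * q z.2|)) => //.
  by move=> z _; rewrite normrM ler_piMr.
apply: integrable_norm; apply/integrable12ltyP; first exact/measurable_EFinP.
rewrite (_ : \int[m1]_x _ = \int[m1]_x (`|(p x)%:E| * \int[m2]_y `|(q y)%:E|))%E; last first.
  apply: eq_integral => x _ /=.
  rewrite -ge0_integralZl//.
  - by apply: eq_integral => y _; rewrite normrM EFinM.
  - by apply/measurable_EFinP; exact: measurableT_comp.
case/integrableP: ip => _ ip; case/integrableP: iq => _ iq.
have q0 : (0 <= \int[m2]_y `|(q y)%:E|)%E by exact: integral_ge0.
rewrite ge0_integralZr//.
  by apply: lte_mul_pinfty => //; [exact: integral_ge0|rewrite ge0_fin_numE//; exact: integral_ge0].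
by apply/measurable_EFinP; exact: measurableT_comp.
Qed.

End ProductSwap.

Section LebesgueAe.
Variable R : realType.
Local Notation mu := (@lebesgue_measure R).

Lemma ae_mono (P Q : R -> Prop) : (forall x, P x -> Q x) ->
  {ae mu, forall x, P x} -> {ae mu, forall x, Q x}.
Proof. by move=> PQ; apply: filterS; first exact: (ae_filter_ringOfSetsType mu). Qed.

Lemma ae_mono2 (P Q S : R -> Prop) : (forall x, P x -> Q x -> S x) ->
  {ae mu, forall x, P x} -> {ae mu, forall x, Q x} -> {ae mu, forall x, S x}.
Proof. by move=> PQS; apply: filterS2; first exact: (ae_filter_ringOfSetsType mu). Qed.

End LebesgueAe.

Section Primitive.
Variable R : realType.
Local Notation mu := (@lebesgue_measure R).
Implicit Types (a b c d x y : R) (f g h p q : R -> R).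
Local Notation intT h := (mu.-integrable setT (EFin \o h)).

Let mItv (i : interval R) : measurable ([set` i] : set (measurableTypeR R)) :=
  measurable_itv i.

Lemma integrable_itvS (i : interval R) h : intT h -> mu.-integrable [set` i] (EFin \o h).
Proof. by move=> ih; exact: (integrableS measurableT (mItv i) (@subsetT _ _) ih). Qed.

(** Integrating from [-oo] makes the primitive depend on [h] alone; functions on an interval are
    first extended by 0. *)
Definition prim h x : R := \int[mu]_(t in `]-oo, x]) h t.

Lemma primB h x y : intT h -> x <= y -> prim h y - prim h x = \int[mu]_(t in `]x, y[) h t.
Proof.
move=> ih xy; rewrite /prim Rintegral_itvB ?bnd_simp//; last exact: integrable_itvS.
by rewrite Rintegral_itv_bndo_bndc//; exact: integrable_itvS.
Qed.

Let Rintegral_indicator (i : interval R) h :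
  \int[mu]_(t in [set` i]) h t = \int[mu]_t (h t * (t \in i)%:R).
Proof.
rewrite Rintegral_mkcond; apply: eq_Rintegral => t _; rewrite patchE.
by rewrite mem_setE; case: ifP => _; rewrite ?mulr1 ?mulr0.
Qed.

Let integrable_indicator (i : interval R) h : intT h -> intT (fun t => h t * (t \in i)%:R).
Proof.
move=> ih; have := (@integrable_mkcond _ _ _ mu _ (EFin \o h) (mItv i)).1 (@integrable_itvS i h ih).
rewrite restrict_EFin; congr (_.-integrable _ _); apply/funext => t /=.
by congr EFin; rewrite patchE mem_setE; case: ifP => _; rewrite ?mulr1 ?mulr0.
Qed.

Lemma prim_bound h x : intT h -> `|prim h x| <= \int[mu]_t `|h t|.
Proof.
move=> ih; rewrite /prim Rintegral_indicator.
have ii := @integrable_indicator `]-oo, x] h ih.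
apply: (le_trans (le_normr_Rintegral measurableT ii)).
apply: le_Rintegral => //; [exact: integrable_norm|exact: integrable_norm|].
move=> t _; rewrite normrM; case: (_ \in _); rewrite ?normr1 ?mulr1// normr0 mulr0//.
Qed.

Lemma prim_continuous h : intT h -> continuous (prim h).
Proof.
move=> ih x; have xx : x - 1 < x + 1 by lra.
have := parameterized_integral_continuous (ltW xx) (@integrable_itvS `[x - 1, x + 1] h ih).
move/(continuous_within_itvP _ xx) => [hc _ _].
have {}hc := hc x ltac:(by rewrite in_itv/=; lra).
have e : {near x, (fun y => prim h (x - 1) + parameterized_integral mu (x - 1) y h) =1 prim h}.
  near=> y; have xy : x - 1 <= y.
    near: y; have := @lt_nbhsr R (x - 1) x ltac:(lra); apply: filterS => y; exact: ltW.
  rewrite /parameterized_integral -Rintegral_itv_obnd_cbnd; last exact: integrable_itvS.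
  rewrite -Rintegral_itv_bndo_bndc; last exact: integrable_itvS.
  by rewrite -primB// addrC subrK.
rewrite /continuous_at -(nbhs_singleton e).
apply: (cvg_trans (near_eq_cvg e)).
by apply: cvgD; [exact: cvg_cst|exact: hc].
Unshelve. all: by end_near. Qed.

Lemma prim_measurable h (D : set (measurableTypeR R)) : intT h -> measurable_fun D (prim h).
Proof.
move=> ih; apply: measurable_funTS; apply: continuous_measurable_fun.
exact: prim_continuous.
Qed.

Lemma integrable_mul_prim p q : intT p -> intT q -> intT (fun x => p x * prim q x).
Proof.
move=> ip iq; apply: (@le_integrable_EFin _ _ _ mu _ measurableT _ (fun x => \int[mu]_t `|q t| * `|p x|)) => //.
- by apply: measurable_funM; [exact: integrable_EFin_measurable ip|exact: prim_measurable].
- by move=> x _; rewrite normrM mulrC ler_wpM2r//; exact: prim_bound.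
- by apply: integrable_EFinZ => //; exact: integrable_norm.
Qed.

(** Fubini for [p x * q y] on the half plane [y <= x]: one order of integration gives [p * prim q],
    the other the product of the total integrals minus [q * prim p]. *)
Lemma prim_parts p q : intT p -> intT q ->
  \int[mu]_x (p x * prim q x) = \int[mu]_x p x * \int[mu]_x q x - \int[mu]_x (q x * prim p x).
Proof.
move=> ip iq.
have mind : measurable_fun setT (fun z : measurableTypeR R * measurableTypeR R => ((z.2 <= z.1)%R%:R : R)).
  apply: measurableT_comp => //.
  exact: (measurable_fun_ler measurable_snd measurable_fst).
have ind1 (z : R * R) : `|((z.2 <= z.1)%R%:R : R)| <= 1.
  by case: (z.2 <= z.1); rewrite ?normr1 ?normr0.
have iF := integrable_product_mul mind ind1 ip iq.
have := Rintegral_swap iF => /=.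
under eq_Rintegral => x _.
  have -> : (fun y => p x * q y * (y <= x)%R%:R) = (fun y => p x * (q y * (y \in `]-oo, x])%:R)).
    by apply/funext => y; rewrite in_itv/= mulrA.
  rewrite RintegralZl//; last exact: integrable_indicator.
  rewrite -Rintegral_indicator -/(prim q x).
  over.
move=> ->.
have e y : \int[mu]_x (p x * q y * (y <= x)%R%:R) = \int[mu]_x p x * q y - q y * prim p y.
  have -> : (fun x => p x * q y * (y <= x)%R%:R) = (fun x => q y * (p x - p x * (x \in `]-oo, y[)%:R)).
    apply/funext => x; rewrite in_itv/= ltNge; case: (y <= x); rewrite /= ?mulr1 ?mulr0; ring.
  rewrite RintegralZl//; last by apply: integrable_EFinB => //; exact: integrable_indicator.
  rewrite RintegralB//; last exact: integrable_indicator.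
  rewrite -Rintegral_indicator Rintegral_itv_bndo_bndc; last exact: integrable_itvS.
  by rewrite -/(prim p y) mulrBr mulrC.
under eq_Rintegral => y _ do rewrite e.
rewrite RintegralB//; last exact: integrable_mul_prim; last exact: integrable_EFinZ.
by rewrite RintegralZl.
Qed.

(** The primitive of [h] is locally constant on [(a, b)], and by Lebesgue differentiation its
    derivative is [h] almost everywhere. *)
Lemma ae_zero_of_itv a b h : intT h ->
  (forall c d, a < c -> d < b -> \int[mu]_(x in `]c, d[) h x = 0) ->
  {ae mu, forall x, `]a, b[%classic x -> h x = 0}.
Proof.
move=> ih h0.
have loc : locally_integrable setT h.
  by have := integrable_locally measurableT ih; rewrite patch_setT.
have := FTC1Ny (fun y => @integrable_itvS `]-oo, y] h ih) loc.
apply: filterS; first exact: (ae_filter_ringOfSetsType mu).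
move=> x [dx <-] /=; rewrite in_itv/= => /andP[ax xb].
rewrite derive1E (@near_eq_derive _ _ _ _ (cst (prim h x))) ?derive_cst//.
near=> y; rewrite /cst -/(prim h y).
have ay : a < y by near: y; exact: lt_nbhsr.
have yb : y < b by near: y; exact: lt_nbhsl.
have [xy|/ltW yx] := leP x y.
  by apply/eqP; rewrite -subr_eq0 primB// h0.
by apply/esym/eqP; rewrite -subr_eq0 primB// h0.
Unshelve. all: by end_near. Qed.

End Primitive.

(** * Sobolev functions on an interval *)

Section Sobolev1D.
Variable R : realType.
Local Notation mu := (@lebesgue_measure R).
Implicit Types (a b c d e x y r : R) (f g h p q phi : R -> R).
Local Notation intT h := (mu.-integrable setT (EFin \o h)).

Let mItv (i : interval R) : measurable ([set` i] : set (measurableTypeR R)) :=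
  measurable_itv i.

Lemma integrable_ext a b f : mu.-integrable `]a, b[ (EFin \o f) -> intT (f \_ `]a, b[).
Proof.
by move=> h; have := (@integrable_mkcond _ _ _ mu _ (EFin \o f) (mItv `]a, b[)).1 h; rewrite restrict_EFin.
Qed.

Lemma Rintegral_ext a b f : \int[mu]_(x in `]a, b[) f x = \int[mu]_x (f \_ `]a, b[) x.
Proof. exact: Rintegral_mkcond. Qed.

Lemma ext_in a b f x : a < x < b -> (f \_ `]a, b[) x = f x.
Proof. by move=> h; rewrite patchE mem_set//= in_itv. Qed.

Lemma ext_out a b f x : ~~ (a < x < b) -> (f \_ `]a, b[) x = 0.
Proof. by move=> h; rewrite patchE memNset//= in_itv/=; exact/negP. Qed.

Lemma ext_mull a b f g x : (f \_ `]a, b[) x * g x = ((fun x => f x * g x) \_ `]a, b[) x.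
Proof. by rewrite !patchE; case: ifP => _; rewrite ?mul0r. Qed.

Lemma ae_eq0_test a b f : mu.-integrable `]a, b[ (EFin \o f) ->
  (forall phi, test_fun a b phi -> \int[mu]_(x in `]a, b[) (f x * phi x) = 0) ->
  {ae mu, forall x, `]a, b[%classic x -> f x = 0}.
Proof.
move=> intf f0.
have h0 c d : a < c -> d < b -> \int[mu]_(x in `]c, d[) (f \_ `]a, b[) x = 0.
  move=> ac db; rewrite -[RHS](Rintegral_test_fun0 ac db intf f0).
  apply: eq_Rintegral => x; rewrite inE/= in_itv/= => /andP[cx xd].
  by rewrite ext_in// (lt_trans ac cx) (lt_trans xd db).
have := ae_zero_of_itv (integrable_ext intf) h0; apply: ae_mono => x h Dx; have := h Dx.
by rewrite ext_in//; move: Dx; rewrite /= in_itv.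
Qed.

Lemma is_wderiv_unique a b f g h : is_wderiv a b f g -> is_wderiv a b f h ->
  {ae mu, forall x, `]a, b[%classic x -> g x = h x}.
Proof.
move=> [Lf Lg fg] [_ Lh fh].
have Lgh := L2B (mItv _) Lg Lh.
have : {ae mu, forall x, `]a, b[%classic x -> g x - h x = 0}.
  apply: ae_eq0_test; first exact: L2_integrable.
  move=> phi tp; have ig := integrable_test_funM (mItv _) tp (L2_integrable Lg).
  have ih := integrable_test_funM (mItv _) tp (L2_integrable Lh).
  under eq_Rintegral do rewrite mulrBl.
  rewrite RintegralB//; have := fg _ tp; rewrite fh// => /oppr_inj ->.
  by rewrite subrr.
by apply: ae_mono => x e /e /eqP; rewrite subr_eq0 => /eqP.
Qed.

Lemma is_wderiv_lin a b r f g f' g' : is_wderiv a b f f' -> is_wderiv a b g g' ->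
  is_wderiv a b (fun x => r * f x + g x) (fun x => r * f' x + g' x).
Proof.
move=> [Lf Lf' ff'] [Lg Lg' gg']; split; [exact: L2_lin|exact: L2_lin|].
move=> phi tp; have i1 h (Lh : L2 mu `]a, b[ h) := integrable_test_funM (mItv _) tp (L2_integrable Lh).
have i2 h (Lh : L2 mu `]a, b[ h) := integrable_test_funM (mItv _) (test_fun_derive1 tp) (L2_integrable Lh).
under eq_Rintegral do rewrite mulrDl -mulrA.
under [in RHS]eq_Rintegral do rewrite mulrDl -mulrA.
rewrite !Rintegral_lin//; [|exact: i1..|exact: i2|exact: i2].
by rewrite ff'// gg'//; ring.
Qed.

Section TestPrimitive.
Variables (a b : R) (phi : R -> R).
Hypothesis tp : test_fun a b phi.

Lemma test_fun_ext : phi \_ `]a, b[ = phi.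
Proof.
have [_ [c [d [ac db h]]]] := (test_funP a b phi).1 tp.
apply/funext => x; have [hx|hx] := boolP (a < x < b); first by rewrite ext_in.
rewrite ext_out// h//; apply: contra hx => /andP[cx xd].
by rewrite (lt_le_trans ac cx) (le_lt_trans xd db).
Qed.

Lemma integrable_test_fun : intT phi.
Proof. by rewrite -test_fun_ext; apply: integrable_ext; apply: L2_integrable; exact: L2_test_fun. Qed.

Lemma is_derive_prim x : is_derive x 1 (prim phi) (phi x).
Proof.
have [sp _] := (test_funP a b phi).1 tp.
have xx : x < x + 1 by rewrite ltrDl.
have cx : {for x, continuous phi} by exact: smooth_continuous.
have [d1 d2] := continuous_FTC1 xx (@integrable_itvS _ `]-oo, x + 1] _ integrable_test_fun) (ltNyr _) cx.
by apply: (DeriveDef d1); rewrite derive1E in d2.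
Qed.

Lemma prim_test_fun_left : exists2 c, a < c & forall x, x < c -> prim phi x = 0.
Proof.
have [_ [c [d [ac db h]]]] := (test_funP a b phi).1 tp.
exists c => // x xc; rewrite /prim.
transitivity (\int[mu]_(t in `]-oo, x]) (0 : R)); last by rewrite /Rintegral integral0.
apply: eq_Rintegral => t; rewrite inE/= in_itv/= => tx.
by rewrite h// negb_and -ltNge (le_lt_trans tx xc).
Qed.

Lemma prim_test_fun_right : exists2 d, d < b & forall x, d < x ->
  prim phi x = \int[mu]_(t in `]a, b[) phi t.
Proof.
have [_ [c [d [ac db h]]]] := (test_funP a b phi).1 tp.
exists d => // x dx; rewrite Rintegral_ext test_fun_ext /prim Rintegral_mkcond.
apply: eq_Rintegral => t _; rewrite patchE; case: ifPn => //.
rewrite notin_setE/= in_itv/= => /negP; rewrite -ltNge => xt.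
by rewrite h// negb_and -!ltNge (lt_trans dx xt) orbT.
Qed.

(** Total integral zero is what makes the primitive vanish again to the right of the support. *)
Lemma test_fun_prim : \int[mu]_(t in `]a, b[) phi t = 0 -> test_fun a b (prim phi).
Proof.
move=> p0; have [sp _] := (test_funP a b phi).1 tp.
have [c ac hc] := prim_test_fun_left; have [d db hd] := prim_test_fun_right.
apply/test_funP; split.
  apply/smoothP; case => [//|n]; split => [x|]; first by case: (is_derive_prim x).
  have -> : ((prim phi)^`())%classic = phi.
    by apply/funext => x; rewrite derive1E; case: (is_derive_prim x).
  by move/smoothP: sp.
exists c, d; split => // x; rewrite negb_and -!ltNge => /orP[/hc//|/hd ->//].
Qed.

End TestPrimitive.

Lemma prim_derive1_test a b phi : test_fun a b phi -> prim (phi^`())%classic = phi.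
Proof.
move=> tp; have td := test_fun_derive1 tp.
have [sp [c [d [ac db h]]]] := (test_funP a b phi).1 tp.
have [c' ac' hc'] := prim_test_fun_left td.
apply/funext => x; apply/eqP; rewrite -subr_eq0; apply/eqP.
(* A point to the left of both supports: there [phi] and the primitive of its derivative vanish, and
   their difference is constant. *)
pose y := Num.min c c' - 1.
have yc : y < c by rewrite /y ltrBlDr gt_min ltrDl ltr01.
have yc' : y < c' by rewrite /y ltrBlDr gt_min ltrDl ltr01 orbT.
have dz (z : R) : is_derive z (1 : R) ((prim (phi^`())%classic : R -> R) - phi) (0 : R).
  have := is_deriveB (is_derive_prim td z) (smooth_is_derive z sp).
  by rewrite subrr.
have := is_derive_0_is_cst x y dz; rewrite !fctE => ->.
by rewrite hc'// h ?subrr// negb_and -ltNge yc.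
Qed.

Lemma Rintegral_derive1_test a b phi : a < b -> test_fun a b phi ->
  \int[mu]_(x in `]a, b[) (phi^`())%classic x = 0.
Proof.
move=> ab tp; have [d db hd] := prim_test_fun_right (test_fun_derive1 tp).
have [sp [c' [d' [ac' db' h]]]] := (test_funP a b phi).1 tp.
rewrite -(hd b)// (prim_derive1_test tp) h// negb_and -!ltNge db' orbT//.
Qed.

(** If every test function had integral 0, then [Rintegral_test_fun0] applied to the constant 1
    would give the middle third of the interval length 0. *)
Lemma exists_test_fun_mean1 a b : a < b -> exists2 eta, test_fun a b eta &
  \int[mu]_(x in `]a, b[) eta x = 1.
Proof.
move=> ab; have i1 := @integrable_itv_cst R a b 1.
have [eta te e0] : exists2 eta, test_fun a b eta & \int[mu]_(x in `]a, b[) eta x != 0.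
  apply: contrapT => /forall2NP h.
  have := @Rintegral_test_fun0 R a b (a + (b - a) / 3) (a + 2 * (b - a) / 3) _ _ _ i1.
  move=> /(_ ltac:(lra) ltac:(lra)) h1.
  have {h1} : \int[mu]_(x in `]a + (b - a) / 3, a + 2 * (b - a) / 3[) (fun=> 1) x = 0.
    apply: h1 => phi tp; under eq_Rintegral do rewrite mul1r.
    by case: (h phi) => // /negP; rewrite negbK => /eqP.
  rewrite Rintegral_cst//= mul1r lebesgue_measure_itv/= lte_fin.
  case: ifPn => [_|]; rewrite -?EFinD/=; [lra|by rewrite -leNgt; lra].
exists (fun x => (\int[mu]_(x in `]a, b[) eta x)^-1 * eta x + 0).
  by apply: test_fun_lin => //; exact: test_fun0.
under eq_Rintegral do rewrite addr0.
rewrite RintegralZl//; last by apply: L2_integrable; exact: L2_test_fun.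
by rewrite mulVf.
Qed.

(** Subtracting a multiple of a fixed [eta] of integral 1 turns any [phi] into a test function of
    integral 0, hence into the derivative of a test function. So [f] minus its integral against
    [eta] annihilates every [phi]. *)
Lemma du_bois_reymond a b f : a < b -> mu.-integrable `]a, b[ (EFin \o f) ->
  (forall phi, test_fun a b phi -> \int[mu]_(x in `]a, b[) (f x * (phi^`())%classic x) = 0) ->
  exists c, {ae mu, forall x, `]a, b[%classic x -> f x = c}.
Proof.
move=> ab intf f0; have [eta te e1] := exists_test_fun_mean1 ab.
exists (\int[mu]_(x in `]a, b[) (f x * eta x)); set c := Rintegral _ _ _.
have ic := @integrable_itv_cst R a b c.
have iL phi : test_fun a b phi -> mu.-integrable `]a, b[ (EFin \o phi).
  by move=> tp; apply: L2_integrable; exact: L2_test_fun.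
have : {ae mu, forall x, `]a, b[%classic x -> f x - c = 0}.
  apply: ae_eq0_test; first exact: integrable_EFinB.
  move=> phi tp; set m := \int[mu]_(x in `]a, b[) phi x.
  pose th x := - m * eta x + phi x.
  have tth : test_fun a b th by exact: test_fun_lin.
  have mth : \int[mu]_(x in `]a, b[) th x = 0.
    rewrite Rintegral_lin//; [|exact: iL|exact: iL].
    by rewrite e1 mulr1 -/m addNr.
  have := f0 _ (test_fun_prim tth mth).
  have -> : ((prim th)^`())%classic = th.
    by apply/funext => x; rewrite derive1E; case: (is_derive_prim tth x).
  have ife : mu.-integrable `]a, b[ (EFin \o (fun x => f x * eta x)) by exact: integrable_test_funM te intf.
  have ifp : mu.-integrable `]a, b[ (EFin \o (fun x => f x * phi x)) by exact: integrable_test_funM tp intf.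
  rewrite (@eq_Rintegral _ _ _ mu _ (fun x => - m * (f x * eta x) + f x * phi x)); last first.
    by move=> x _; rewrite /th; ring.
  rewrite Rintegral_lin// -/c.
  move=> h; under eq_Rintegral do rewrite mulrBl.
  rewrite RintegralB//; last by apply: integrable_EFinZ => //; exact: iL.
  rewrite RintegralZl//; last exact: iL.
  by move: h; rewrite -/m; lra.
by apply: ae_mono => x h /h /eqP; rewrite subr_eq0 => /eqP.
Qed.

(* [c] is the value at [a] of the continuous representative of [f]. *)
Definition prim_rep a b f g c : Prop :=
  {ae mu, forall x, `]a, b[%classic x -> f x = c + prim (g \_ `]a, b[) x}.

(** By [prim_parts], the primitive of [g] has weak derivative [g] as well, so its difference from
    [f] annihilates derivatives of test functions and is constant. *)
Lemma is_wderiv_rep a b f g : a < b -> is_wderiv a b f g -> exists c, prim_rep a b f g c.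
Proof.
move=> ab [Lf Lg fg]; have iG := integrable_ext (L2_integrable Lg).
set G := prim (g \_ `]a, b[).
have iGD : mu.-integrable `]a, b[ (EFin \o G).
  apply: L2_integrable; apply: L2_bounded; first exact: prim_measurable.
  by move=> x; exact: prim_bound.
have [||c hc] := @du_bois_reymond a b (fun x => f x - G x) ab.
- by apply: integrable_EFinB => //; exact: L2_integrable.
- move=> phi tp; have td := test_fun_derive1 tp.
  under eq_Rintegral do rewrite mulrBl.
  rewrite RintegralB//; [|exact: integrable_test_funM td (L2_integrable Lf)|exact: integrable_test_funM td iGD].
  rewrite fg//; have := prim_parts (integrable_test_fun td) iG.
  have i0 : \int[mu]_x (phi^`())%classic x = 0.
    by rewrite -(test_fun_ext td) -Rintegral_ext (Rintegral_derive1_test ab tp).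
  rewrite (prim_derive1_test tp) i0 mul0r sub0r.
  have -> : \int[mu]_x ((phi^`())%classic x * prim (g \_ `]a, b[) x) =
      \int[mu]_(x in `]a, b[) (G x * (phi^`())%classic x).
    rewrite Rintegral_ext; apply: eq_Rintegral => x _.
    by rewrite -[in LHS](test_fun_ext td) ext_mull; congr ((_ \_ _) x); apply/funext => y; rewrite mulrC.
  move=> ->; rewrite [X in _ - - X](_ : _ = \int[mu]_(x in `]a, b[) (g x * phi x)).
    by rewrite opprK addNr.
  by rewrite Rintegral_ext; apply: eq_Rintegral => x _; rewrite ext_mull.
exists c; apply: ae_mono hc => x h /h <-; by rewrite subrK.
Qed.

(** The right side is the boundary term: [c] and [c] plus the integral of [f'] are the end values of
    the continuous representative of [f], likewise with [e] for [g]. *)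
Lemma prim_rep_parts a b f f' g g' c e : a < b -> is_wderiv a b f f' -> is_wderiv a b g g' ->
  prim_rep a b f f' c -> prim_rep a b g g' e ->
  \int[mu]_(x in `]a, b[) (f x * g' x) + \int[mu]_(x in `]a, b[) (f' x * g x) =
  (c + \int[mu]_(x in `]a, b[) f' x) * (e + \int[mu]_(x in `]a, b[) g' x) - c * e.
Proof.
move=> ab [Lf Lf' _] [Lg Lg' _] rf rg.
have iF := integrable_ext (L2_integrable Lf'); have iG := integrable_ext (L2_integrable Lg').
have half h h' p p' k : L2 mu `]a, b[ h -> L2 mu `]a, b[ h' -> L2 mu `]a, b[ p' ->
    prim_rep a b h h' k -> \int[mu]_(x in `]a, b[) (h x * p' x) =
      k * \int[mu]_(x in `]a, b[) p' x + \int[mu]_x ((p' \_ `]a, b[) x * prim (h' \_ `]a, b[) x).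
  move=> Lh Lh' Lp' rh.
  have iH := integrable_ext (L2_integrable Lh'); have iP := integrable_ext (L2_integrable Lp').
  have mP := L2_measurable Lp'; have mH : measurable_fun `]a, b[ (prim (h' \_ `]a, b[)) by exact: prim_measurable.
  rewrite (@ae_eq_Rintegral _ _ _ mu _ _ _ (fun x => k * p' x + p' x * prim (h' \_ `]a, b[) x)).
  - rewrite Rintegral_lin//; first last.
    + have := @integrable_itvS _ `]a, b[ _ (integrable_mul_prim iP iH).
      apply: eq_integrable => // x; rewrite inE/= in_itv/= => hx.
      by rewrite ext_in.
    + exact: L2_integrable.
    + congr (_ + _); rewrite Rintegral_ext; apply: eq_Rintegral => x _.
      by rewrite ext_mull.
  - exact: mItv.
  - by apply: measurable_funM => //; exact: L2_measurable Lh.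
  - apply: measurable_funD; first exact: measurable_funM.
    exact: measurable_funM.
  - by apply: ae_mono rh => x hx Dx; rewrite hx//; ring.
rewrite (half f f' g g' c)//.
have -> : \int[mu]_(x in `]a, b[) (f' x * g x) = \int[mu]_(x in `]a, b[) (g x * f' x).
  by apply: eq_Rintegral => x _; rewrite mulrC.
rewrite (half g g' f f' e)//.
by have := prim_parts iG iF; rewrite -!Rintegral_ext => ->; ring.
Qed.

End Sobolev1D.

(** Closing arithmetic of [H10_parts]: [A] and [B] are the errors made when [f] and its derivative
    are replaced by those of a test function, [s] and [s'] the squared distances to them. *)
Lemma sqr_addr_le (R : realFieldType) (A B s s' g g' e : R) : A ^+ 2 <= s * g' -> B ^+ 2 <= s' * g ->
  0 <= s -> 0 <= s' -> 0 <= g -> 0 <= g' -> (s + s') * (2 * (g' + g) + 1) < e ->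
  (A + B) ^+ 2 <= e.
Proof.
move=> c1 c2 t1 t2 t3 t4 small.
have := sqr_ge0 (A - B); have := mulr_ge0 t1 t3; have := mulr_ge0 t2 t4.
by move: small; rewrite sqrrB sqrrD !(mulrDl, mulrDr) !mulr1; lra.
Qed.

(** Closing arithmetic of [poincare]: [F], [F'] are the squared norms of [f] and its derivative,
    [P], [P'] those of an approximating test function, [A], [B] the squared errors. *)
Lemma poincare_le (R : realFieldType) (F P P' F' A B l e : R) : 0 <= A -> 0 <= B -> 0 <= l ->
  F <= 2 * A + 2 * P -> P' <= 2 * B + 2 * F' -> P <= l * P' ->
  A + B < e / (4 * l + 2) -> 0 < 4 * l + 2 -> F <= 4 * l * F' + e.
Proof.
move=> A0 B0 l0 h1 h2 h3 small k0.
rewrite ltr_pdivlMr// in small.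
have := ler_wpM2l l0 h2; have := mulr_ge0 A0 l0.
by move: small; rewrite !(mulrDl, mulrDr); lra.
Qed.

(** * Traces, Dirichlet conditions and Poincare inequalities *)

Section TracesPoincare.
Variable R : realType.
Local Notation mu := (@lebesgue_measure R).
Implicit Types (a b c d e x y r : R) (f g h p q phi w : R -> R).

Let mItv (i : interval R) : measurable ([set` i] : set (measurableTypeR R)) :=
  measurable_itv i.

Lemma Rintegral_itv_cst a b r : a < b -> \int[mu]_(x in `]a, b[) r = r * (b - a).
Proof. by move=> ab; rewrite Rintegral_cst//= lebesgue_measure_itv/= lte_fin ab -EFinD. Qed.

Lemma ae_itv_witness c d (P : R -> Prop) : c < d -> {ae mu, forall x, P x} ->
  exists2 x, c < x < d & P x.
Proof.
move=> cd [A [mA A0 PA]]; apply: contrapT => /forall2NP h.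
have sub : `]c, d[%classic `<=` A.
  move=> x /=; rewrite in_itv/= => cxd; apply: PA => /= Px.
  by case: (h x).
have : (mu `]c, d[%classic <= mu A)%E by apply: le_measure => //; rewrite inE//; exact: mItv.
rewrite A0 lebesgue_measure_itv/= lte_fin cd -EFinD lee_fin; lra.
Qed.

Lemma within_itv_continuous_dist a b f x e : {within `[a, b], continuous f} ->
  a <= x <= b -> 0 < e -> exists2 d, 0 < d &
  forall y, a <= y <= b -> `|y - x| < d -> `|f y - f x| < e.
Proof.
move=> /subspace_continuousP cf hx e0.
have /cvgrPdist_lt /(_ e e0) := cf x ltac:(by rewrite /= in_itv).
rewrite near_withinE => /nbhs_ballP [d /= d0 hd]; exists d => // y hy yx.
rewrite distrC; apply: hd; first by rewrite /ball/= distrC.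
by rewrite /= in_itv.
Qed.

Lemma continuous_ae_eq a b f g x : a < b -> {within `[a, b], continuous f} ->
  {within `[a, b], continuous g} ->
  {ae mu, forall x, `]a, b[%classic x -> f x = g x} ->
  a <= x <= b -> f x = g x.
Proof.
move=> ab cf cg fg hx; apply/eqP; rewrite -subr_eq0 -normr_le0.
apply/ler_addgt0Pr => e e0; rewrite add0r.
have e2 : 0 < e / 2 by rewrite divr_gt0.
have [d d0 hd] := within_itv_continuous_dist cf hx e2.
have [d' d'0 hd'] := within_itv_continuous_dist cg hx e2.
pose s := Num.min d d'; have s0 : 0 < s by rewrite lt_min d0.
have sd : s <= d by rewrite ge_min lexx.
have sd' : s <= d' by rewrite ge_min lexx orbT.
have cd : Num.max a (x - s) < Num.min b (x + s).
  by rewrite gt_max !lt_min; lra.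
have [y] := ae_itv_witness cd fg.
rewrite gt_max lt_min => /andP[/andP[ay y1] /andP[yb y2]] /(_ _)/[dup].
rewrite /= in_itv/= ay yb => /(_ isT) fgy _.
have hy : a <= y <= b by lra.
have ys : `|y - x| < s by rewrite ltr_norml; lra.
have := hd y hy (lt_le_trans ys sd); have := hd' y hy (lt_le_trans ys sd').
rewrite fgy !ltr_norml => /andP[h1 h2] /andP[h3 h4].
rewrite ler_norml; lra.
Qed.

Lemma prim_ext_left a b f : prim (f \_ `]a, b[) a = 0.
Proof.
rewrite /prim; transitivity (\int[mu]_(t in `]-oo, a]) (0 : R)); last by rewrite /Rintegral integral0.
apply: eq_Rintegral => t; rewrite inE/= in_itv/= => ta.
by rewrite ext_out// negb_and -leNgt ta.
Qed.

Lemma prim_ext_right a b f : prim (f \_ `]a, b[) b = \int[mu]_(x in `]a, b[) f x.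
Proof.
rewrite Rintegral_ext /prim Rintegral_mkcond; apply: eq_Rintegral => t _.
rewrite patchE; case: ifPn => //; rewrite notin_setE/= in_itv/= => /negP.
by rewrite -ltNge => /ltW bt; rewrite ext_out// negb_and -!leNgt bt orbT.
Qed.

Section Rep.
Variables (a b : R) (f g : R -> R) (c : R).
Hypotheses (ab : a < b) (Lg : L2 mu `]a, b[ g) (fg : prim_rep a b f g c).

Let W x := c + prim (g \_ `]a, b[) x.

Let W_continuous : {within `[a, b], continuous W}.
Proof.
apply: continuous_subspaceT => x; apply: cvgD; first exact: cvg_cst.
by apply: prim_continuous; exact: integrable_ext (L2_integrable Lg).
Qed.

Lemma prim_rep_has_trace x : has_trace a b f x (c + prim (g \_ `]a, b[) x).
Proof. by exists W. Qed.

Lemma has_trace_prim_rep x y : a <= x <= b -> has_trace a b f x y ->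
  y = c + prim (g \_ `]a, b[) x.
Proof.
move=> hx [w [cw fw <-]]; apply: (continuous_ae_eq ab cw W_continuous) => //.
by apply: ae_mono2 fw fg => t h1 h2 Dt; rewrite -h1// h2.
Qed.

Lemma has_trace_left y : has_trace a b f a y -> y = c.
Proof.
by move/has_trace_prim_rep => ->; rewrite ?prim_ext_left ?addr0// lexx ltW.
Qed.

Lemma has_trace_right y : has_trace a b f b y -> y = c + \int[mu]_(x in `]a, b[) g x.
Proof.
by move/has_trace_prim_rep => ->; rewrite ?prim_ext_right// lexx ltW.
Qed.

End Rep.

Lemma wderivP a b f : H1 a b f -> is_wderiv a b f (wderiv a b f).
Proof. by move=> h; exact: (@xgetPex _ (fun=> 0) [set g | is_wderiv a b f g]). Qed.

Lemma wderiv_ae a b f g : is_wderiv a b f g ->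
  {ae mu, forall x, `]a, b[%classic x -> wderiv a b f x = g x}.
Proof. by move=> fg; apply: (is_wderiv_unique (wderivP (ex_intro _ g fg)) fg). Qed.

Lemma H1_lin a b r f g : H1 a b f -> H1 a b g -> H1 a b (fun x => r * f x + g x).
Proof. by move=> [f' hf] [g' hg]; exists (fun x => r * f' x + g' x); exact: is_wderiv_lin. Qed.

Lemma wderiv_lin a b r f g : H1 a b f -> H1 a b g ->
  {ae mu, forall x, `]a, b[%classic x ->
    wderiv a b (fun x => r * f x + g x) x = r * wderiv a b f x + wderiv a b g x}.
Proof. by move=> hf hg; apply: wderiv_ae; apply: is_wderiv_lin; exact: wderivP. Qed.

Lemma L2_wderiv a b f : H1 a b f -> L2 mu `]a, b[ (wderiv a b f).
Proof. by case/wderivP. Qed.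

Lemma H1_L2 a b f : H1 a b f -> L2 mu `]a, b[ f. Proof. by move=> [g []]. Qed.

(** Cauchy-Schwarz against the indicator of []-oo, x]], whose squared norm on the interval is at
    most [b - a]. *)
Lemma sqr_prim_le a b g x : a < b -> L2 mu `]a, b[ g ->
  (prim (g \_ `]a, b[) x) ^+ 2 <= (b - a) * \int[mu]_(t in `]a, b[) (g t ^+ 2).
Proof.
move=> ab Lg; pose i := \1_(`]-oo, x]%classic) : R -> R.
have iE t : i t = (t <= x)%R%:R by rewrite /i indicE mem_setE in_itv.
have mi : measurable_fun `]a, b[ i by apply: measurable_indic; exact: mItv.
have ib t : `|i t| <= 1 by rewrite iE; case: (t <= x); rewrite ?normr1 ?normr0.
have Li : L2 mu `]a, b[ i by exact: L2_bounded ib.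
have -> : prim (g \_ `]a, b[) x = \int[mu]_(t in `]a, b[) (g t * i t).
  rewrite /prim Rintegral_mkcond Rintegral_ext; apply: eq_Rintegral => t _.
  rewrite -ext_mull patchE mem_setE in_itv/= iE.
  by case: (t <= x); rewrite ?mulr1 ?mulr0.
apply: (le_trans (Rintegral_cauchy_schwarz (mItv _) Lg Li)).
rewrite mulrC ler_wpM2r ?Rintegral_sqr_ge0//.
apply: (@le_trans _ _ (\int[mu]_(t in `]a, b[) (1 : R))).
  apply: le_Rintegral; [exact: mItv|by case: Li|exact: integrable_itv_cst|].
  by move=> t _; rewrite iE; case: (t <= x); rewrite ?expr1n// expr0n.
by rewrite Rintegral_itv_cst// mul1r.
Qed.

Section H10.
Variables (a b : R) (f : R -> R).
Hypotheses (ab : a < b) (hf : H10 a b f).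
Let f' := wderiv a b f.

Let Lf : L2 mu `]a, b[ f. Proof. by case: hf => /H1_L2. Qed.
Let Lf' : L2 mu `]a, b[ f'. Proof. by case: hf => /L2_wderiv. Qed.

(** Membership in [H10] is approximability by test functions, so the identity defining [g'] passes
    from them to [f] in the limit; no boundary value of [f] is needed. The defect [X] is shown to
    satisfy [X ^+ 2 <= e] for all [e > 0]. *)
Lemma H10_parts g g' : is_wderiv a b g g' ->
  \int[mu]_(x in `]a, b[) (f x * g' x) = - \int[mu]_(x in `]a, b[) (f' x * g x).
Proof.
move=> [Lg Lg' gg']; apply/eqP; rewrite -subr_eq0 opprK; apply/eqP.
set X := (X in X = 0).
pose k := 2 * (\int[mu]_(x in `]a, b[) (g' x ^+ 2) + \int[mu]_(x in `]a, b[) (g x ^+ 2)).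
have k0 : 0 <= k by rewrite mulr_ge0// addr_ge0// Rintegral_sqr_ge0.
suff : X ^+ 2 <= 0 by move=> h; apply/eqP; rewrite -sqrf_eq0 eq_le h sqr_ge0.
apply/ler_addgt0Pr => e e0; rewrite add0r.
have k1 : 0 < k + 1 by rewrite ltr_wpDl.
have [_ /(_ _ (divr_gt0 e0 k1)) [phi tp]] := hf.
have Lp := L2_test_fun tp; have Lp' := L2_test_fun (test_fun_derive1 tp).
have L1 := L2B (mItv _) Lf Lp; have L2' := L2B (mItv _) Lf' Lp'.
have -> : X = \int[mu]_(x in `]a, b[) ((f x - phi x) * g' x) +
    \int[mu]_(x in `]a, b[) ((f' x - (phi^`())%classic x) * g x).
  under eq_Rintegral do rewrite mulrBl.
  under [X in _ + X]eq_Rintegral do rewrite mulrBl.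
  rewrite !RintegralB//; try exact: L2_mul.
  have := gg' _ tp.
  have -> : \int[mu]_(x in `]a, b[) (g x * (phi^`())%classic x) = \int[mu]_(x in `]a, b[) ((phi^`())%classic x * g x).
    by apply: eq_Rintegral => x _; rewrite mulrC.
  have -> : \int[mu]_(x in `]a, b[) (g' x * phi x) = \int[mu]_(x in `]a, b[) (phi x * g' x).
    by apply: eq_Rintegral => x _; rewrite mulrC.
  by move=> ->; rewrite /X; ring.
have c1 := Rintegral_cauchy_schwarz (mItv _) L1 Lg'.
have c2 := Rintegral_cauchy_schwarz (mItv _) L2' Lg.
have t1 := Rintegral_sqr_ge0 mu `]a, b[ (fun x => f x - phi x).
have t2 := Rintegral_sqr_ge0 mu `]a, b[ (fun x => f' x - (phi^`())%classic x).
have t3 := Rintegral_sqr_ge0 mu `]a, b[ g.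
have t4 := Rintegral_sqr_ge0 mu `]a, b[ g'.
rewrite ltr_pdivlMr// /k => small.
exact: sqr_addr_le c1 c2 t1 t2 t3 t4 small.
Qed.

Lemma H10_Rintegral_wderiv : \int[mu]_(x in `]a, b[) f' x = 0.
Proof.
have L1 : L2 mu `]a, b[ (fun=> 1).
  by apply: (@L2_bounded _ _ _ _ 1) => [|x]; [exact: measurable_cst|rewrite normr1].
have w1 : is_wderiv a b (fun=> 1) (fun=> 0).
  split; [exact: L1|exact: L2_0|move=> phi tp].
  under eq_Rintegral do rewrite mul1r.
  under [in RHS]eq_Rintegral do rewrite mul0r.
  by rewrite (Rintegral_derive1_test ab tp) /Rintegral integral0 oppr0.
have := H10_parts w1; under eq_Rintegral do rewrite mulr0.
under [in X in _ = - X -> _]eq_Rintegral do rewrite mulr1.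
by rewrite /Rintegral integral0 => /esym/eqP; rewrite oppr_eq0 => /eqP.
Qed.

(** For test functions the constant is [(b - a) ^+ 2], by [sqr_prim_le]. The factor 4 arises from
    splitting squares into twice the error plus twice the approximant, once for the function and
    once for its derivative. *)
Lemma poincare : \int[mu]_(x in `]a, b[) (f x ^+ 2) <=
  4 * (b - a) ^+ 2 * \int[mu]_(x in `]a, b[) (f' x ^+ 2).
Proof.
pose l := (b - a) ^+ 2; have l0 : 0 <= l by exact: sqr_ge0.
apply/ler_addgt0Pr => e e0.
have k1 : 0 < 4 * l + 2 by lra.
have [_ /(_ _ (divr_gt0 e0 k1)) [phi tp small]] := hf.
have Lp := L2_test_fun tp; have Lp' := L2_test_fun (test_fun_derive1 tp).
have Pp : \int[mu]_(x in `]a, b[) (phi x ^+ 2) <= l * \int[mu]_(x in `]a, b[) ((phi^`())%classic x ^+ 2).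
  set k := (b - a) * \int[mu]_(x in `]a, b[) ((phi^`())%classic x ^+ 2).
  apply: (@le_trans _ _ (\int[mu]_(x in `]a, b[) k)).
    apply: le_Rintegral; [exact: mItv|by case: Lp|exact: integrable_itv_cst|move=> x _].
    have := sqr_prim_le x ab Lp'; rewrite (test_fun_ext (test_fun_derive1 tp)).
    by rewrite (prim_derive1_test tp).
  rewrite Rintegral_itv_cst// /k /l; lra.
have split2 g h : L2 mu `]a, b[ g -> L2 mu `]a, b[ h -> \int[mu]_(x in `]a, b[) (g x ^+ 2) <=
    2 * \int[mu]_(x in `]a, b[) ((g x - h x) ^+ 2) + 2 * \int[mu]_(x in `]a, b[) (h x ^+ 2).
  move=> Lg Lh; have Lgh := L2B (mItv _) Lg Lh.
  have i2 : mu.-integrable `]a, b[ (EFin \o (fun x => 2 * h x ^+ 2)).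
    by apply: integrable_EFinZ; [exact: mItv|case: Lh].
  rewrite -[X in _ <= _ + X]RintegralZl//; last by case: Lh.
  rewrite -Rintegral_lin//; last by case: Lgh.
  apply: le_Rintegral; [exact: mItv|by case: Lg| |].
    by apply: integrable_EFinD => //; apply: integrable_EFinZ => //; case: Lgh.
  by move=> x _; have := sqr_ge0 (g x - 2 * h x); nra.
have h1 := split2 _ _ Lf Lp; have h2 := split2 _ _ Lp' Lf'.
have e12 : \int[mu]_(x in `]a, b[) (((phi^`())%classic x - f' x) ^+ 2) =
   \int[mu]_(x in `]a, b[) ((f' x - (phi^`())%classic x) ^+ 2).
  by apply: eq_Rintegral => x _; rewrite -sqrrN opprB.
rewrite e12 in h2.
exact: poincare_le (Rintegral_sqr_ge0 _ _ _) (Rintegral_sqr_ge0 _ _ _) l0 h1 h2 Pp small k1.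
Qed.

End H10.

(** Write [f = c + P] with [P] the primitive of [f']. Mean zero makes [c] minus the mean of [P], so
    both [P ^+ 2] and [c ^+ 2] are at most [(b - a) * s], and [f ^+ 2] at most four times that. *)
Lemma poincare_wirtinger a b f f' : a < b -> is_wderiv a b f f' ->
  \int[mu]_(x in `]a, b[) f x = 0 ->
  \int[mu]_(x in `]a, b[) (f x ^+ 2) <= 4 * (b - a) ^+ 2 * \int[mu]_(x in `]a, b[) (f' x ^+ 2).
Proof.
move=> ab ff' f0; have [Lf Lf' _] := ff'; have [c rf] := is_wderiv_rep ab ff'.
set P := prim (f' \_ `]a, b[) in rf; set s := \int[mu]_(x in `]a, b[) (f' x ^+ 2).
have s0 : 0 <= s by exact: Rintegral_sqr_ge0.
have Pb x : P x ^+ 2 <= (b - a) * s by exact: sqr_prim_le.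
have iF := integrable_ext (L2_integrable Lf').
have mP : measurable_fun `]a, b[ P by exact: prim_measurable.
have LP : L2 mu `]a, b[ P by apply: L2_bounded => // x; exact: prim_bound.
have e0 : c * (b - a) + \int[mu]_(x in `]a, b[) P x = 0.
  rewrite -Rintegral_itv_cst// -RintegralD; [|exact: mItv|exact: integrable_itv_cst|exact: L2_integrable].
  rewrite -[RHS]f0; apply: ae_eq_Rintegral; [exact: mItv| |exact: L2_measurable Lf|].
    by apply: measurable_funD => //; exact: measurable_cst.
  by apply: ae_mono rf => x h /h ->.
have L1 : L2 mu `]a, b[ (fun=> 1).
  by apply: (@L2_bounded _ _ _ _ 1) => [|x]; [exact: measurable_cst|rewrite normr1].
have c2 : c ^+ 2 <= (b - a) * s.
  have := Rintegral_cauchy_schwarz (mItv _) LP L1.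
  under eq_Rintegral do rewrite mulr1.
  under [X in _ <= _ * X -> _]eq_Rintegral do rewrite expr1n.
  rewrite Rintegral_itv_cst// mul1r => h.
  have hP : \int[mu]_(x in `]a, b[) (P x ^+ 2) <= (b - a) * s * (b - a).
    rewrite -Rintegral_itv_cst//; apply: le_Rintegral; [exact: mItv|by case: LP|exact: integrable_itv_cst|].
    by move=> x _.
  have ba : 0 < b - a by rewrite subr_gt0.
  have e1 : \int[mu]_(x in `]a, b[) P x = - (c * (b - a)) by lra.
  rewrite e1 sqrrN exprMn in h.
  have : c ^+ 2 * (b - a) ^+ 2 <= (b - a) * s * (b - a) ^+ 2.
    apply: (le_trans h); rewrite [(b - a) ^+ 2]expr2 mulrA ler_wpM2r// ltW//.
  by rewrite ler_pM2r// exprn_gt0.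
apply: (@le_trans _ _ (\int[mu]_(x in `]a, b[) (4 * ((b - a) * s)))); last first.
  by rewrite Rintegral_itv_cst//; lra.
rewrite (@ae_eq_Rintegral _ _ _ mu _ (mItv _) _ (fun x => (c + P x) ^+ 2)).
- apply: le_Rintegral; [exact: mItv| |exact: integrable_itv_cst|].
    have Lc : L2 mu `]a, b[ (fun=> c).
      by apply: (@L2_bounded _ _ _ _ `|c|) => [|x]; [exact: measurable_cst|].
    by case: (L2D (mItv _) Lc LP).
  by move=> x _; have := Pb x; have := sqr_ge0 (c - P x); rewrite (sqrrD c (P x)) (sqrrB c (P x)); lra.
- by apply: measurable_funX; exact: L2_measurable Lf.
- by apply: measurable_funX; apply: measurable_funD => //; exact: measurable_cst.
- by apply: ae_mono rf => x h /h ->.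
Qed.

(** Companion of [H10_parts] for [theta_x], whose boundary values are prescribed as traces and not
    through approximation by test functions. *)
Lemma dirichlet_trace_parts a b f f' g g' : a < b -> is_wderiv a b f f' -> is_wderiv a b g g' ->
  has_trace a b f a 0 -> has_trace a b f b 0 ->
  \int[mu]_(x in `]a, b[) (f x * g' x) = - \int[mu]_(x in `]a, b[) (f' x * g x).
Proof.
move=> ab ff' gg' ta tb; have [_ Lf' _] := ff'.
have [c rf] := is_wderiv_rep ab ff'; have [e rg] := is_wderiv_rep ab gg'.
have := prim_rep_parts ab ff' gg' rf rg.
rewrite -(has_trace_right ab Lf' rf tb) -(has_trace_left ab Lf' rf ta) !mul0r subr0.
by move/eqP; rewrite addr_eq0 => /eqP.
Qed.

Lemma dirichlet_trace_Rintegral a b f f' : a < b -> is_wderiv a b f f' ->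
  has_trace a b f a 0 -> has_trace a b f b 0 -> \int[mu]_(x in `]a, b[) f' x = 0.
Proof.
move=> ab ff' ta tb; have [_ Lf' _] := ff'; have [c rf] := is_wderiv_rep ab ff'.
have := has_trace_right ab Lf' rf tb; rewrite -(has_trace_left ab Lf' rf ta); lra.
Qed.

End TracesPoincare.

(** * The state space *)

Section SemiInnerProduct.
Variables (R : realType) (V : lmodType R) (H : set V).
Implicit Types (U W X : V) (B : V -> V -> R).

Definition symmetric_form B : Prop :=
  (forall b U W X, H U -> H W -> H X -> B (b *: U + W) X = b * B U X + B W X) /\
  (forall U W, H U -> H W -> B U W = B W U).

Variable B : V -> V -> R.
Hypotheses (H0 : H 0) (Hlin : forall a U W, H U -> H W -> H (a *: U + W)).
Hypotheses (sB : symmetric_form B) (B_ge0 : forall U, H U -> 0 <= B U U).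

Lemma form_cauchy_schwarz U W : H U -> H W -> (B U W) ^+ 2 <= B U U * B W W.
Proof.
move=> hU hW; have [Bl Bs] := sB.
have a0 := B_ge0 hU; have b0 := B_ge0 hW.
have q t : 0 <= t ^+ 2 * B U U + (2 * t * B U W + B W W).
  have h := Hlin t hU hW; have := B_ge0 h.
  by rewrite Bl// (Bs U)// (Bs W)// !Bl// (Bs W U)//; congr (_ <= _); ring.
set c := B U W in q *; set a := B U U in a0 q *; set b := B W W in b0 q *.
have [a_eq0|an0] := eqVneq a 0.
  have [->|cn0] := eqVneq c 0; first by rewrite a_eq0 expr0n mul0r.
  have := q (- (b + 1) / (2 * c)); rewrite a_eq0.
  have -> : 2 * (- (b + 1) / (2 * c)) * c = - (b + 1) by field.
  by lra.
have ap : 0 < a by rewrite lt_def an0.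
have := q (- c / a).
have -> : (- c / a) ^+ 2 * a + (2 * (- c / a) * c + b) = (a * b - c ^+ 2) / a.
  by field.
by rewrite pmulr_lge0 ?invr_gt0// subr_ge0.
Qed.

Lemma form_le_sqrt U W : H U -> H W ->
  `|B U W| <= Num.sqrt (B U U) * Num.sqrt (B W W).
Proof.
move=> hU hW; rewrite -sqrtrM; last exact: B_ge0.
by rewrite -sqrtr_sqr ler_wsqrtr// form_cauchy_schwarz.
Qed.

Lemma semi_inner_seminormed : seminormed H (fun U => Num.sqrt (B U U)).
Proof.
have [Bl Bs] := sB.
have BZ b U X : H U -> H X -> B (b *: U) X = b * B U X.
  move=> hU hX; have := Bl b U 0 X hU H0 hX; rewrite addr0 => ->.
  have := Bl 1 0 0 X H0 H0 hX; rewrite scale1r addr0 mul1r; lra.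
have HZ b U : H U -> H (b *: U) by move=> hU; rewrite -[_ *: _]addr0; apply: Hlin.
split => //.
- move=> b U hU; rewrite BZ//; last exact: HZ.
  rewrite Bs//; last exact: HZ.
  by rewrite BZ// mulrA -expr2 sqrtrM ?sqr_ge0// sqrtr_sqr.
- move=> U W hU hW.
  have hUW : H (U + W) by rewrite -[U]scale1r; apply: Hlin.
  rewrite -(@ler_pXn2r _ 2)// ?nnegrE ?addr_ge0 ?sqrtr_ge0//.
  rewrite sqr_sqrtr ?B_ge0// sqrrD !sqr_sqrtr ?B_ge0//.
  have e X : H X -> B (U + W) X = B U X + B W X.
    by move=> hX; rewrite -{1}[U]scale1r Bl// mul1r.
  rewrite e// Bs// e// [B W (U + W)]Bs// e// (Bs W U)//.
  have := form_le_sqrt hU hW; rewrite ler_norml => /andP[_]; lra.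
Qed.

End SemiInnerProduct.

(** * Bilinear forms assembled from integrals of products *)

Section Blocks.
Context d (T : measurableType d) (R : realType) (mu : {measure set T -> \bar R}).
Variable D : set T.
Hypothesis mD : measurable D.
Variables (V : lmodType R) (H : set V).
Implicit Types (U W X : V) (a b : V -> T -> R).

(** Describes the coordinates of a state that enter quadratic forms. Linearity is demanded only
    almost everywhere because [wderiv] chooses a representative and fibre integrals may diverge on a
    null set. *)
Definition ae_linear_L2 a : Prop :=
  (forall U, H U -> L2 mu D (a U)) /\
  forall r U W, H U -> H W ->
    {ae mu, forall x, D x -> a (r *: U + W) x = r * a U x + a W x}.

Lemma ae_linear_L2_lin k a b : ae_linear_L2 a -> ae_linear_L2 b ->
  ae_linear_L2 (fun U x => k * a U x + b U x).
Proof.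
move=> [La la] [Lb lb]; split=> [U hU|r U W hU hW].
  by apply: L2_lin => //; [exact: La|exact: Lb].
by apply: filterS2 (la r U W hU hW) (lb r U W hU hW) => x h1 h2 Dx; rewrite h1// h2//; ring.
Qed.

(** Both the inner product and the Lyapunov form are combinations of such blocks, so their
    bilinearity and symmetry are checked once here. *)
Definition block a b U W := \int[mu]_(x in D) (a U x * b W x).

Lemma blockC a b U W : block a b U W = block b a W U.
Proof. by apply: eq_Rintegral => x _; rewrite mulrC. Qed.

Lemma block_lin a b r U W X : (forall (k : R) U W, H U -> H W -> H (k *: U + W)) ->
  ae_linear_L2 a -> ae_linear_L2 b ->
  H U -> H W -> H X -> block a b (r *: U + W) X = r * block a b U X + block a b W X.
Proof.
move=> Hlin [La la] [Lb lb] hU hW hX.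
have LX := Lb X hX; have LU := La U hU; have LW := La W hW.
have LUW : L2 mu D (a (r *: U + W)) by apply: La; exact: Hlin.
rewrite /block -Rintegral_lin//; [|exact: L2_mul|exact: L2_mul].
apply: ae_eq_Rintegral => //.
- by apply: measurable_funM; [exact: (L2_measurable LUW)|exact: (L2_measurable LX)].
- have [mU mW mX] := And3 (L2_measurable LU) (L2_measurable LW) (L2_measurable LX).
  by apply: measurable_funD; [apply: measurable_funM => //|]; exact: measurable_funM.
- by apply: filterS (la r U W hU hW) => x h Dx; rewrite h//; ring.
Qed.

Lemma block_symmetric a b : (forall (k : R) U W, H U -> H W -> H (k *: U + W)) ->
  ae_linear_L2 a -> ae_linear_L2 b ->
  symmetric_form H (fun U W => block a b U W + block b a U W).
Proof.
move=> Hlin la lb; split=> [r U W X hU hW hX|U W hU hW].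
  by rewrite !block_lin//; ring.
by rewrite addrC [block b a U W]blockC [block a b U W]blockC.
Qed.

Lemma block_diag_symmetric a : (forall (k : R) U W, H U -> H W -> H (k *: U + W)) ->
  ae_linear_L2 a -> symmetric_form H (block a a).
Proof.
move=> Hlin la; split=> [r U W X hU hW hX|U W hU hW]; first by rewrite block_lin.
by rewrite blockC.
Qed.

End Blocks.

Section SymmetricForms.
Variables (R : realType) (V : lmodType R) (H : set V).
Implicit Types B : V -> V -> R.

Lemma symmetric_formD B B' : symmetric_form H B -> symmetric_form H B' ->
  symmetric_form H (fun U W => B U W + B' U W).
Proof.
move=> [l s] [l' s']; split=> [b U W X hU hW hX|U W hU hW].
  by rewrite l// l'//; ring.
by rewrite s// s'.
Qed.

Lemma symmetric_formZ k B : symmetric_form H B -> symmetric_form H (fun U W => k * B U W).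
Proof.
move=> [l s]; split=> [b U W X hU hW hX|U W hU hW]; first by rewrite l//; ring.
by rewrite s.
Qed.

Lemma eq_symmetric_form B B' : (forall (k : R) U W, H U -> H W -> H (k *: U + W)) ->
  (forall U W, H U -> H W -> B U W = B' U W) ->
  symmetric_form H B -> symmetric_form H B'.
Proof.
move=> Hlin BB [l s]; split=> [b U W X hU hW hX|U W hU hW].
  by rewrite -!BB//; [exact: l|exact: Hlin].
by rewrite -!BB// s.
Qed.

End SymmetricForms.

Section UnitSquareFibres.
Variable R : realType.
Local Notation mu := (@lebesgue_measure R).
Variables (a b : R).
Local Notation Om := (`]a, b[%classic : set (measurableTypeR R)).
Local Notation I01 := (`]0, 1[%classic : set (measurableTypeR R)).
Local Notation L2Q := (L2 (mu \x mu)%E (`]a, b[%classic `*` `]0, 1[%classic)).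
Implicit Types p q : R * R -> R.

Let mOm : measurable Om := measurable_itv _.
Let mI01 : measurable I01 := measurable_itv _.
Let mQ : measurable (Om `*` I01). Proof. exact: measurableX. Qed.

Lemma L2Q_section p : L2Q p ->
  {ae mu, forall x, `]a, b[%classic x -> L2 mu `]0, 1[ (fun r => p (x, r))}.
Proof.
move=> [mp p2]; have := ae_integrable_section mOm mI01 p2.
apply: ae_mono => x h Ox; split; last exact: h.
have mpQ := (measurable_restrictT p mQ).1 mp.
apply/(measurable_restrictT _ mI01).
have -> : (fun r => p (x, r)) \_ `]0, 1[ = (p \_ (Om `*` I01)) \o (fun r => (x, r)).
  apply/funext => r; rewrite /= !patchE.
  by have [Ir|nIr] := pselect (I01 r); [rewrite !mem_set|rewrite !memNset// => -[]].
by apply: measurableT_comp => //; exact: measurable_fun_pair.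
Qed.

Lemma Rintegral_fibre_mul p q : L2Q p -> L2Q q ->
  \int[mu]_(x in `]a, b[) (\int[mu]_(r in `]0, 1[) (p (x, r) * q (x, r))) =
  \int[(mu \x mu)%E]_(z in `]a, b[%classic `*` `]0, 1[%classic) (p z * q z).
Proof.
move=> Lp Lq; exact: (Rintegral_product mOm mI01 (L2_mul mQ Lp Lq)).
Qed.

Lemma L2Q_bounded (f : R * R -> R) M :
  measurable_fun (Om `*` I01) f -> (forall z, `]a, b[%classic z.1 -> `]0, 1[%classic z.2 -> `|f z| <= M) -> L2Q f.
Proof.
move=> mf hM; split => //.
apply: (@le_integrable_EFin _ _ _ _ _ mQ _ (fun=> M ^+ 2)).
- exact: measurable_funX.
- move=> z [/= z1 z2]; rewrite normrX; apply: lerXn2r; rewrite ?nnegrE//.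
    exact: le_trans (hM z z1 z2).
  exact: hM.
- apply/integrableP; split; first by apply/measurable_EFinP; exact: measurable_cst.
  have m_lty c d : (mu (`]c, d[)%classic < +oo)%E.
    by rewrite lebesgue_measure_itv/=; case: ifP => _; rewrite ?ltry// -EFinD ltry.
  have fin : ((mu \x mu)%E (Om `*` I01) < +oo)%E.
    rewrite product_measure1E//.
    by apply: lte_mul_pinfty => //; rewrite ?ge0_fin_numE//; exact: m_lty.
  rewrite /= (integral_cst _ mQ).
  by apply: lte_mul_pinfty => //; rewrite lee_fin.
Qed.

Definition fibre_mean p x : R := \int[mu]_(r in `]0, 1[) p (x, r).

Lemma L2Q_integrable p : L2Q p -> (mu \x mu)%E.-integrable (Om `*` I01) (EFin \o p).
Proof.
move=> Lp; have L1 : L2Q (fun=> 1).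
  by apply: (@L2Q_bounded _ 1) => [|z _ _]; [exact: measurable_cst|rewrite normr1].
have e : (fun x => p x * 1) = p by apply/funext => x; rewrite mulr1.
by have := L2_mul mQ Lp L1; rewrite e.
Qed.

Lemma fibre_mean_sqr_le p : L2Q p -> {ae mu, forall x, `]a, b[%classic x ->
  fibre_mean p x ^+ 2 <= \int[mu]_(r in `]0, 1[) (p (x, r) ^+ 2)}.
Proof.
move=> Lp; apply: ae_mono (L2Q_section Lp) => x h Ox.
have L1 : L2 mu `]0, 1[ (fun=> 1 : R).
  by apply: (@L2_bounded _ _ _ _ 1) => [|r]; [exact: measurable_cst|rewrite normr1].
have := Rintegral_cauchy_schwarz mI01 (h Ox) L1.
under eq_Rintegral do rewrite mulr1.
under [X in _ <= _ * X -> _]eq_Rintegral do rewrite expr1n.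
by rewrite Rintegral_itv_cst// subr0 !mulr1.
Qed.

Let measurable_fibre_mean p : L2Q p -> measurable_fun Om (fibre_mean p).
Proof.
move=> Lp; apply: integrable_EFin_measurable.
exact: (integrable_section_Rintegral mOm mI01 (L2Q_integrable Lp)).
Qed.

Let integrable_fibre_sqr p : L2Q p ->
  mu.-integrable Om (EFin \o (fun x => \int[mu]_(r in `]0, 1[) (p (x, r) ^+ 2))).
Proof. by move=> [_ p2]; exact: (integrable_section_Rintegral mOm mI01 p2). Qed.

Lemma L2_fibre_mean p : L2Q p -> L2 mu `]a, b[ (fibre_mean p).
Proof.
move=> Lp; have mf := measurable_fibre_mean Lp; split => //.
have ip := integrable_fibre_sqr Lp.
apply/integrableP; split; first by apply/measurable_EFinP; exact: measurable_funX.
case/integrableP: ip => mi; apply: le_lt_trans.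
apply: ae_ge0_le_integral => //.
- by apply: measurableT_comp => //; apply/measurable_EFinP; exact: measurable_funX.
- exact: measurableT_comp.
- apply: ae_mono (fibre_mean_sqr_le Lp) => x h Ox; rewrite /= lee_fin ger0_norm ?sqr_ge0//.
  by rewrite (le_trans (h Ox))// ler_norm.
Qed.

Lemma Rintegral_fibre_mean_sqr_le p : L2Q p ->
  \int[mu]_(x in `]a, b[) (fibre_mean p x ^+ 2) <=
  \int[(mu \x mu)%E]_(z in `]a, b[%classic `*` `]0, 1[%classic) (p z ^+ 2).
Proof.
move=> Lp; have [_ p2] := Lp.
rewrite -(Rintegral_product mOm mI01 p2) /Rintegral.
have [_ i1] := L2_fibre_mean Lp; have i2 := integrable_fibre_sqr Lp.
apply: fine_le; [exact: integrable_fin_num|exact: integrable_fin_num|].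
apply: ae_ge0_le_integral => //.
- by move=> x _; rewrite lee_fin sqr_ge0.
- exact: (measurable_int mu).
- by move=> x _; rewrite lee_fin Rintegral_sqr_ge0.
- exact: (measurable_int mu).
- by apply: ae_mono (fibre_mean_sqr_le Lp) => x h Ox; rewrite lee_fin h.
Qed.

Lemma fibre_mean_lin r p q : L2Q p -> L2Q q -> {ae mu, forall x, `]a, b[%classic x ->
  fibre_mean (fun z => r * p z + q z) x = r * fibre_mean p x + fibre_mean q x}.
Proof.
move=> Lp Lq; apply: ae_mono2 (L2Q_section Lp) (L2Q_section Lq) => x h1 h2 Ox.
by rewrite /fibre_mean Rintegral_lin//; [exact: L2_integrable (h1 Ox)|exact: L2_integrable (h2 Ox)].
Qed.

End UnitSquareFibres.

(** Closing arithmetic of [H10_lin]: [A], [A'] are the approximation errors of [f] and its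
    derivative, [B], [B'] those of [g], and [k] is the square of the scalar. *)
Lemma sqr_lin_lt (R : realFieldType) (k A A' B B' X Y e : R) : 0 <= k ->
  X <= 2 * k * A + 2 * B -> Y <= 2 * k * A' + 2 * B' ->
  A + A' < e / (2 * k + 2) -> B + B' < e / (2 * k + 2) -> X + Y < e.
Proof.
move=> k0 h1 h2 h3 h4; have c0 : 0 < 2 * k + 2 by lra.
have -> : e = 2 * k * (e / (2 * k + 2)) + 2 * (e / (2 * k + 2)).
  by field; rewrite gt_eqF.
have : 2 * k * (A + A') <= 2 * k * (e / (2 * k + 2)).
  by apply: ler_wpM2l; [rewrite mulr_ge0|exact: ltW].
lra.
Qed.

Section StateSpace.
Variable R : realType.
Local Notation mu := (@lebesgue_measure R).
Variables (alpha ell xi : R).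
Hypotheses (alpha_gt0 : 0 < alpha) (ell_gt0 : 0 < ell) (xi_gt0 : 0 < xi).
Local Notation Om := (`]0, ell[%classic : set (measurableTypeR R)).
Local Notation I01 := (`]0, 1[%classic : set (measurableTypeR R)).
Local Notation Q := (Om `*` I01).
Local Notation L2Om := (L2 mu `]0, ell[).
Local Notation L2Q := (L2 (mu \x mu)%E (`]0, ell[%classic `*` `]0, 1[%classic)).
Local Notation dx := (wderiv 0 ell).
Local Notation H := (Hspace ell).
Local Notation N := (Hnorm alpha ell xi).
Implicit Types (U W X : state R) (k r e : R).

Let mOm : measurable Om := measurable_itv _.
Let mI01 : measurable I01 := measurable_itv _.
Let mQ : measurable Q. Proof. exact: measurableX. Qed.

Definition st_u U : R -> R := U.1.1.1.
Definition st_v U : R -> R := U.1.1.2.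
Definition st_z U : R * R -> R := U.1.2.
Definition st_t U : R -> R := U.2.

Lemma st_u_lin k U W : st_u (k *: U + W) = (fun x => k * st_u U x + st_u W x).
Proof. by case: U => [[[u v] z] t]; case: W => [[[u' v'] z'] t']. Qed.

Lemma st_v_lin k U W : st_v (k *: U + W) = (fun x => k * st_v U x + st_v W x).
Proof. by case: U => [[[u v] z] t]; case: W => [[[u' v'] z'] t']. Qed.

Lemma st_z_lin k U W : st_z (k *: U + W) = (fun x => k * st_z U x + st_z W x).
Proof. by case: U => [[[u v] z] t]; case: W => [[[u' v'] z'] t']. Qed.

Lemma st_t_lin k U W : st_t (k *: U + W) = (fun x => k * st_t U x + st_t W x).
Proof. by case: U => [[[u v] z] t]; case: W => [[[u' v'] z'] t']. Qed.

Definition st_lin := (st_u_lin, st_v_lin, st_z_lin, st_t_lin).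

Lemma HspaceP U : H U <-> [/\ H10 0 ell (st_u U), L2Om (st_v U), L2Q (st_z U),
  L2Om (st_t U) & \int[mu]_(x in `]0, ell[) st_t U x = 0].
Proof. by case: U => [[[f g] p] h]. Qed.

Lemma H10_0 a b : a < b -> H10 a b (fun=> 0 : R).
Proof.
move=> ab; have w0 : is_wderiv a b (fun=> 0 : R) (fun=> 0).
  split; [exact: L2_0|exact: L2_0|move=> phi tp].
  under eq_Rintegral do rewrite mul0r.
  under [in RHS]eq_Rintegral do rewrite mul0r.
  by rewrite /Rintegral integral0 oppr0.
have t0 := test_fun0 ab.
split=> [|e e0]; first by exists (fun=> 0).
exists (fun=> 0) => //.
have d0 : ((fun _ : R => 0 : R)^`())%classic = (fun=> 0).
  by apply/funext => x; rewrite derive1_cst.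
have -> : \int[mu]_(x in `]a, b[) ((wderiv a b (fun=> 0 : R) x - ((fun _ : R => 0 : R)^`())%classic x) ^+ 2) =
    \int[mu]_(x in `]a, b[) (0 : R).
  have Lw := L2_wderiv (ex_intro _ _ w0 : H1 a b (fun=> 0)).
  rewrite d0; apply: ae_eq_Rintegral; [exact: measurable_itv| |exact: measurable_cst|].
    by apply: measurable_funX; apply: measurable_funB; [exact: (L2_measurable Lw)|exact: measurable_cst].
  by apply: ae_mono (wderiv_ae w0) => x h /h ->; rewrite subrr expr0n.
under eq_Rintegral do rewrite subrr expr0n.
by rewrite /Rintegral !integral0 addr0.
Qed.


Lemma Rintegral_sqr_lin_le d (T : measurableType d) (m : {measure set T -> \bar R}) (D : set T) k (f g : T -> R) :
  measurable D -> L2 m D f -> L2 m D g ->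
  \int[m]_(x in D) ((k * f x + g x) ^+ 2) <=
    2 * k ^+ 2 * \int[m]_(x in D) (f x ^+ 2) + 2 * \int[m]_(x in D) (g x ^+ 2).
Proof.
move=> mD Lf Lg; have [mf f2] := Lf; have [mg g2] := Lg.
have i2 : m.-integrable D (EFin \o (fun x => 2 * g x ^+ 2)) by exact: integrable_EFinZ.
rewrite -[X in _ <= _ + X]RintegralZl// -Rintegral_lin//.
apply: le_Rintegral => //; first by case: (L2_lin mD k Lf Lg).
  by apply: integrable_EFinD => //; exact: integrable_EFinZ.
by move=> x _; have := sqr_ge0 (k * f x - g x); rewrite sqrrB sqrrD exprMn; lra.
Qed.

Lemma H10_lin a b k (f g : R -> R) : H10 a b f -> H10 a b g -> H10 a b (fun x => k * f x + g x).
Proof.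
move=> [hf af] [hg ag]; split=> [|e e0]; first exact: H1_lin.
have c0 : 0 < 2 * k ^+ 2 + 2 by rewrite ltr_wpDl// mulr_ge0// sqr_ge0.
have [phi tphi hphi] := af _ (divr_gt0 e0 c0); have [psi tpsi hpsi] := ag _ (divr_gt0 e0 c0).
exists (fun x => k * phi x + psi x); first exact: test_fun_lin.
have mI : measurable (`]a, b[%classic : set (measurableTypeR R)) by exact: measurable_itv.
have Lphi := L2_test_fun tphi; have Lpsi := L2_test_fun tpsi.
have Lphi' := L2_test_fun (test_fun_derive1 tphi); have Lpsi' := L2_test_fun (test_fun_derive1 tpsi).
have Lf := L2B mI (H1_L2 hf) Lphi; have Lg := L2B mI (H1_L2 hg) Lpsi.
have Lf' := L2B mI (L2_wderiv hf) Lphi'; have Lg' := L2B mI (L2_wderiv hg) Lpsi'.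
have dE : ((fun x => k * phi x + psi x)^`())%classic = (fun x => k * (phi^`())%classic x + (psi^`())%classic x).
  apply/funext => x; rewrite derive1E.
  have [sp _] := (test_funP a b phi).1 tphi; have [sq _] := (test_funP a b psi).1 tpsi.
  have d1 := is_deriveZ k (smooth_is_derive x sp).
  by case: (is_deriveD d1 (smooth_is_derive x sq)).
have e1 : \int[mu]_(x in `]a, b[) ((k * f x + g x - (k * phi x + psi x)) ^+ 2) =
   \int[mu]_(x in `]a, b[) ((k * (f x - phi x) + (g x - psi x)) ^+ 2).
  by apply: eq_Rintegral => x _; congr (_ ^+ 2); ring.
have e2 : \int[mu]_(x in `]a, b[) ((wderiv a b (fun x => k * f x + g x) x - ((fun x => k * phi x + psi x)^`())%classic x) ^+ 2) =
   \int[mu]_(x in `]a, b[) ((k * (wderiv a b f x - (phi^`())%classic x) + (wderiv a b g x - (psi^`())%classic x)) ^+ 2).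
  apply: ae_eq_Rintegral => //.
  - apply: measurable_funX; rewrite dE; apply: (L2_measurable (mu := mu)).
    by apply: L2B => //; [exact: L2_wderiv (H1_lin k hf hg)|exact: L2_lin].
  - by apply: measurable_funX; apply: (L2_measurable (mu := mu)); exact: L2_lin.
  - by apply: ae_mono (wderiv_lin k hf hg) => x h /h ->; rewrite dE; congr (_ ^+ 2); ring.
rewrite e1 e2.
have b1 := Rintegral_sqr_lin_le k mI Lf Lg; have b2 := Rintegral_sqr_lin_le k mI Lf' Lg'.
exact: sqr_lin_lt (sqr_ge0 k) b1 b2 hphi hpsi.
Qed.

Lemma Hspace_0 : H 0.
Proof.
have e0 : [/\ st_u 0 = (fun=> 0), st_v 0 = (fun=> 0), st_z 0 = (fun=> 0) & st_t 0 = (fun=> 0)] by [].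
apply/HspaceP; case: e0 => -> -> -> ->; split; [exact: H10_0|exact: L2_0|exact: L2_0|exact: L2_0|].
by rewrite /Rintegral integral0.
Qed.

Lemma Hspace_lin k U W : H U -> H W -> H (k *: U + W).
Proof.
move=> /HspaceP[u1 v1 z1 t1 m1] /HspaceP[u2 v2 z2 t2 m2]; apply/HspaceP; rewrite !st_lin; split.
- exact: H10_lin.
- exact: L2_lin.
- exact: L2_lin.
- exact: L2_lin.
- rewrite Rintegral_lin//; [|exact: L2_integrable t1|exact: L2_integrable t2].
  by rewrite m1 m2 mulr0 addr0.
Qed.

Lemma ae_linear_dx : ae_linear_L2 mu Om H (fun U => dx (st_u U)).
Proof.
split=> [U /HspaceP[[hu _] _ _ _ _]|r U W /HspaceP[[hu _] _ _ _ _] /HspaceP[[hw _] _ _ _ _]].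
  exact: L2_wderiv.
by rewrite st_u_lin; exact: wderiv_lin.
Qed.

Lemma ae_linear_u : ae_linear_L2 mu Om H st_u.
Proof.
split=> [U /HspaceP[[hu _] _ _ _ _]|r U W _ _]; first exact: H1_L2.
by rewrite st_u_lin; exact: aeW.
Qed.

Lemma ae_linear_v : ae_linear_L2 mu Om H st_v.
Proof. by split=> [U /HspaceP[]//|r U W _ _]; rewrite st_v_lin; exact: aeW. Qed.

Lemma ae_linear_t : ae_linear_L2 mu Om H st_t.
Proof. by split=> [U /HspaceP[]//|r U W _ _]; rewrite st_t_lin; exact: aeW. Qed.

Lemma ae_linear_z : ae_linear_L2 (mu \x mu)%E Q H st_z.
Proof. by split=> [U /HspaceP[]//|r U W _ _]; rewrite st_z_lin; exact: aeW. Qed.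

Lemma ae_linear_fibre_mean : ae_linear_L2 mu Om H (fun U => fibre_mean (st_z U)).
Proof.
split=> [U /HspaceP[_ _ hz _ _]|r U W /HspaceP[_ _ hz _ _] /HspaceP[_ _ hw _ _]].
  exact: L2_fibre_mean.
by rewrite st_z_lin; exact: fibre_mean_lin.
Qed.

Local Notation blk := (block mu Om).
Local Notation blkQ := (block (mu \x mu)%E Q).

Definition inner_blocks U W : R :=
  alpha * blk (fun U => dx (st_u U)) (fun U => dx (st_u U)) U W +
  (blk st_v st_v U W + (blk st_t st_t U W + xi * blkQ st_z st_z U W)).

Lemma innerE U W : H U -> H W -> inner alpha ell xi U W = inner_blocks U W.
Proof.
move=> hU hW; have [Lu _] := ae_linear_dx.
have /HspaceP[_ v1 z1 t1 _] := hU; have /HspaceP[_ v2 z2 t2 _] := hW.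
have i1 := L2_mul mOm (Lu U hU) (Lu W hW); have i2 := L2_mul mOm v1 v2; have i3 := L2_mul mOm t1 t2.
have -> : inner alpha ell xi U W =
  \int[mu]_(x in `]0, ell[) (alpha * (dx (st_u U) x * dx (st_u W) x) + st_v U x * st_v W x + st_t U x * st_t W x)
  + xi * \int[mu]_(x in `]0, ell[) (\int[mu]_(r in `]0, 1[) (st_z U (x, r) * st_z W (x, r))).
  by move: (U) (W) => [[[u v] z] t] [[[u' v'] z'] t'].
rewrite /inner_blocks /block -(Rintegral_fibre_mul z1 z2) !addrA; congr (_ + _).
rewrite -addrA -RintegralD// -Rintegral_lin//; last exact: integrable_EFinD.
by apply: eq_Rintegral => x _; rewrite addrA.
Qed.

Lemma symmetric_inner : symmetric_form H (inner alpha ell xi).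
Proof.
apply: (eq_symmetric_form Hspace_lin (B := inner_blocks)).
  by move=> U W hU hW; rewrite innerE.
apply: symmetric_formD; first exact: symmetric_formZ (block_diag_symmetric mOm Hspace_lin ae_linear_dx).
apply: symmetric_formD; first exact: (block_diag_symmetric mOm Hspace_lin ae_linear_v).
apply: symmetric_formD; first exact: (block_diag_symmetric mOm Hspace_lin ae_linear_t).
exact: symmetric_formZ (block_diag_symmetric mQ Hspace_lin ae_linear_z).
Qed.

Lemma inner_diag U : H U -> inner alpha ell xi U U =
  alpha * \int[mu]_(x in `]0, ell[) (dx (st_u U) x ^+ 2) +
  (\int[mu]_(x in `]0, ell[) (st_v U x ^+ 2) + (\int[mu]_(x in `]0, ell[) (st_t U x ^+ 2) +
   xi * \int[(mu \x mu)%E]_(q in Q) (st_z U q ^+ 2))).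
Proof. by move=> hU; rewrite innerE. Qed.

Lemma inner_ge0 U : H U -> 0 <= inner alpha ell xi U U.
Proof.
move=> hU; rewrite inner_diag// addr_ge0// ?(mulr_ge0 (ltW alpha_gt0)) ?Rintegral_sqr_ge0//.
by rewrite addr_ge0// ?Rintegral_sqr_ge0// addr_ge0// ?(mulr_ge0 (ltW xi_gt0)) ?Rintegral_sqr_ge0.
Qed.

Lemma Hnorm_seminormed : seminormed H N.
Proof.
exact: (semi_inner_seminormed Hspace_0 Hspace_lin symmetric_inner inner_ge0).
Qed.

End StateSpace.

Lemma sqr_addr_le2 (R : realFieldType) (A B s s' g g' c q : R) : 0 <= g -> 0 <= g' ->
  A ^+ 2 <= s * g -> B ^+ 2 <= s' * g' -> s <= c * q -> s' <= c * q ->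
  (A + B) ^+ 2 <= 2 * c * (g + g') * q.
Proof.
move=> g0 g'0 c1 c2 hs hs'.
have := sqr_ge0 (A - B); rewrite (sqrrB A B) (sqrrD A B).
have := ler_wpM2r g0 hs; have := ler_wpM2r g'0 hs'; lra.
Qed.

(** Closing arithmetic of [H10_lim]: [A], [A'] measure the distance from a term of the sequence to
    the limit, [B], [B'] that from the term to its test function. *)
Lemma four_errors_lt (R : realFieldType) (A A' B B' c q e : R) :
  A <= c * q -> A' <= c * q -> B + B' < e / 4 -> q * (4 * c + 4) <= e / 2 ->
  0 <= q -> 2 * A + 2 * B + (2 * A' + 2 * B') < e.
Proof. by move=> h1 h2 h3 h4 q0; move: h4; rewrite mulrDr; lra. Qed.

(** * Completeness of the state space *)

Section Completeness.
Variable R : realType.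
Local Notation mu := (@lebesgue_measure R).

Lemma eventually_eq0 (x c : R) : 0 <= c -> (forall n, x ^+ 2 <= c * 2^-1 ^+ n) -> x = 0.
Proof.
move=> c0 h; apply/eqP; rewrite -sqrf_eq0 eq_le sqr_ge0 andbT.
apply/ler_addgt0Pr => e e0; rewrite add0r.
have c1 : 0 < c + 1 by lra.
have [n0 hn] := half_expn_le (divr_gt0 e0 c1).
apply: (le_trans (h n0)); have := hn n0 (leqnn _); rewrite ler_pdivlMr// => h1.
have : 0 <= 2^-1 ^+ n0 :> R by rewrite exprn_ge0// invr_ge0.
by move: h1; rewrite mulrDr mulr1 mulrC; lra.
Qed.

(** The weak derivative is a closed operator: for a fixed test function both sides of its defining
    identity are continuous in the [L2] norm. *)
Lemma is_wderiv_lim a b (f f' : R -> R) (fn fn' : nat -> R -> R) (c : R) : 0 <= c ->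
  L2 mu `]a, b[ f -> L2 mu `]a, b[ f' -> (forall n, is_wderiv a b (fn n) (fn' n)) ->
  (forall n, \int[mu]_(x in `]a, b[) ((fn n x - f x) ^+ 2) <= c * 2^-1 ^+ n) ->
  (forall n, \int[mu]_(x in `]a, b[) ((fn' n x - f' x) ^+ 2) <= c * 2^-1 ^+ n) ->
  is_wderiv a b f f'.
Proof.
move=> c0 Lf Lf' wn hf hf'; split => // phi tp.
have mI : measurable (`]a, b[%classic : set (measurableTypeR R)) by exact: measurable_itv.
have Lp := L2_test_fun tp; have Lp' := L2_test_fun (test_fun_derive1 tp).
apply/eqP; rewrite -subr_eq0 opprK; apply/eqP.
set X := (X in X = 0).
pose g := \int[mu]_(x in `]a, b[) ((phi^`())%classic x ^+ 2).
pose g' := \int[mu]_(x in `]a, b[) (phi x ^+ 2).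
have g0 : 0 <= g by exact: Rintegral_sqr_ge0.
have g'0 : 0 <= g' by exact: Rintegral_sqr_ge0.
apply: (@eventually_eq0 _ (2 * c * (g + g'))) => [|n]; first by rewrite !mulr_ge0// addr_ge0.
have [Ln Ln' hn] := wn n.
have L1 := L2B mI Ln Lf; have L1' := L2B mI Ln' Lf'.
have c1 := Rintegral_cauchy_schwarz mI L1 Lp'; have c2 := Rintegral_cauchy_schwarz mI L1' Lp.
have eX : X = - (\int[mu]_(x in `]a, b[) ((fn n x - f x) * (phi^`())%classic x) +
    \int[mu]_(x in `]a, b[) ((fn' n x - f' x) * phi x)).
  under eq_Rintegral do rewrite mulrBl.
  under [X in _ = - (_ + X)]eq_Rintegral do rewrite mulrBl.
  rewrite !RintegralB//; try exact: L2_mul.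
  by rewrite hn// /X; ring.
rewrite eX sqrrN.
exact: (sqr_addr_le2 g0 g'0 c1 c2 (hf n) (hf' n)).
Qed.

Lemma H10_lim a b (f f' : R -> R) (fn : nat -> R -> R) (c : R) : 0 <= c ->
  L2 mu `]a, b[ f -> L2 mu `]a, b[ f' -> (forall n, H10 a b (fn n)) ->
  (forall n, \int[mu]_(x in `]a, b[) ((fn n x - f x) ^+ 2) <= c * 2^-1 ^+ n) ->
  (forall n, \int[mu]_(x in `]a, b[) ((wderiv a b (fn n) x - f' x) ^+ 2) <= c * 2^-1 ^+ n) ->
  H10 a b f /\ is_wderiv a b f f'.
Proof.
move=> c0 Lf Lf' hn hf hf'.
have mI : measurable (`]a, b[%classic : set (measurableTypeR R)) by exact: measurable_itv.
have ff' : is_wderiv a b f f'.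
  by apply: (is_wderiv_lim c0 Lf Lf' _ hf hf') => n; apply: wderivP; case: (hn n).
split => //; split=> [|e e0]; first by exists f'.
have e4 : 0 < e / 4 by rewrite divr_gt0.
have e2 : 0 < e / 2 by rewrite divr_gt0.
have c1 : 0 < 4 * c + 4 by lra.
have [n hn0] := half_expn_le (divr_gt0 e2 c1).
have {hn0} := hn0 n (leqnn _); rewrite ler_pdivlMr// => small.
have [Hn /(_ _ e4) [phi tp hphi]] := hn n.
exists phi => //.
have Lp := L2_test_fun tp; have Lp' := L2_test_fun (test_fun_derive1 tp).
have Ln := H1_L2 Hn; have Ln' := L2_wderiv Hn.
have b1 := Rintegral_sqr_lin_le (-1) mI (L2B mI Ln Lf) (L2B mI Ln Lp).
have b2 := Rintegral_sqr_lin_le (-1) mI (L2B mI Ln' Lf') (L2B mI Ln' Lp').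
have d1 : \int[mu]_(x in `]a, b[) ((f x - phi x) ^+ 2) =
    \int[mu]_(x in `]a, b[) ((-1 * (fn n x - f x) + (fn n x - phi x)) ^+ 2).
  by apply: eq_Rintegral => x _; congr (_ ^+ 2); ring.
have d2 : \int[mu]_(x in `]a, b[) ((wderiv a b f x - (phi^`())%classic x) ^+ 2) =
    \int[mu]_(x in `]a, b[) ((-1 * (wderiv a b (fn n) x - f' x) + (wderiv a b (fn n) x - (phi^`())%classic x)) ^+ 2).
  apply: ae_eq_Rintegral => //.
  - apply: measurable_funX; apply: (L2_measurable (mu := mu)); apply: L2B => //.
    by apply: L2_wderiv; exists f'.
  - apply: measurable_funX; apply: (L2_measurable (mu := mu)).
    by apply: L2_lin => //; exact: L2B.
  - by apply: ae_mono (wderiv_ae ff') => x h /h ->; congr (_ ^+ 2); ring.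
rewrite d1 d2; apply: (le_lt_trans (lerD b1 b2)).
rewrite sqrrN expr1n mulr1.
apply: (four_errors_lt (hf n) (hf' n) hphi small).
by rewrite exprn_ge0// invr_ge0.
Qed.

Section BlockCompleteness.
Context d (T : measurableType d) (m : {measure set T -> \bar R}).
Variable D : set T.
Hypothesis mD : measurable D.
Variables (V : lmodType R) (H : set V) (a : V -> T -> R).
Hypothesis la : ae_linear_L2 m D H a.

Lemma Rintegral_sqrB U W : (forall (k : R) U W, H U -> H W -> H (k *: U + W)) -> H U -> H W ->
  \int[m]_(x in D) (a (U - W) x ^+ 2) = \int[m]_(x in D) ((a U x - a W x) ^+ 2).
Proof.
move=> Hlin hU hW; have [La l] := la.
rewrite addrC -scaleN1r; have hUW := Hlin (-1) W U hW hU.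
apply: ae_eq_Rintegral => //.
- by apply: measurable_funX; exact: (L2_measurable (La _ hUW)).
- by apply: measurable_funX; exact: (L2_measurable (L2B mD (La _ hU) (La _ hW))).
- by apply: filterS (l (-1) W U hW hU) => x h /h ->; congr (_ ^+ 2); ring.
Qed.

Lemma ae_linear_L2_complete (u : nat -> V) (c : R) :
  (forall (k : R) U W, H U -> H W -> H (k *: U + W)) -> 0 <= c ->
  (forall n, H (u n)) -> (forall n, \int[m]_(x in D) (a (u n.+1 - u n) x ^+ 2) <= c * 4^-1 ^+ n) ->
  exists2 g, L2 m D g & forall n, \int[m]_(x in D) ((a (u n) x - g x) ^+ 2) <= 4 * c * 2^-1 ^+ n.
Proof.
move=> Hlin c0 Hu hu; have [La _] := la; apply: L2_complete => // n; first exact: La.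
by rewrite -Rintegral_sqrB.
Qed.

End BlockCompleteness.

Variables (alpha ell xi : R).
Hypotheses (alpha_gt0 : 0 < alpha) (ell_gt0 : 0 < ell) (xi_gt0 : 0 < xi).
Local Notation Om := (`]0, ell[%classic : set (measurableTypeR R)).
Local Notation I01 := (`]0, 1[%classic : set (measurableTypeR R)).
Local Notation Q := (Om `*` I01).
Local Notation dx := (wderiv 0 ell).
Local Notation H := (Hspace ell).
Local Notation N := (Hnorm alpha ell xi).

Let mOm : measurable Om := measurable_itv _.
Let mQ : measurable Q. Proof. by apply: measurableX => //; exact: measurable_itv. Qed.

(** Each component converges by [L2_complete]. The norm sees only the derivative of the
    displacement; the displacement itself converges by the Poincare inequality, and closedness of
    the weak derivative identifies the limits. Mean zero survives by Cauchy-Schwarz against 1. *)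
Lemma Hspace_complete : complete_seminorm H N.
Proof.
move=> u Hu fast.
have HN := Hnorm_seminormed alpha_gt0 ell_gt0 xi_gt0.
have Hlin := @Hspace_lin R ell.
have Hd n : H (u n.+1 - u n) by exact: (seminormedB HN).
have sq n : inner alpha ell xi (u n.+1 - u n) (u n.+1 - u n) <= 4^-1 ^+ n.
  have := fast n; have i0 := inner_ge0 alpha_gt0 xi_gt0 (Hd n).
  have p0 : 0 <= 2^-1 ^+ n :> R by rewrite exprn_ge0// invr_ge0.
  rewrite -(@ler_pXn2r _ 2)// ?nnegrE// ?sqrtr_ge0// sqr_sqrtr// -exprM mulnC exprM.
  by have -> : 2^-1 ^+ 2 = 4^-1 :> R by field.
have q0 n : 0 <= 4^-1 ^+ n :> R by rewrite exprn_ge0// invr_ge0.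
have comps n : [/\ \int[mu]_(x in `]0, ell[) (dx (st_u (u n.+1 - u n)) x ^+ 2) <= alpha^-1 * 4^-1 ^+ n,
    \int[mu]_(x in `]0, ell[) (st_v (u n.+1 - u n) x ^+ 2) <= 1 * 4^-1 ^+ n,
    \int[mu]_(x in `]0, ell[) (st_t (u n.+1 - u n) x ^+ 2) <= 1 * 4^-1 ^+ n &
    \int[(mu \x mu)%E]_(x in Q) (st_z (u n.+1 - u n) x ^+ 2) <= xi^-1 * 4^-1 ^+ n].
  have := sq n; rewrite (inner_diag _ _ (Hd n)).
  have := Rintegral_sqr_ge0 mu `]0, ell[ (dx (st_u (u n.+1 - u n))).
  have := Rintegral_sqr_ge0 mu `]0, ell[ (st_v (u n.+1 - u n)).
  have := Rintegral_sqr_ge0 mu `]0, ell[ (st_t (u n.+1 - u n)).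
  have := Rintegral_sqr_ge0 (mu \x mu)%E Q (st_z (u n.+1 - u n)).
  set A := Rintegral _ _ _; set B := Rintegral _ _ _; set C := Rintegral _ _ _; set E := Rintegral _ _ _.
  move=> A0 B0 C0 E0 h.
  have h1 : 0 <= alpha * E by rewrite mulr_ge0// ltW.
  have h2 : 0 <= xi * A by rewrite mulr_ge0// ltW.
  rewrite ![_^-1 * _]mulrC !ler_pdivlMr// !mul1r [E * _]mulrC [A * _]mulrC.
  by clear -A0 B0 C0 E0 h h1 h2; split; lra.
have ia0 : 0 <= alpha^-1 by rewrite invr_ge0 ltW.
have ix0 : 0 <= xi^-1 by rewrite invr_ge0 ltW.
have l0 : 0 <= 4 * ell ^+ 2 * alpha^-1 by rewrite mulr_ge0// mulr_ge0// sqr_ge0.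
have ldx := ae_linear_dx ell.
have [f' Lf' hf'] : exists2 g, L2 mu Om g & forall n,
    \int[mu]_(x in Om) ((dx (st_u (u n)) x - g x) ^+ 2) <= 4 * alpha^-1 * 2^-1 ^+ n.
  by apply: (ae_linear_L2_complete mOm ldx Hlin ia0 Hu) => n; case: (comps n).
have [f Lf hf] : exists2 g, L2 mu Om g & forall n,
    \int[mu]_(x in Om) ((st_u (u n) x - g x) ^+ 2) <= 4 * (4 * ell ^+ 2 * alpha^-1) * 2^-1 ^+ n.
  apply: (ae_linear_L2_complete mOm (ae_linear_u ell) Hlin l0 Hu) => n.
  have /HspaceP[hu _ _ _ _] := Hd n.
  apply: (le_trans (poincare ell_gt0 hu)); rewrite subr0 -[leRHS]mulrA; apply: ler_wpM2l.
    by rewrite mulr_ge0// sqr_ge0.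
  by case: (comps n).
have [g Lg hg] : exists2 g, L2 mu Om g & forall n,
    \int[mu]_(x in Om) ((st_v (u n) x - g x) ^+ 2) <= 4 * 1 * 2^-1 ^+ n.
  by apply: (ae_linear_L2_complete mOm (ae_linear_v ell) Hlin ler01 Hu) => n; case: (comps n).
have [h Lh hh] : exists2 g, L2 mu Om g & forall n,
    \int[mu]_(x in Om) ((st_t (u n) x - g x) ^+ 2) <= 4 * 1 * 2^-1 ^+ n.
  by apply: (ae_linear_L2_complete mOm (ae_linear_t ell) Hlin ler01 Hu) => n; case: (comps n).
have [p Lp hp] : exists2 g, L2 (mu \x mu)%E Q g & forall n,
    \int[(mu \x mu)%E]_(x in Q) ((st_z (u n) x - g x) ^+ 2) <= 4 * xi^-1 * 2^-1 ^+ n.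
  by apply: (ae_linear_L2_complete mQ (ae_linear_z ell) Hlin ix0 Hu) => n; case: (comps n).
pose c := 4 * alpha^-1 + 4 * (4 * ell ^+ 2 * alpha^-1).
have c0 : 0 <= c by rewrite addr_ge0// mulr_ge0.
have pw n : 0 <= 2^-1 ^+ n :> R by rewrite exprn_ge0// invr_ge0.
have [hf10 ff'] : H10 0 ell f /\ is_wderiv 0 ell f f'.
  apply: (H10_lim (fn := fun n => st_u (u n)) c0 Lf Lf') => n.
  - by have /HspaceP[] := Hu n.
  - by apply: (le_trans (hf n)); rewrite ler_wpM2r// lerDr mulr_ge0.
  - by apply: (le_trans (hf' n)); rewrite ler_wpM2r// lerDl mulr_ge0.
have h_mean : \int[mu]_(x in `]0, ell[) h x = 0.
  apply: (@eventually_eq0 _ (4 * ell)) => [|n]; first by rewrite mulr_ge0// ltW.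
  have /HspaceP[_ _ _ Ln mn] := Hu n.
  have L1 : L2 mu `]0, ell[ (fun=> 1 : R).
    by apply: (@L2_bounded _ _ _ _ 1) => [|x]; [exact: measurable_cst|rewrite normr1].
  have := Rintegral_cauchy_schwarz mOm (L2B mOm Ln Lh) L1.
  under eq_Rintegral do rewrite mulr1.
  under [X in _ <= _ * X -> _]eq_Rintegral do rewrite expr1n.
  rewrite Rintegral_itv_cst// mul1r subr0.
  rewrite RintegralB//; [|exact: L2_integrable Ln|exact: L2_integrable Lh].
  rewrite mn sub0r sqrrN => h1; apply: (le_trans h1).
  by rewrite mulrAC ler_wpM2r ?(ltW ell_gt0)// (le_trans (hh n))// mulr1.
pose U : state R := (f, g, p, h).
have HU : H U by [].
exists U => // e e0.
(* The four terms of the squared norm are each at most [4 * 2^-n]. *)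
have e16 : 0 < e ^+ 2 / 16 by rewrite divr_gt0// exprn_gt0.
have [n0 hn0] := half_expn_le e16.
exists n0 => n nn0.
have HdU : H (u n - U) by exact: (seminormedB HN).
rewrite -(@ler_pXn2r _ 2)// ?nnegrE ?sqrtr_ge0 ?(ltW e0)//.
rewrite sqr_sqrtr; last exact: inner_ge0.
rewrite inner_diag//.
rewrite (Rintegral_sqrB mOm ldx Hlin (Hu n) HU) (Rintegral_sqrB mOm (ae_linear_v ell) Hlin (Hu n) HU).
rewrite (Rintegral_sqrB mOm (ae_linear_t ell) Hlin (Hu n) HU) (Rintegral_sqrB mQ (ae_linear_z ell) Hlin (Hu n) HU).
have -> : \int[mu]_(x in Om) ((dx (st_u (u n)) x - dx (st_u U) x) ^+ 2) =
    \int[mu]_(x in Om) ((dx (st_u (u n)) x - f' x) ^+ 2).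
  have [Ldx _] := ldx; have L1 := Ldx _ (Hu n); have L2' := Ldx _ HU.
  apply: ae_eq_Rintegral => //.
  - by apply: measurable_funX; exact: (L2_measurable (L2B mOm L1 L2')).
  - by apply: measurable_funX; exact: (L2_measurable (L2B mOm L1 Lf')).
  - by apply: ae_mono (wderiv_ae ff') => x hx /hx ->.
have := hn0 n nn0; have := hf' n; have := hg n; have := hh n; have := hp n.
move: (2^-1 ^+ n) => q; rewrite /st_v /st_t /st_z/=.
set A := Rintegral _ _ _; set B := Rintegral _ _ _; set C := Rintegral _ _ _; set E := Rintegral _ _ _.
move=> hA hB hC hE hq.
have a1 : alpha * E <= 4 * q.
  have := ler_wpM2l (ltW alpha_gt0) hE.
  by have -> : alpha * (4 * alpha^-1 * q) = 4 * q by field; rewrite gt_eqF.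
have x1 : xi * A <= 4 * q.
  have := ler_wpM2l (ltW xi_gt0) hA.
  by have -> : xi * (4 * xi^-1 * q) = 4 * q by field; rewrite gt_eqF.
by clearbody A B C E; clear -a1 x1 hB hC hq; lra.
Qed.

End Completeness.

(** * The generator on its domain *)

Section BoundedMultiplier.
Context d (T : measurableType d) (R : realType) (mu : {measure set T -> \bar R}).
Variable D : set T.
Hypothesis mD : measurable D.

Lemma L2_mul_bounded (m f : T -> R) (M : R) : measurable_fun D m ->
  (forall x, D x -> `|m x| <= M) -> L2 mu D f -> L2 mu D (fun x => m x * f x).
Proof.
move=> mm hM [mf f2]; split; first exact: measurable_funM.
apply: (@le_integrable_EFin _ _ _ _ _ mD _ (fun x => M ^+ 2 * f x ^+ 2)).
- by apply: measurable_funX; exact: measurable_funM.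
- move=> x Dx; rewrite exprMn normrM [`|f x ^+ 2|]ger0_norm ?sqr_ge0//.
  rewrite ler_wpM2r ?sqr_ge0// normrX; apply: lerXn2r; rewrite ?nnegrE//.
    exact: le_trans (hM x Dx).
  exact: hM.
- exact: integrable_EFinZ.
Qed.

Lemma Rintegral_mul_linl (k : R) (f g h : T -> R) : L2 mu D f -> L2 mu D g -> L2 mu D h ->
  \int[mu]_(x in D) ((k * f x + g x) * h x) =
  k * \int[mu]_(x in D) (f x * h x) + \int[mu]_(x in D) (g x * h x).
Proof.
move=> Lf Lg Lh; rewrite -Rintegral_lin//; [|exact: L2_mul|exact: L2_mul].
by apply: eq_Rintegral => x _; ring.
Qed.

Lemma Rintegral_mulC (f g : T -> R) :
  \int[mu]_(x in D) (f x * g x) = \int[mu]_(x in D) (g x * f x).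
Proof. by apply: eq_Rintegral => x _; rewrite mulrC. Qed.

Lemma Rintegral_mulZl (k : R) (f h : T -> R) : L2 mu D f -> L2 mu D h ->
  \int[mu]_(x in D) ((k * f x) * h x) = k * \int[mu]_(x in D) (f x * h x).
Proof.
move=> Lf Lh; rewrite -RintegralZl//; last exact: L2_mul.
by apply: eq_Rintegral => x _; rewrite mulrA.
Qed.

(** [k] is a sign, so that cross terms of either sign are bounded without absolute values. *)
Lemma Rintegral_young2 (s k : R) (f g : T -> R) : 0 < s -> L2 mu D f -> L2 mu D g -> `|k| = 1 ->
  2 * (k * \int[mu]_(x in D) (f x * g x)) <=
  s * \int[mu]_(x in D) (f x ^+ 2) + s^-1 * \int[mu]_(x in D) (g x ^+ 2).
Proof.
move=> s0 Lf Lg k1; have := Rintegral_young mD s0 (L2Z mD k Lf) Lg.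
rewrite Rintegral_mulZl//.
have -> : \int[mu]_(x in D) ((k * f x) ^+ 2) = \int[mu]_(x in D) (f x ^+ 2).
  by apply: eq_Rintegral => x _; rewrite exprMn -[k ^+ 2]real_normK ?num_real// k1 expr1n mul1r.
by rewrite invfM; lra.
Qed.

End BoundedMultiplier.

Section WeightedTrace.
Variable R : realType.
Local Notation mu := (@lebesgue_measure R).
Implicit Types (z q : R -> R).
Local Notation I01 := (`]0, 1[%classic : set (measurableTypeR R)).
Let mI01 : measurable I01 := measurable_itv _.

Let wt (r : R) : R := 2 - r.

Let wt_smooth : smooth wt.
Proof.
have -> : wt = (fun r => id (-1 * r + 2)) by apply/funext => r; rewrite /wt/=; ring.
have si : smooth (@id R).
  apply/smoothP; case => [//|n]; split => [x|]; first exact: derivable_id.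
  have -> : ((@id R)^`())%classic = (fun=> 1) by apply/funext => x; rewrite derive1_id.
  elim: n => [//|n ih]; split => [x|]; first exact: derivable_cst.
  have -> : ((fun _ : R => 1 : R)^`())%classic = (fun=> 0 * 1) by apply/funext => x; rewrite derive1_cst mul0r.
  exact: times_derivableZ.
exact: (@smooth_affine _ (-1) 2 (@id R) si).
Qed.

Let wt_le2 r : I01 r -> `|wt r| <= 2.
Proof. by rewrite /= in_itv/= /wt => /andP[r0 r1]; rewrite ler_norml; lra. Qed.

Let L2_wt f : L2 mu `]0, 1[ f -> L2 mu `]0, 1[ (fun r => wt r * f r).
Proof.
by apply: L2_mul_bounded wt_le2 => //; exact: smooth_measurable.
Qed.

(** The weak product rule: the identity for [z] is tested with [(2 - r) * phi], which is again a
    test function. *)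
Lemma is_wderiv_weight z q : is_wderiv 0 1 z q ->
  is_wderiv 0 1 (fun r => (2 - r) * z r) (fun r => (2 - r) * q r - z r).
Proof.
move=> [Lz Lq zq]; split; [exact: L2_wt|by apply: L2B => //; exact: L2_wt|move=> phi tp].
have [sp [c [d [c0 d1 hp]]]] := (test_funP _ _ phi).1 tp.
have tw : test_fun 0 1 (fun r => wt r * phi r).
  apply/test_funP; split; first exact: smoothM.
  by exists c, d; split => // r hr; rewrite hp// mulr0.
have dw : ((fun r => wt r * phi r)^`())%classic = (fun r => wt r * (phi^`())%classic r - phi r).
  apply/funext => r; rewrite derive1E.
  have dwt : is_derive r 1 wt (-1).
    have := is_deriveB (is_derive_cst (2 : R) r 1) (is_derive_id r 1).
    by rewrite sub0r.
  have := is_deriveM dwt (smooth_is_derive r sp).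
  by case => _ ->; rewrite /GRing.scale/= mulrN1.
have Lp := L2_test_fun tp; have Lp' := L2_test_fun (test_fun_derive1 tp).
have := zq _ tw; rewrite dw.
have -> : \int[mu]_(x in `]0, 1[) (z x * (wt x * (phi^`())%classic x - phi x)) =
    \int[mu]_(x in `]0, 1[) ((wt x * z x) * (phi^`())%classic x) - \int[mu]_(x in `]0, 1[) (z x * phi x).
  rewrite -RintegralB//; [|exact: L2_mul (L2_wt Lz) Lp'|exact: L2_mul].
  by apply: eq_Rintegral => x _; ring.
have -> : \int[mu]_(x in `]0, 1[) (((2 - x) * q x - z x) * phi x) =
    \int[mu]_(x in `]0, 1[) (q x * (wt x * phi x)) - \int[mu]_(x in `]0, 1[) (z x * phi x).
  rewrite -RintegralB//; [|exact: L2_mul Lq (L2_wt Lp)|exact: L2_mul].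
  by apply: eq_Rintegral => x _; rewrite /wt; ring.
rewrite -/(wt _); lra.
Qed.

Lemma has_trace_weight z x y : has_trace 0 1 z x y ->
  has_trace 0 1 (fun r => (2 - r) * z r) x ((2 - x) * y).
Proof.
move=> [w [cw zw wy]]; exists (fun r => (2 - r) * w r); split; last by rewrite wy.
  have cwt : {within `[0, 1], continuous wt}.
    by apply: continuous_subspaceT; exact: smooth_continuous.
  by move=> r; apply: cvgM; [exact: cwt|exact: cw].
by apply: ae_mono zw => r h /h ->.
Qed.

(** Integration by parts for the pair [(2 - r) * z] and [z]. The weight is 2 at [r = 0] and 1 at
    [r = 1], which gives the boundary terms, and its derivative [-1] produces the integral of
    [z ^+ 2]. *)
Lemma weighted_energy_identity z q y0 y1 : is_wderiv 0 1 z q ->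
  has_trace 0 1 z 0 y0 -> has_trace 0 1 z 1 y1 ->
  2 * \int[mu]_(r in `]0, 1[) ((2 - r) * q r * z r) =
  y1 ^+ 2 - 2 * y0 ^+ 2 + \int[mu]_(r in `]0, 1[) (z r ^+ 2).
Proof.
move=> zq t0 t1; have [Lz Lq _] := zq; have zq' := is_wderiv_weight zq.
have [Lz' Lq' _] := zq'.
have [c rz] := is_wderiv_rep ltr01 zq; have [c' rz'] := is_wderiv_rep ltr01 zq'.
have := prim_rep_parts ltr01 zq' zq rz' rz.
rewrite -(has_trace_right ltr01 Lq rz t1) -(has_trace_left ltr01 Lq rz t0).
rewrite -(has_trace_right ltr01 Lq' rz' (has_trace_weight t1)) -(has_trace_left ltr01 Lq' rz' (has_trace_weight t0)).
have -> : \int[mu]_(x in `]0, 1[) ((2 - x) * z x * q x) = \int[mu]_(r in `]0, 1[) ((2 - r) * q r * z r).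
  by apply: eq_Rintegral => x _; ring.
have -> : \int[mu]_(x in `]0, 1[) (((2 - x) * q x - z x) * z x) =
    \int[mu]_(r in `]0, 1[) ((2 - r) * q r * z r) - \int[mu]_(r in `]0, 1[) (z r ^+ 2).
  rewrite -RintegralB//; [|exact: L2_mul (L2_wt Lq) Lz|by case: Lz].
  by apply: eq_Rintegral => x _; ring.
lra.
Qed.

End WeightedTrace.

Section Domain.
Variable R : realType.
Local Notation mu := (@lebesgue_measure R).
Variables (alpha beta gamma kappa tau ell : R).
Hypotheses (ell_gt0 : 0 < ell) (tau_gt0 : 0 < tau).
Local Notation Om := (`]0, ell[%classic : set (measurableTypeR R)).
Local Notation I01 := (`]0, 1[%classic : set (measurableTypeR R)).
Local Notation Q := (Om `*` I01).
Local Notation L2Om := (L2 mu `]0, ell[).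
Local Notation L2Q := (L2 (mu \x mu)%E (`]0, ell[%classic `*` `]0, 1[%classic)).
Local Notation dx := (wderiv 0 ell).

Let mOm : measurable Om := measurable_itv _.
Let mI01 : measurable I01 := measurable_itv _.
Let mQ : measurable Q. Proof. exact: measurableX. Qed.

Lemma drhoP (z : R * R -> R) : L2H1 ell z -> is_drho ell z (drho ell z).
Proof. by move=> h; exact: (@xgetPex _ (fun=> 0) [set q | is_drho ell z q]). Qed.

(** The domain prescribes only the slice at 0. Integrating [z_rho] along fibres provides the one at
    1, without which [slice ell z 1] would be a default value. *)
Lemma is_slice1 (z q : R * R -> R) (w : R -> R) : is_drho ell z q -> is_slice ell z 0 w ->
  is_slice ell z 1 (fun x => w x + fibre_mean q x).
Proof.
move=> [Lz Lq zq] [Lw tw]; split; first by apply: L2D => //; exact: L2_fibre_mean.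
apply: ae_mono2 zq tw => x h1 h2 Ox; have zx := h1 Ox; have tx := h2 Ox.
have [_ Lqx _] := zx; have [c rz] := is_wderiv_rep ltr01 zx.
have -> : w x + fibre_mean q x = c + prim ((fun r => q (x, r)) \_ `]0, 1[) 1.
  by rewrite prim_ext_right -(has_trace_left ltr01 Lqx rz tx).
exact: prim_rep_has_trace.
Qed.

Lemma slice1P (z q : R * R -> R) (w : R -> R) : is_drho ell z q -> is_slice ell z 0 w ->
  is_slice ell z 1 (slice ell z 1) /\
  {ae mu, forall x, `]0, ell[%classic x -> slice ell z 1 x = w x + fibre_mean q x}.
Proof.
move=> zq s0; have s1 := is_slice1 zq s0.
have s1' : is_slice ell z 1 (slice ell z 1).
  exact: (@xgetPex _ (fun=> 0) [set w | is_slice ell z 1 w] (ex_intro _ _ s1)).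
split => //; have [_ _ zq'] := zq; have [_ t1] := s1; have [_ t1'] := s1'.
have ae3 : {ae mu, forall x, `]0, ell[%classic x ->
    has_trace 0 1 (fun s => z (x, s)) 1 (w x + fibre_mean q x) /\
    has_trace 0 1 (fun s => z (x, s)) 1 (slice ell z 1 x)}.
  by apply: ae_mono2 t1 t1' => x h1 h2 Ox; split; [exact: h1|exact: h2].
apply: ae_mono2 zq' ae3 => x h1 h2 Ox; have zx := h1 Ox; have [a b] := h2 Ox.
have [_ Lqx _] := zx; have [c rz] := is_wderiv_rep ltr01 zx.
by rewrite (has_trace_right ltr01 Lqx rz a) (has_trace_right ltr01 Lqx rz b).
Qed.

Section Element.
Variables (u v : R -> R) (z : R * R -> R) (t : R -> R).
Hypothesis DU : domA alpha beta ell ((u, v, z, t) : state R).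
Let q := drho ell z.
Let z1 := slice ell z 1.
Let fx := flux alpha beta ell v z.
Let AU := opA alpha beta gamma kappa tau ell ((u, v, z, t) : state R).

Let hu : H10 0 ell u. Proof. by case: DU => _ [? ? ? ?] _ _ _. Qed.
Let hv : H10 0 ell v. Proof. by case: DU => _ [? ? ? ?] _ _ _. Qed.
Let hz : is_drho ell z q. Proof. by case: DU => _ [_ _ /drhoP h _] _ _ _. Qed.
Let ht : H1 0 ell t. Proof. by case: DU => _ [_ _ _ [h h']] _ _ _. Qed.
Let htx : H1 0 ell (dx t). Proof. by case: DU => _ [_ _ _ [h h']] _ _ _. Qed.
Let hs : is_slice ell z 0 (dx u). Proof. by case: DU. Qed.
Let hfx : H1 0 ell fx. Proof. by case: DU. Qed.
Let ht0 : has_trace 0 ell (dx t) 0 0. Proof. by case: DU => _ _ _ _ []. Qed.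
Let ht1 : has_trace 0 ell (dx t) ell 0. Proof. by case: DU => _ _ _ _ []. Qed.

Let Lux : L2Om (dx u). Proof. by case: hu => /L2_wderiv. Qed.
Let Lvx : L2Om (dx v). Proof. by case: hv => /L2_wderiv. Qed.
Let Lu : L2Om u. Proof. by case: hu => /H1_L2. Qed.
Let Lv : L2Om v. Proof. by case: hv => /H1_L2. Qed.
Let Lt : L2Om t. Proof. exact: H1_L2 ht. Qed.
Let Ltx : L2Om (dx t). Proof. exact: L2_wderiv ht. Qed.
Let Ltxx : L2Om (dx (dx t)). Proof. exact: L2_wderiv htx. Qed.
Let Lz1 : L2Om z1. Proof. by have [[]] := slice1P hz hs. Qed.
Let Lz : L2Q z. Proof. by case: hz. Qed.
Let Lq : L2Q q. Proof. by case: hz. Qed.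
Let Lfx : L2Om (dx fx). Proof. exact: L2_wderiv hfx. Qed.

Lemma domA_L2 : [/\ L2Om (dx u), L2Om (dx v), L2Om u, L2Om v & L2Om t] /\
  [/\ L2Om (dx t), L2Om z1 & L2Q z].
Proof. exact: conj (And5 Lux Lvx Lu Lv Lt) (And3 Ltx Lz1 Lz). Qed.

(** The new temperature component has mean zero because [v] lies in [H10] and [theta_x] has zero
    traces at both ends. *)
Lemma domA_opA_Hspace : Hspace ell AU.
Proof.
split => //.
- by apply: L2B; [|exact: Lfx|exact: L2Z Ltx].
- exact: L2Z.
- by apply: L2D; [|exact: L2Z Lvx|exact: L2Z Ltxx].
- rewrite RintegralD//; [|exact: L2_integrable (L2Z mOm _ Lvx)|exact: L2_integrable (L2Z mOm _ Ltxx)].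
  have iv := L2_integrable Lvx; have ixx := L2_integrable Ltxx.
  rewrite !RintegralZl//.
  rewrite (H10_Rintegral_wderiv ell_gt0 hv).
  by rewrite (dirichlet_trace_Rintegral ell_gt0 (wderivP htx) ht0 ht1) !mulr0 addr0.
Qed.

(** Only the whole flux is known to have a weak derivative, so the derivative is moved onto [w]
    before the flux is split into its elastic and viscous parts. *)
Let momentum (w : R -> R) : H10 0 ell w ->
  \int[mu]_(x in `]0, ell[) (st_v AU x * w x) =
  - alpha * \int[mu]_(x in `]0, ell[) (z1 x * dx w x) - beta * \int[mu]_(x in `]0, ell[) (dx v x * dx w x)
  + gamma * \int[mu]_(x in `]0, ell[) (t x * dx w x).
Proof.
move=> hw; have Lw : L2Om w by case: hw => /H1_L2.
have Lwx : L2Om (dx w) by case: hw => /L2_wderiv.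
transitivity (\int[mu]_(x in `]0, ell[) ((- gamma * dx t x + dx fx x) * w x)).
  by apply: eq_Rintegral => x _; rewrite /st_v/= -/fx; ring.
rewrite Rintegral_mul_linl// ![\int[mu]_(x in _) (dx _ x * w x)]Rintegral_mulC.
rewrite (H10_parts hw (wderivP ht)) (H10_parts hw (wderivP hfx)).
have e : \int[mu]_(x in `]0, ell[) (dx w x * fx x) =
    alpha * \int[mu]_(x in `]0, ell[) (z1 x * dx w x) + beta * \int[mu]_(x in `]0, ell[) (dx v x * dx w x).
  transitivity (\int[mu]_(x in `]0, ell[) ((alpha * z1 x + beta * dx v x) * dx w x)).
    by apply: eq_Rintegral => x _; rewrite mulrC.
  by rewrite Rintegral_mul_linl ?Rintegral_mulZl//; exact: L2Z.
by rewrite e (Rintegral_mulC mu Om (dx w) t); ring.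
Qed.

Lemma domA_momentum_v : \int[mu]_(x in `]0, ell[) (st_v AU x * v x) =
  - alpha * \int[mu]_(x in `]0, ell[) (z1 x * dx v x) - beta * \int[mu]_(x in `]0, ell[) (dx v x ^+ 2)
  + gamma * \int[mu]_(x in `]0, ell[) (t x * dx v x).
Proof. by rewrite momentum. Qed.

Lemma domA_momentum_u : \int[mu]_(x in `]0, ell[) (st_v AU x * u x) =
  - alpha * \int[mu]_(x in `]0, ell[) (z1 x * dx u x) - beta * \int[mu]_(x in `]0, ell[) (dx v x * dx u x)
  + gamma * \int[mu]_(x in `]0, ell[) (t x * dx u x).
Proof. by rewrite momentum. Qed.

Lemma domA_heat : \int[mu]_(x in `]0, ell[) (st_t AU x * t x) =
  - gamma * \int[mu]_(x in `]0, ell[) (t x * dx v x) - kappa * \int[mu]_(x in `]0, ell[) (dx t x ^+ 2).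
Proof.
transitivity (\int[mu]_(x in `]0, ell[) ((- gamma * dx v x + kappa * dx (dx t) x) * t x)) => //.
rewrite Rintegral_mul_linl ?Rintegral_mulZl//; last exact: L2Z.
have := dirichlet_trace_parts ell_gt0 (wderivP htx) (wderivP ht) ht0 ht1.
rewrite (Rintegral_mulC mu Om (dx v) t).
have -> : \int[mu]_(x in `]0, ell[) (dx t x * dx t x) = \int[mu]_(x in `]0, ell[) (dx t x ^+ 2) by [].
move=> ->; ring.
Qed.

(** The transport equation integrated along a fibre: the mean of [z_rho] is [z(., 1) - u_x], since
    the slice at 0 is [u_x]. *)
Lemma domA_fibre_mean : {ae mu, forall x, `]0, ell[%classic x ->
  fibre_mean (st_z AU) x = tau^-1 * (dx u x - z1 x)}.
Proof.
have [_ e1] := slice1P hz hs; apply: ae_mono2 e1 (L2Q_section Lq) => x h1 h2 Ox.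
rewrite /z1 h1// /fibre_mean RintegralZl//; last exact: L2_integrable (h2 Ox).
by rewrite -/(fibre_mean q x); ring.
Qed.

(** Fibrewise [weighted_energy_identity] integrated over [x], with boundary values [u_x] at
    [rho = 0] and [z(., 1)] at [rho = 1]. *)
Lemma domA_transport :
  \int[(mu \x mu)%E]_(p in Q) ((2 - p.2) * st_z AU p * z p) =
  - (2 * tau)^-1 * (\int[mu]_(x in `]0, ell[) (z1 x ^+ 2) - 2 * \int[mu]_(x in `]0, ell[) (dx u x ^+ 2)
    + \int[(mu \x mu)%E]_(p in Q) (z p ^+ 2)).
Proof.
have Lwq : L2Q (fun p => (2 - p.2) * q p).
  apply: (@L2_mul_bounded _ _ _ _ _ mQ _ _ 2) => //.
    by apply: measurable_funTS; apply: measurable_funB => //; exact: measurable_cst.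
  by move=> p [_ /=]; rewrite in_itv/= => /andP[p0 p1]; rewrite ler_norml; lra.
transitivity (- tau^-1 * \int[(mu \x mu)%E]_(p in Q) (((2 - p.2) * q p) * z p)).
  rewrite -RintegralZl//; last exact: L2_mul.
  by apply: eq_Rintegral => p _; rewrite /st_z/= -/q; ring.
rewrite -(Rintegral_fibre_mul Lwq Lz).
have [_ z2] := Lz; rewrite -(Rintegral_product mOm mI01 z2).
have i1 := integrable_section_Rintegral mOm mI01 (L2_mul mQ Lwq Lz).
have i2 := integrable_section_Rintegral mOm mI01 z2.
have [[_ tr1] _] := slice1P hz hs; have [_ tr0] := hs; have [_ _ zq] := hz.
have trs : {ae mu, forall x, `]0, ell[%classic x -> has_trace 0 1 (fun s => z (x, s)) 0 (dx u x) /\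
    has_trace 0 1 (fun s => z (x, s)) 1 (z1 x)}.
  by apply: ae_mono2 tr0 tr1 => x h1 h2 Ox; split; [exact: h1|exact: h2].
have [_ s1] := Lz1; have [_ s2] := Lux.
have : 2 * \int[mu]_(x in `]0, ell[) (\int[mu]_(r in `]0, 1[) ((2 - (x, r).2) * q (x, r) * z (x, r))) =
   \int[mu]_(x in `]0, ell[) (-2 * dx u x ^+ 2 + (z1 x ^+ 2 + \int[mu]_(r in `]0, 1[) (z (x, r) ^+ 2))).
  rewrite -RintegralZl//; apply: ae_eq_Rintegral => //.
  - by apply: measurable_funM; [exact: measurable_cst|exact: integrable_EFin_measurable i1].
  - apply: measurable_funD; first by apply: measurable_funM; [exact: measurable_cst|exact: integrable_EFin_measurable s2].
    by apply: measurable_funD; [exact: integrable_EFin_measurable s1|exact: integrable_EFin_measurable i2].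
  - apply: ae_mono2 zq trs => x h1 h2 Ox; have [a b] := h2 Ox.
    by rewrite /= (weighted_energy_identity (h1 Ox) a b); ring.
rewrite Rintegral_lin//; last exact: integrable_EFinD.
rewrite RintegralD// invfM.
have t0 : tau != 0 by rewrite gt_eqF.
set X := \int[mu]_(x in _) _ => h.
have -> : X = 2^-1 * (2 * X) by rewrite mulrA mulVf ?mul1r// pnatr_eq0.
by rewrite h; field.
Qed.

End Element.
End Domain.

(** * The Lyapunov functional *)

Section RealEstimates.
Variable F : realFieldType.
Implicit Types (alpha beta gamma kappa tau k P : F).

(* [V], [Tt], [Vx], [Ux], [Tx], [Z1], [ZZ], [zz] are the squared norms of [v],
   [theta], [v_x], [u_x], [theta_x], [z(., 1)], [Z = int_0^1 z] and [z]; [a] to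
   [h] are the integrals of [z(., 1) v_x], [theta u_x], [v_x Z], [u_x Z],
   [z(., 1) Z], [z(., 1) u_x], [v_x u_x] and [theta v_x]. *)
Lemma dissipation_estimate alpha beta gamma kappa tau k P
    (V Tt Vx Ux Tx Z1 ZZ zz a b c d e f g h : F) :
  0 < alpha -> 0 < beta -> 0 < gamma -> 0 < kappa -> 0 < tau -> 0 < k ->
  0 <= Vx -> 0 <= Ux -> 0 <= Tx -> 0 <= Z1 -> 0 <= ZZ -> 0 <= zz ->
  V <= P * Vx -> Tt <= P * Tx -> ZZ <= zz ->
  16 * k * alpha <= beta -> 8 * P <= k * beta -> 32 * (alpha * tau ^+ 2) <= k * beta ->
  8 * (alpha * tau) <= beta -> 4 * gamma ^+ 2 * P <= k * (alpha * kappa) ->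
  2 * (-1 * a) <= 8 * k * Vx + (8 * k)^-1 * Z1 ->
  2 * (1 * b) <= alpha / (4 * gamma) * Ux + (alpha / (4 * gamma))^-1 * Tt ->
  2 * (-1 * c) <= 8 * tau * Vx + (8 * tau)^-1 * ZZ ->
  2 * (1 * d) <= 1 * Ux + 1^-1 * ZZ ->
  2 * (-1 * e) <= 1 * Z1 + 1^-1 * ZZ ->
  2 * (k * beta * (- alpha * a - beta * Vx + gamma * h) +
    (k * beta * (- gamma * h - kappa * Tx) +
    (beta * (V + (- alpha * f - beta * g + gamma * b)) +
    (beta ^+ 2 * g - alpha * beta * tau * c - alpha * beta * Ux
      + alpha ^+ 2 * tau * d + alpha * beta * f - alpha ^+ 2 * tau * e +
    alpha * beta * tau / 2 * (- (2 * tau)^-1 * (Z1 - 2 * Ux + zz)))))) <=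
  - (alpha * beta / 2 * Ux + alpha * beta / 8 * zz + k * beta ^+ 2 * Vx + k * beta * kappa * Tx).
Proof.
move=> al be ga ka ta k0 Vx0 Ux0 Tx0 Z10 ZZ0 zz0 hV hT hZ h1 h2 h3 h4 h5 ya yb yc yd ye.
have kb : 0 < k * beta by rewrite mulr_gt0.
have kba : 0 < k * beta * alpha by rewrite mulr_gt0.
have ea : 2 * (-1 * a) * (k * beta * alpha) <= 8 * k * Vx * (k * beta * alpha) + alpha * beta / 8 * Z1.
  have := ler_wpM2r (ltW kba) ya; rewrite [leRHS]mulrDl.
  by have -> : (8 * k)^-1 * Z1 * (k * beta * alpha) = alpha * beta / 8 * Z1 by field; rewrite gt_eqF.
have ea' : 8 * k * Vx * (k * beta * alpha) <= k * beta ^+ 2 / 2 * Vx.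
  have := ler_wpM2r (mulr_ge0 (ltW kb) Vx0) h1.
  by rewrite !expr2; lra.
have eb : 2 * (1 * b) * (beta * gamma) <= alpha * beta / 4 * Ux + 4 * beta * gamma ^+ 2 / alpha * Tt.
  have := ler_wpM2r (ltW (mulr_gt0 be ga)) yb; rewrite [leRHS]mulrDl.
  have -> : alpha / (4 * gamma) * Ux * (beta * gamma) = alpha * beta / 4 * Ux by field; rewrite gt_eqF.
  by have -> : (alpha / (4 * gamma))^-1 * Tt * (beta * gamma) = 4 * beta * gamma ^+ 2 / alpha * Tt
    by field; rewrite !gt_eqF.
have eb' : 4 * beta * gamma ^+ 2 / alpha * Tt <= k * beta * kappa * Tx.
  have c0 : 0 <= 4 * beta * gamma ^+ 2 / alpha.
    by apply: divr_ge0 (ltW al); rewrite mulr_ge0 ?sqr_ge0// mulr_ge0 ?(ltW be).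
  apply: (le_trans (ler_wpM2l c0 hT)).
  have -> : 4 * beta * gamma ^+ 2 / alpha * (P * Tx) = (4 * gamma ^+ 2 * P) * (beta / alpha * Tx).
    by field; rewrite gt_eqF.
  have -> : k * beta * kappa * Tx = (k * (alpha * kappa)) * (beta / alpha * Tx).
    by field; rewrite gt_eqF.
  by apply: ler_wpM2r => //; rewrite mulr_ge0// divr_ge0// ltW.
have abt : 0 < alpha * beta * tau by rewrite !mulr_gt0.
have ec : 2 * (-1 * c) * (alpha * beta * tau) <= 8 * (alpha * tau ^+ 2) * beta * Vx + alpha * beta / 8 * ZZ.
  have := ler_wpM2r (ltW abt) yc; rewrite [leRHS]mulrDl.
  have -> : 8 * tau * Vx * (alpha * beta * tau) = 8 * (alpha * tau ^+ 2) * beta * Vx by ring.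
  by have -> : (8 * tau)^-1 * ZZ * (alpha * beta * tau) = alpha * beta / 8 * ZZ by field; rewrite gt_eqF.
have ec' : 8 * (alpha * tau ^+ 2) * beta * Vx <= k * beta ^+ 2 / 4 * Vx.
  by have := ler_wpM2r (mulr_ge0 (ltW be) Vx0) h3; rewrite [beta ^+ 2]expr2; lra.
have aat : 0 <= alpha ^+ 2 * tau by rewrite mulr_ge0 ?sqr_ge0// ltW.
have aat' : alpha ^+ 2 * tau <= alpha * beta / 8.
  by have := ler_wpM2l (ltW al) h4; rewrite expr2; lra.
have ed : 2 * (1 * d) * (alpha ^+ 2 * tau) <= alpha * beta / 8 * Ux + alpha * beta / 8 * ZZ.
  have := ler_wpM2r aat yd; rewrite invr1 !mul1r [leRHS]mulrDl.
  by have := ler_wpM2l Ux0 aat'; have := ler_wpM2l ZZ0 aat'; lra.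
have ee : 2 * (-1 * e) * (alpha ^+ 2 * tau) <= alpha * beta / 8 * Z1 + alpha * beta / 8 * ZZ.
  have := ler_wpM2r aat ye; rewrite invr1 !mul1r [leRHS]mulrDl.
  by have := ler_wpM2l Z10 aat'; have := ler_wpM2l ZZ0 aat'; lra.
have eV : 2 * beta * V <= k * beta ^+ 2 / 4 * Vx.
  have := ler_wpM2l (ltW be) hV; have := ler_wpM2r (mulr_ge0 (ltW be) Vx0) h2.
  by rewrite expr2; lra.
have ab : 0 < alpha * beta by rewrite mulr_gt0.
have eZ : alpha * beta * ZZ <= alpha * beta * zz by rewrite ler_pM2l.
have abU : 0 <= alpha * beta * Ux by rewrite mulr_ge0// ltW.
have abZ1 : 0 <= alpha * beta * Z1 by rewrite mulr_ge0// ltW.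
have kT : 0 <= k * beta * kappa * Tx by rewrite !mulr_ge0// ltW.
have kV : 0 <= k * beta ^+ 2 * Vx by rewrite !mulr_ge0// ?sqr_ge0// ltW.
(* After doubling, the dissipation offers [alpha beta Ux], [alpha beta / 2] of [Z1] and of [zz],
   [2 k beta^2 Vx] and [2 k beta kappa Tx]. The bounds above consume [3/8 alpha beta Ux],
   [1/4 alpha beta Z1], [3/8 alpha beta ZZ], and half of the [Vx] and [Tx] terms. *)
have -> : alpha * beta * tau / 2 * (- (2 * tau)^-1 * (Z1 - 2 * Ux + zz)) =
    - (alpha * beta / 4) * (Z1 - 2 * Ux + zz) by field; rewrite gt_eqF.
clear ya yb yc yd ye hV hT hZ h1 h2 h3 h4 h5 aat aat'.
lra.
Qed.

(* [Uu], [Y] are the squared norms of [u] and of [beta u_x - alpha tau Z], [uv]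
   is the integral of [u v], and [wz] that of [(2 - rho) z^2]. *)
Lemma lyapunov_lower alpha beta tau k P (V Tt Ux ZZ zz Uu uv Y wz : F) :
  0 < alpha -> 0 < beta -> 0 < tau -> 0 < k -> 0 < P -> 0 <= V -> 0 <= Tt -> 0 <= Ux -> 0 <= zz ->
  Uu <= P * Ux -> ZZ <= zz -> 8 * P <= k * beta -> 8 * (alpha * tau) <= beta ->
  2 * (-1 * uv) <= beta / (4 * P) * Uu + (beta / (4 * P))^-1 * V ->
  beta ^+ 2 * Ux <= 2 * (alpha * tau) ^+ 2 * ZZ + 2 * Y -> zz <= wz ->
  k * beta / 2 * V + k * beta * Tt + beta ^+ 2 / 4 * Ux + alpha * beta * tau / 4 * zz <=
  k * beta * V + (k * beta * Tt + (beta * (uv + uv) + (Y + alpha * beta * tau / 2 * wz))).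
Proof.
move=> al be ta k0 P0 V0 T0 Ux0 zz0 hU hZ h2 h4 yu hY hw.
(* The weight [beta / (4 * P)] is such that Poincare turns the [u] part into [beta^2 / 4 * Ux], half
   of the [beta^2 / 2 * Ux] that [Y] provides; the [V] part is at most half of [k * beta * V]. *)
have e1 : 2 * (-1 * uv) * beta <= beta ^+ 2 / 4 * Ux + 4 * P * V.
  have := ler_wpM2r (ltW be) yu; rewrite [leRHS]mulrDl.
  have -> : (beta / (4 * P))^-1 * V * beta = 4 * P * V by field; rewrite !gt_eqF.
  have c0 : 0 <= beta ^+ 2 / (4 * P) by rewrite divr_ge0 ?sqr_ge0// mulr_ge0// ltW.
  have := ler_wpM2l c0 hU.
  have -> : beta ^+ 2 / (4 * P) * (P * Ux) = beta ^+ 2 / 4 * Ux by field; rewrite gt_eqF.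
  have -> : beta / (4 * P) * Uu * beta = beta ^+ 2 / (4 * P) * Uu by field; rewrite gt_eqF.
  lra.
have e2 := ler_wpM2r V0 h2.
have at0 : 0 < alpha * tau by rewrite mulr_gt0.
have e3 : (alpha * tau) ^+ 2 * ZZ <= alpha * beta * tau / 8 * zz.
  apply: (@le_trans _ _ ((alpha * tau) ^+ 2 * zz)); first by rewrite ler_wpM2l// sqr_ge0.
  by apply: ler_wpM2r => //; have := ler_wpM2l (ltW at0) h4; rewrite expr2; lra.
have abt : 0 < alpha * beta * tau by rewrite !mulr_gt0.
have e4 : alpha * beta * tau * zz <= alpha * beta * tau * wz by rewrite ler_pM2l.
have e5 : 0 <= alpha * beta * tau * zz by rewrite mulr_ge0// ltW.
clear hU hZ h2 h4 yu hw.
lra.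
Qed.

Lemma lyapunov_upper alpha beta tau k P (V Tt Ux ZZ zz Uu uv Y wz : F) :
  0 < alpha -> 0 < beta -> 0 < tau -> 0 < k -> 0 < P -> 0 <= V -> 0 <= Tt -> 0 <= Ux -> 0 <= zz ->
  Uu <= P * Ux -> ZZ <= zz ->
  2 * (1 * uv) <= 1 * Uu + 1^-1 * V ->
  Y <= 2 * (alpha * tau) ^+ 2 * ZZ + 2 * (beta ^+ 2 * Ux) -> wz <= 2 * zz ->
  k * beta * V + (k * beta * Tt + (beta * (uv + uv) + (Y + alpha * beta * tau / 2 * wz))) <=
  (k * beta + beta + beta * P + 2 * beta ^+ 2 + 2 * (alpha * tau) ^+ 2 + alpha * beta * tau) *
    (V + Tt + Ux + zz).
Proof.
move=> al be ta k0 P0 V0 T0 Ux0 zz0 hU hZ yu hY hw.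
have e1 := ler_wpM2r (ltW be) yu; have e2 := ler_wpM2l (ltW be) hU.
have e3 := ler_wpM2l (sqr_ge0 (alpha * tau)) hZ.
have abt : 0 < alpha * beta * tau by rewrite !mulr_gt0.
have e4 := ler_wpM2l (ltW abt) hw.
have S0 : 0 <= V + Tt + Ux + zz by rewrite !addr_ge0.
have kb := ltW (mulr_gt0 k0 be); have bP := ltW (mulr_gt0 be P0).
have b2 := sqr_ge0 beta; have at2 := sqr_ge0 (alpha * tau).
have := mulr_ge0 kb Ux0; have := mulr_ge0 kb zz0.
have := mulr_ge0 (ltW be) T0; have := mulr_ge0 (ltW be) Ux0; have := mulr_ge0 (ltW be) zz0.
have := mulr_ge0 bP V0; have := mulr_ge0 bP T0; have := mulr_ge0 bP zz0.
have := mulr_ge0 b2 V0; have := mulr_ge0 b2 T0; have := mulr_ge0 b2 zz0.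
have := mulr_ge0 at2 V0; have := mulr_ge0 at2 T0; have := mulr_ge0 at2 Ux0.
have := mulr_ge0 (ltW abt) V0; have := mulr_ge0 (ltW abt) T0; have := mulr_ge0 (ltW abt) Ux0.
move: e1; rewrite invr1 !mul1r.
clear yu hU hZ hw al be ta k0 P0 kb bP abt.
lra.
Qed.

End RealEstimates.

Arguments st_u {R} U.
Arguments st_v {R} U.
Arguments st_z {R} U.
Arguments st_t {R} U.

Section Lyapunov.
Variable R : realType.
Local Notation mu := (@lebesgue_measure R).
Variables (alpha beta gamma kappa tau ell xi k : R).
Hypotheses (alpha_gt0 : 0 < alpha) (beta_gt0 : 0 < beta) (gamma_gt0 : 0 < gamma)
  (kappa_gt0 : 0 < kappa) (tau_gt0 : 0 < tau) (ell_gt0 : 0 < ell) (xi_gt0 : 0 < xi)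
  (k_gt0 : 0 < k).
Local Notation Om := (`]0, ell[%classic : set (measurableTypeR R)).
Local Notation I01 := (`]0, 1[%classic : set (measurableTypeR R)).
Local Notation Q := (Om `*` I01).
Local Notation L2Q := (L2 (mu \x mu)%E Q).
Local Notation dx := (wderiv 0 ell).
Local Notation H := (Hspace ell).
Local Notation N := (Hnorm alpha ell xi).
Local Notation blk := (block mu Om).
Local Notation blkQ := (block (mu \x mu)%E Q).
Implicit Types U W : state R.

Let mOm : measurable Om := measurable_itv _.
Let mQ : measurable Q. Proof. by apply: measurableX => //; exact: measurable_itv. Qed.
Let Hlin := @Hspace_lin R ell.

(* The equation for [u] says that [beta u_x - alpha tau int_0^1 z] has time
   derivative [flux - alpha u_x]. *)
Definition st_y U x : R := - (alpha * tau) * fibre_mean (st_z U) x + beta * dx (st_u U) x.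

Definition st_wz U (p : R * R) : R := (2 - p.2) * st_z U p.

(** The cross term [2 * beta * u v] is split into two blocks to be symmetric. The factor
    [alpha * beta * tau / 2] makes the growth in [u_x] coming from the history term exactly half of
    what [y y_t] dissipates. *)
Definition lyapunov U W : R :=
  k * beta * blk st_v st_v U W + (k * beta * blk st_t st_t U W +
  (beta * (blk st_u st_v U W + blk st_v st_u U W) +
  (blk st_y st_y U W + alpha * beta * tau / 2 * blkQ st_wz st_z U W))).

Let ae_linear_y : ae_linear_L2 mu Om H st_y.
Proof.
apply: ae_linear_L2_lin => //; first exact: ae_linear_fibre_mean.
have [L l] := ae_linear_dx ell; split=> [U hU|r U W hU hW]; first by apply: L2Z => //; exact: L.
by apply: ae_mono (l r U W hU hW) => x h /h ->; ring.
Qed.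

Let wt_le p : Q p -> 1 <= 2 - p.2 <= 2.
Proof. by move=> [_ /=]; rewrite in_itv/= => /andP[p0 p1]; lra. Qed.

Let L2_wz U : H U -> L2Q (st_wz U).
Proof.
move=> /HspaceP[_ _ hz _ _]; apply: (@L2_mul_bounded _ _ _ _ _ mQ _ _ 2) => //.
  by apply: measurable_funTS; apply: measurable_funB => //; exact: measurable_cst.
by move=> p /wt_le /andP[p0 p1]; rewrite ler_norml; lra.
Qed.

Let ae_linear_wz : ae_linear_L2 (mu \x mu)%E Q H st_wz.
Proof.
split; first exact: L2_wz.
by move=> r U W hU hW; apply: aeW => p _; rewrite /st_wz st_z_lin; ring.
Qed.

Lemma symmetric_lyapunov : symmetric_form H lyapunov.
Proof.
apply: symmetric_formD; first exact: symmetric_formZ (block_diag_symmetric mOm Hlin (ae_linear_v ell)).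
apply: symmetric_formD; first exact: symmetric_formZ (block_diag_symmetric mOm Hlin (ae_linear_t ell)).
apply: symmetric_formD; first exact: symmetric_formZ (block_symmetric mOm Hlin (ae_linear_u ell) (ae_linear_v ell)).
apply: symmetric_formD; first exact: (block_diag_symmetric mOm Hlin ae_linear_y).
apply: symmetric_formZ; split=> [r U W X hU hW hX|U W hU hW].
  exact: (block_lin mQ r Hlin ae_linear_wz (ae_linear_z ell)).
by apply: eq_Rintegral => p _; rewrite /st_wz; ring.
Qed.

Definition sq_v U := \int[mu]_(x in `]0, ell[) (st_v U x ^+ 2).
Definition sq_t U := \int[mu]_(x in `]0, ell[) (st_t U x ^+ 2).
Definition sq_ux U := \int[mu]_(x in `]0, ell[) (dx (st_u U) x ^+ 2).
Definition sq_z U := \int[(mu \x mu)%E]_(p in Q) (st_z U p ^+ 2).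

Lemma sq_ge0 U : [/\ 0 <= sq_v U, 0 <= sq_t U, 0 <= sq_ux U & 0 <= sq_z U].
Proof. by split; exact: Rintegral_sqr_ge0. Qed.

Let P := 4 * ell ^+ 2.
Let P_gt0 : 0 < P. Proof. by rewrite mulr_gt0// exprn_gt0. Qed.

Hypotheses (k_big : 8 * P <= k * beta) (beta_big : 8 * (alpha * tau) <= beta).

Section Bounds.
Variable U : state R.
Hypothesis hU : H U.

Let Lz : L2Q (st_z U). Proof. by have /HspaceP[] := hU. Qed.
Let Lu : L2 mu `]0, ell[ (st_u U). Proof. by have /HspaceP[[/H1_L2]] := hU. Qed.
Let Lux : L2 mu `]0, ell[ (dx (st_u U)). Proof. by have /HspaceP[[/L2_wderiv]] := hU. Qed.
Let Lv : L2 mu `]0, ell[ (st_v U). Proof. by have /HspaceP[] := hU. Qed.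
Let LZ : L2 mu `]0, ell[ (fibre_mean (st_z U)). Proof. exact: L2_fibre_mean. Qed.
Let Ly : L2 mu `]0, ell[ (st_y U). Proof. by have [h _] := ae_linear_y; exact: h. Qed.

Let poincare_u : \int[mu]_(x in `]0, ell[) (st_u U x ^+ 2) <= P * sq_ux U.
Proof. by have /HspaceP[hu _ _ _ _] := hU; have := poincare ell_gt0 hu; rewrite subr0. Qed.

Let wz_bounds : sq_z U <= blkQ st_wz st_z U U <= 2 * sq_z U.
Proof.
have [_ z2] := Lz; have i := L2_mul mQ (L2_wz hU) Lz.
rewrite /sq_z -RintegralZl//; apply/andP; split; apply: le_Rintegral => //.
- move=> p /wt_le /andP[p0 p1]; rewrite /st_wz -mulrA -expr2.
  by have := ler_wpM2r (sqr_ge0 (st_z U p)) p0; rewrite mul1r.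
- exact: integrable_EFinZ.
- move=> p /wt_le /andP[p0 p1]; rewrite /st_wz -mulrA -expr2.
  exact: (ler_wpM2r (sqr_ge0 (st_z U p)) p1).
Qed.

Let lyapunov_diag : lyapunov U U = k * beta * sq_v U + (k * beta * sq_t U +
  (beta * (\int[mu]_(x in `]0, ell[) (st_u U x * st_v U x) + \int[mu]_(x in `]0, ell[) (st_u U x * st_v U x)) +
  (\int[mu]_(x in `]0, ell[) (st_y U x ^+ 2) + alpha * beta * tau / 2 * blkQ st_wz st_z U U))).
Proof. by rewrite /lyapunov (blockC mu Om st_v st_u). Qed.

Lemma lyapunov_ge : k * beta / 2 * sq_v U + k * beta * sq_t U + beta ^+ 2 / 4 * sq_ux U
  + alpha * beta * tau / 4 * sq_z U <= lyapunov U U.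
Proof.
have [v0 t0 u0 z0] := sq_ge0 U; have /andP[w1 _] := wz_bounds.
rewrite lyapunov_diag.
apply: (lyapunov_lower alpha_gt0 beta_gt0 tau_gt0 k_gt0 P_gt0 v0 t0 u0 z0 poincare_u
  (Rintegral_fibre_mean_sqr_le Lz) k_big beta_big _ _ w1).
- apply: Rintegral_young2 => //; first by rewrite divr_gt0// mulr_gt0.
  by rewrite normrN1.
- rewrite -RintegralZl//; last by case: Lux.
  have := Rintegral_sqr_lin_le (alpha * tau) mOm LZ Ly; congr (_ <= _).
  by apply: eq_Rintegral => x _; rewrite /st_y; ring.
Qed.

Lemma lyapunov_le : lyapunov U U <=
  (k * beta + beta + beta * P + 2 * beta ^+ 2 + 2 * (alpha * tau) ^+ 2 + alpha * beta * tau) *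
  (sq_v U + sq_t U + sq_ux U + sq_z U).
Proof.
have [v0 t0 u0 z0] := sq_ge0 U; have /andP[_ w2] := wz_bounds.
rewrite lyapunov_diag.
apply: (lyapunov_upper alpha_gt0 beta_gt0 tau_gt0 k_gt0 P_gt0 v0 t0 u0 z0 poincare_u
  (Rintegral_fibre_mean_sqr_le Lz) _ _ w2).
- by apply: Rintegral_young2 => //; rewrite normr1.
- have := Rintegral_sqr_lin_le (- (alpha * tau)) mOm LZ (L2Z mOm beta Lux).
  rewrite sqrrN; congr (_ <= _ + 2 * _).
  rewrite -RintegralZl//; last by case: Lux.
  by apply: eq_Rintegral => x _; rewrite exprMn.
Qed.

End Bounds.

Hypotheses (beta_big' : 16 * k * alpha <= beta)
  (k_big' : 32 * (alpha * tau ^+ 2) <= k * beta)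
  (k_big'' : 4 * gamma ^+ 2 * P <= k * (alpha * kappa)).
Local Notation D := (domA alpha beta ell).
Local Notation A := (opA alpha beta gamma kappa tau ell).

Lemma lyapunov_dissipative U : D U -> 2 * lyapunov (A U) U <=
  - (alpha * beta / 2 * sq_ux U + alpha * beta / 8 * sq_z U + k * beta ^+ 2 / P * sq_v U
    + k * beta * kappa / P * sq_t U).
Proof.
case: U => [[[u v] z] t] DU.
have [[Lux Lvx Lu Lv Lt] [Ltx Lz1 Lz]] := domA_L2 DU.
have HAU := domA_opA_Hspace gamma kappa tau ell_gt0 DU.
set U : state R := (u, v, z, t); set AU := A U in HAU *.
have [hU [hu hv _ [ht _]] _ _ _] := DU.
set z1 := slice ell z 1 in Lz1 *; pose Zm := fibre_mean z.
have LZ : L2 mu `]0, ell[ Zm by exact: L2_fibre_mean.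
pose a := \int[mu]_(x in `]0, ell[) (z1 x * dx v x).
pose b := \int[mu]_(x in `]0, ell[) (t x * dx u x).
pose c := \int[mu]_(x in `]0, ell[) (dx v x * Zm x).
pose d := \int[mu]_(x in `]0, ell[) (dx u x * Zm x).
pose e := \int[mu]_(x in `]0, ell[) (z1 x * Zm x).
pose f := \int[mu]_(x in `]0, ell[) (z1 x * dx u x).
pose g := \int[mu]_(x in `]0, ell[) (dx v x * dx u x).
pose h := \int[mu]_(x in `]0, ell[) (t x * dx v x).
pose Vx := \int[mu]_(x in `]0, ell[) (dx v x ^+ 2).
pose Tx := \int[mu]_(x in `]0, ell[) (dx t x ^+ 2).
pose Z1 := \int[mu]_(x in `]0, ell[) (z1 x ^+ 2).
pose ZZ := \int[mu]_(x in `]0, ell[) (Zm x ^+ 2).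
have ey : blk st_y st_y AU U = beta ^+ 2 * g - alpha * beta * tau * c - alpha * beta * sq_ux U
      + alpha ^+ 2 * tau * d + alpha * beta * f - alpha ^+ 2 * tau * e.
  have -> : blk st_y st_y AU U = \int[mu]_(x in `]0, ell[)
      ((alpha * z1 x + (beta * dx v x + (- alpha) * dx u x)) * (- (alpha * tau) * Zm x + beta * dx u x)).
    have Ly := (ae_linear_y.1 AU HAU).
    have Ly' : L2 mu Om (fun x => alpha * z1 x + (beta * dx v x + (- alpha) * dx u x)).
      by apply: L2_lin => //; apply: L2_lin => //; exact: L2Z.
    have Ly2 := (ae_linear_y.1 U hU).
    apply: ae_eq_Rintegral => //.
    - by apply: measurable_funM; [exact: (L2_measurable Ly)|exact: (L2_measurable Ly2)].
    - by apply: measurable_funM; [exact: (L2_measurable Ly')|exact: (L2_measurable Ly2)].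
    - apply: ae_mono (domA_fibre_mean gamma kappa tau DU) => x hx Ox.
      congr (_ * _); rewrite /st_y hx//; rewrite /st_u/= -/z1.
      by field; rewrite gt_eqF.
  have Lw : L2 mu `]0, ell[ (fun x => - (alpha * tau) * Zm x + beta * dx u x).
    by apply: L2_lin => //; exact: L2Z.
  have pr (w : R -> R) : L2 mu `]0, ell[ w ->
      \int[mu]_(x in `]0, ell[) (w x * (- (alpha * tau) * Zm x + beta * dx u x)) =
      - (alpha * tau) * \int[mu]_(x in `]0, ell[) (w x * Zm x) + beta * \int[mu]_(x in `]0, ell[) (w x * dx u x).
    move=> Lw'; rewrite Rintegral_mulC Rintegral_mul_linl//; last exact: L2Z.
    rewrite Rintegral_mulZl// (Rintegral_mulC mu Om Zm w).
    by rewrite (Rintegral_mulC mu Om (dx u) w).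
  rewrite !Rintegral_mul_linl//; try (by apply: L2_lin => //; exact: L2Z); try exact: L2Z.
  rewrite Rintegral_mulZl// !pr//.
  by rewrite -/c -/d -/e -/f -/g -[\int[mu]_(x in _) (dx u x * dx u x)]/(sq_ux U); ring.
have ez : blkQ st_wz st_z AU U = - (2 * tau)^-1 * (Z1 - 2 * sq_ux U + sq_z U).
  exact: (domA_transport gamma kappa tau_gt0 DU).
have eL : lyapunov AU U = k * beta * (- alpha * a - beta * Vx + gamma * h) +
    (k * beta * (- gamma * h - kappa * Tx) +
    (beta * (sq_v U + (- alpha * f - beta * g + gamma * b)) +
    (beta ^+ 2 * g - alpha * beta * tau * c - alpha * beta * sq_ux U
      + alpha ^+ 2 * tau * d + alpha * beta * f - alpha ^+ 2 * tau * e +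
    alpha * beta * tau / 2 * (- (2 * tau)^-1 * (Z1 - 2 * sq_ux U + sq_z U))))).
  have e1 : blk st_v st_v AU U = - alpha * a - beta * Vx + gamma * h.
    exact: (domA_momentum_v gamma kappa tau DU).
  have e2 : blk st_v st_u AU U = - alpha * f - beta * g + gamma * b.
    exact: (domA_momentum_u gamma kappa tau DU).
  have e3 : blk st_t st_t AU U = - gamma * h - kappa * Tx.
    exact: (domA_heat gamma kappa tau ell_gt0 DU).
  by rewrite /lyapunov ey ez e1 e2 e3.
have [V0 T0 Ux0 zz0] := sq_ge0 U.
have Vx0 : 0 <= Vx by exact: Rintegral_sqr_ge0.
have Tx0 : 0 <= Tx by exact: Rintegral_sqr_ge0.
have Z10 : 0 <= Z1 by exact: Rintegral_sqr_ge0.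
have ZZ0 : 0 <= ZZ by exact: Rintegral_sqr_ge0.
have hV : sq_v U <= P * Vx by have := poincare ell_gt0 hv; rewrite subr0.
have hT : sq_t U <= P * Tx.
  have m0 : \int[mu]_(x in `]0, ell[) t x = 0 by case: hU.
  by have := poincare_wirtinger ell_gt0 (wderivP ht) m0; rewrite subr0.
have hZ : ZZ <= sq_z U by exact: Rintegral_fibre_mean_sqr_le.
have n1 : `|-1 : R| = 1 by rewrite normrN1.
have ya : 2 * (-1 * a) <= 8 * k * Vx + (8 * k)^-1 * Z1.
  have -> : a = \int[mu]_(x in `]0, ell[) (dx v x * z1 x) by exact: Rintegral_mulC.
  by apply: Rintegral_young2 => //; exact: mulr_gt0.
have yb : 2 * (1 * b) <= alpha / (4 * gamma) * sq_ux U + (alpha / (4 * gamma))^-1 * sq_t U.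
  have -> : b = \int[mu]_(x in `]0, ell[) (dx u x * t x) by exact: Rintegral_mulC.
  apply: Rintegral_young2 => //; last by rewrite normr1.
  by rewrite divr_gt0// mulr_gt0.
have yc : 2 * (-1 * c) <= 8 * tau * Vx + (8 * tau)^-1 * ZZ.
  by apply: Rintegral_young2 => //; exact: mulr_gt0.
have yd : 2 * (1 * d) <= 1 * sq_ux U + 1^-1 * ZZ.
  by apply: Rintegral_young2 => //; rewrite normr1.
have ye : 2 * (-1 * e) <= 1 * Z1 + 1^-1 * ZZ by exact: Rintegral_young2.
rewrite eL; move: (sq_v U) (sq_t U) (sq_ux U) (sq_z U) V0 T0 Ux0 zz0 hV hT hZ yb yd.
move: a b c d e f g h Vx Tx Z1 ZZ Vx0 Tx0 Z10 ZZ0 ya yc ye {ey ez eL}.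
move=> a b c d e f g h Vx Tx Z1 ZZ Vx0 Tx0 Z10 ZZ0 ya yc ye V T Ux zz V0 T0 Ux0 zz0 hV hT hZ yb yd.
apply: (le_trans (dissipation_estimate f g h alpha_gt0 beta_gt0 gamma_gt0 kappa_gt0 tau_gt0 k_gt0 Vx0 Ux0 Tx0 Z10 ZZ0 zz0
  hV hT hZ beta_big' k_big k_big' beta_big k_big'' ya yb yc yd ye)).
(* The two Poincare inequalities trade [Vx] and [Tx] for the norms of [v] and [theta] themselves. *)
rewrite lerN2; apply: lerD; first apply: lerD => //.
- rewrite -mulrA; apply: ler_wpM2l; first exact: mulr_ge0 (ltW k_gt0) (sqr_ge0 _).
  by rewrite mulrC ler_pdivrMr// mulrC.
- rewrite -mulrA; apply: ler_wpM2l.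
    by apply: mulr_ge0; [apply: mulr_ge0|]; exact: ltW.
  by rewrite mulrC ler_pdivrMr// mulrC.
Qed.

End Lyapunov.

Lemma weighted_sum_ge (R : realFieldType) (w1 w2 w3 w4 : R) :
  0 < w1 -> 0 < w2 -> 0 < w3 -> 0 < w4 ->
  exists2 c : R, 0 < c & forall a1 a2 a3 a4, 0 <= a1 -> 0 <= a2 -> 0 <= a3 -> 0 <= a4 ->
    c * (a1 + a2 + a3 + a4) <= w1 * a1 + w2 * a2 + w3 * a3 + w4 * a4.
Proof.
move=> w10 w20 w30 w40; exists (Num.min (Num.min w1 w2) (Num.min w3 w4)).
  by rewrite !lt_min w10 w20 w30.
set c := Num.min _ _ => a1 a2 a3 a4 h1 h2 h3 h4.
have [[c1 c2] [c3 c4]] : (c <= w1 /\ c <= w2) /\ (c <= w3 /\ c <= w4).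
  by rewrite /c; split; split; rewrite !ge_min lexx ?orbT.
by rewrite !mulrDr !lerD// ler_wpM2r.
Qed.

Lemma weighted_sum_le (R : realFieldType) (w1 w2 w3 w4 : R) :
  0 < w1 -> 0 < w2 -> 0 < w3 -> 0 < w4 ->
  exists2 c : R, 0 < c & forall a1 a2 a3 a4, 0 <= a1 -> 0 <= a2 -> 0 <= a3 -> 0 <= a4 ->
    w1 * a1 + w2 * a2 + w3 * a3 + w4 * a4 <= c * (a1 + a2 + a3 + a4).
Proof.
move=> w10 w20 w30 w40; exists (w1 + w2 + w3 + w4); first by rewrite !addr_gt0.
by move=> a1 a2 a3 a4 h1 h2 h3 h4; rewrite !mulrDr !lerD// ler_wpM2r//; lra.
Qed.

(** * Decay of the energy *)

Section Decay.
Variable R : realType.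
Local Notation mu := (@lebesgue_measure R).
Variables (alpha beta gamma kappa tau ell xi k : R).
Hypotheses (alpha_gt0 : 0 < alpha) (beta_gt0 : 0 < beta) (gamma_gt0 : 0 < gamma)
  (kappa_gt0 : 0 < kappa) (tau_gt0 : 0 < tau) (ell_gt0 : 0 < ell) (xi_gt0 : 0 < xi)
  (k_gt0 : 0 < k).
Hypotheses (k_big : 8 * (4 * ell ^+ 2) <= k * beta) (beta_big : 8 * (alpha * tau) <= beta)
  (beta_big' : 16 * k * alpha <= beta)
  (k_big' : 32 * (alpha * tau ^+ 2) <= k * beta)
  (k_big'' : 4 * gamma ^+ 2 * (4 * ell ^+ 2) <= k * (alpha * kappa)).
Local Notation Om := (`]0, ell[%classic : set (measurableTypeR R)).
Local Notation H := (Hspace ell).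
Local Notation N := (Hnorm alpha ell xi).
Local Notation D := (domA alpha beta ell).
Local Notation A := (opA alpha beta gamma kappa tau ell).
Local Notation B := (lyapunov alpha beta tau ell k).
Implicit Types U W : state R.

(** A common yardstick: the energy, the norm, the Lyapunov form and its dissipation are each
    compared with this unweighted sum. *)
Let sq U := sq_v ell U + sq_t ell U + sq_ux ell U + sq_z ell U.

Let sq_ge0' U : 0 <= sq U.
Proof. by have [? ? ? ?] := sq_ge0 ell U; rewrite !addr_ge0. Qed.

Lemma energyE U : H U -> energy alpha ell xi U =
  2^-1 * (sq_v ell U + (alpha * sq_ux ell U + sq_t ell U)) + xi * sq_z ell U.
Proof.
have mOm : measurable Om := measurable_itv _.
move=> hU; have [Lu _] := ae_linear_dx ell; have /HspaceP[_ v1 z1 t1 _] := hU.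
have i1 := L2_mul mOm (Lu U hU) (Lu U hU); have i2 := L2_mul mOm v1 v1; have i3 := L2_mul mOm t1 t1.
have -> : energy alpha ell xi U = 2^-1 *
  \int[mu]_(x in `]0, ell[) (st_v U x ^+ 2 + alpha * wderiv 0 ell (st_u U) x ^+ 2 + st_t U x ^+ 2)
  + xi * \int[mu]_(x in `]0, ell[) (\int[mu]_(r in `]0, 1[) (st_z U (x, r) * st_z U (x, r))).
  by move: (U) => [[[u v] z] t].
rewrite (Rintegral_fibre_mul z1 z1); congr (_ * _ + _).
rewrite /sq_ux /sq_t /sq_v -Rintegral_lin// -RintegralD//.
  by apply: eq_Rintegral => x _; rewrite addrA.
by apply: integrable_EFinD => //; exact: integrable_EFinZ.
Qed.

Let energy_ge : exists2 c : R, 0 < c & forall U, H U -> c * sq U <= energy alpha ell xi U.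
Proof.
have h2 : 0 < 2^-1 :> R by lra.
have h2a : 0 < 2^-1 * alpha by rewrite mulr_gt0.
have [c c0 hc] := weighted_sum_ge h2 h2 h2a xi_gt0.
exists c => // U hU; have [v0 t0 u0 z0] := sq_ge0 ell U.
by rewrite energyE//; apply: le_trans (hc _ _ _ _ v0 t0 u0 z0) _; rewrite le_eqVlt; apply/orP; left; apply/eqP; ring.
Qed.

Let energy_le : exists2 c : R, 0 < c & forall U, H U -> energy alpha ell xi U <= c * sq U.
Proof.
have h2 : 0 < 2^-1 :> R by lra.
have h2a : 0 < 2^-1 * alpha by rewrite mulr_gt0.
have [c c0 hc] := weighted_sum_le h2 h2 h2a xi_gt0.
exists c => // U hU; have [v0 t0 u0 z0] := sq_ge0 ell U.
by rewrite energyE//; apply: le_trans (hc _ _ _ _ v0 t0 u0 z0); rewrite le_eqVlt; apply/orP; left; apply/eqP; ring.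
Qed.

Let norm_ge : exists2 c : R, 0 < c & forall U, H U -> c * sq U <= inner alpha ell xi U U.
Proof.
have [c c0 hc] := weighted_sum_ge ltr01 ltr01 alpha_gt0 xi_gt0.
exists c => // U hU; have [v0 t0 u0 z0] := sq_ge0 ell U.
rewrite inner_diag//; apply: le_trans (hc _ _ _ _ v0 t0 u0 z0) _; rewrite le_eqVlt; apply/orP; left; apply/eqP.
by rewrite /sq_v /sq_t /sq_ux /sq_z; ring.
Qed.

Let form_ge : exists2 c : R, 0 < c & forall U, H U -> c * sq U <= B U U.
Proof.
have h1 : 0 < k * beta by rewrite mulr_gt0.
have h2 : 0 < k * beta / 2 by rewrite divr_gt0.
have h3 : 0 < beta ^+ 2 / 4 by rewrite divr_gt0// exprn_gt0.
have h4 : 0 < alpha * beta * tau / 4 by rewrite divr_gt0// !mulr_gt0.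
have [c c0 hc] := weighted_sum_ge h2 h1 h3 h4.
exists c => // U hU; have [v0 t0 u0 z0] := sq_ge0 ell U.
apply: le_trans (hc _ _ _ _ v0 t0 u0 z0) _.
exact: (lyapunov_ge alpha_gt0 beta_gt0 tau_gt0 ell_gt0 k_gt0 k_big beta_big hU).
Qed.

Let form_le : exists2 c : R, 0 < c & forall U, H U -> B U U <= c * sq U.
Proof.
eexists; last by move=> U hU; exact: (lyapunov_le alpha_gt0 beta_gt0 tau_gt0 ell_gt0 k_gt0 hU).
by rewrite !addr_gt0// ?mulr_gt0// ?exprn_gt0// mulr_gt0.
Qed.

Let form_diss : exists2 m : R, 0 < m & forall U, D U -> 2 * B (A U) U <= - (m * sq U).
Proof.
have l0 : 0 < 4 * ell ^+ 2 by rewrite mulr_gt0// exprn_gt0.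
have h1 : 0 < k * beta ^+ 2 / (4 * ell ^+ 2) by rewrite divr_gt0// mulr_gt0// exprn_gt0.
have h2 : 0 < k * beta * kappa / (4 * ell ^+ 2) by rewrite divr_gt0// !mulr_gt0.
have h3 : 0 < alpha * beta / 2 by rewrite divr_gt0// mulr_gt0.
have h4 : 0 < alpha * beta / 8 by rewrite divr_gt0// mulr_gt0.
have [m m0 hm] := weighted_sum_ge h1 h2 h3 h4.
exists m => // U hU; have [v0 t0 u0 z0] := sq_ge0 ell U.
apply: (le_trans (lyapunov_dissipative alpha_gt0 beta_gt0 gamma_gt0 kappa_gt0 tau_gt0
  ell_gt0 k_gt0 k_big beta_big beta_big' k_big' k_big'' hU)).
rewrite lerN2; apply: le_trans (hm _ _ _ _ v0 t0 u0 z0) _; rewrite le_eqVlt; apply/orP; left; apply/eqP; ring.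
Qed.

Lemma exponential_stability : exists C a0 : R, [/\ 0 < C, 0 < a0 &
  forall S : R -> state R -> state R, generates H N D A S ->
  forall U t, H U -> 0 <= t ->
    energy alpha ell xi (S t U) <= C * energy alpha ell xi (S 0 U) * expR (- a0 * t)].
Proof.
have [e1 e10 he1] := energy_ge; have [e2 e20 he2] := energy_le.
have [n n0 hn] := norm_ge; have [c1 c10 hc1] := form_ge.
have [c2 c20 hc2] := form_le; have [m m0 hm] := form_diss.
have a_gt0 : 0 < m / c2 by rewrite divr_gt0.
(* The rate is the dissipation constant over the upper constant of the Lyapunov form; the factor
   pays for passing from the energy to that form and back. Neither involves the semigroup, which is
   quantified afterwards. *)
exists (e2 / c1 * (c2 / e1)), (m / c2); split=> //; first by rewrite mulr_gt0 ?divr_gt0.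
move=> S gen U t hU t0; have [sg gD _] := gen; have [SH _ _ [S0 _] _] := sg.
have [Blin Bsym] := symmetric_lyapunov alpha beta tau ell k.
have B_ge0 W : H W -> 0 <= B W W.
  by move=> hW; apply: le_trans (hc1 W hW); rewrite mulr_ge0// ltW.
have HN := Hnorm_seminormed alpha_gt0 ell_gt0 xi_gt0.
have B_bound W X : H W -> H X -> `|B W X| <= c2 / n * N W * N X.
  move=> hW hX.
  apply: le_trans (form_le_sqrt (@Hspace_lin R ell) (conj Blin Bsym) B_ge0 hW hX) _.
  have q0 : 0 <= c2 / n by rewrite divr_ge0// ltW.
  have bd Y : H Y -> Num.sqrt (B Y Y) <= Num.sqrt (c2 / n) * N Y.
    move=> hY; rewrite /Hnorm -sqrtrM// ler_wsqrtr//.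
    apply: le_trans (hc2 Y hY) _; rewrite -mulrA ler_wpM2l ?(ltW c20)//.
    by rewrite ler_pdivlMl// hn.
  apply: (le_trans (ler_pM (sqrtr_ge0 _) (sqrtr_ge0 _) (bd W hW) (bd X hX))).
  by rewrite mulrACA -expr2 sqr_sqrtr// mulrA.
have D_H W : D W -> H W by move=> /gD[].
have A_H W : D W -> H (A W).
  by case: W => [[[u v] z] th] DW; exact: domA_opA_Hspace DW.
have A_diss W : D W -> 2 * B (A W) W <= - (m / c2) * B W W.
  move=> DW; apply: le_trans (hm W DW) _; rewrite mulNr lerN2 -mulrA ler_wpM2l ?(ltW m0)//.
  by rewrite mulrC ler_pdivrMr// mulrC; apply: hc2; exact: D_H.
have decay := semigroup_decay HN (Hspace_complete alpha_gt0 ell_gt0 xi_gt0) sg gen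
  Blin Bsym B_bound a_gt0 A_H A_diss B_ge0 hU t0.
have hS0 := SH 0 U (lexx 0) hU; have hSt := SH t U t0 hU.
(* [S 0 U] equals [U] only up to a null vector, and the energy at time 0 is that of [S 0 U]. *)
have B0 : B U U = B (S 0 U) (S 0 U).
  by apply/esym; apply: (form_null_eq HN Blin Bsym B_bound hS0 hU); exact: S0.
have x0 : 0 <= expR (- (m / c2) * t) by exact: expR_ge0.
apply: (le_trans (he2 _ hSt)).
rewrite -!mulrA ler_wpM2l ?(ltW e20)// ler_pdivlMl//.
apply: (le_trans (hc1 _ hSt)); apply: (le_trans decay).
rewrite B0 !mulrA ler_wpM2r// -mulrA.
apply: (le_trans (hc2 _ hS0)); rewrite ler_wpM2l ?(ltW c20)//.
by rewrite ler_pdivlMl// he1.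
Qed.

End Decay.

Theorem theorem3p1 (R : realType) (alpha gamma kappa tau ell xi : R)
    (alpha_gt0 : 0 < alpha) (gamma_gt0 : 0 < gamma) (kappa_gt0 : 0 < kappa)
    (tau_gt0 : 0 < tau) (ell_gt0 : 0 < ell) (xi_gt0 : 0 < xi) :
  exists2 beta0 : R, 0 < beta0 &
    forall beta : R, beta0 <= beta ->
    exists C a0 : R, [/\ 0 < C, 0 < a0 &
      forall S : R -> state R -> state R,
      generates (Hspace ell) (Hnorm alpha ell xi)
        (domA alpha beta ell) (opA alpha beta gamma kappa tau ell) S ->
      forall (u0 u1 : R -> R) (f0 : R -> R -> R) (theta0 : R -> R),
        let U0 := initial_state tau u0 u1 f0 theta0 in
        Hspace ell U0 ->
        let E := fun t : R => energy alpha ell xi (S t U0) in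
        forall t : R, 0 <= t -> E t <= C * E 0 * expR (- a0 * t)].
Proof.
pose P := 4 * ell ^+ 2; have P0 : 0 < P by rewrite mulr_gt0// exprn_gt0.
have ak : 0 < alpha * kappa by rewrite mulr_gt0.
(* The one condition on [k] free of [beta] is [4 * gamma ^+ 2 * P <= k * (alpha * kappa)], so [k] is
   fixed first. *)
pose k := 4 * gamma ^+ 2 * P / (alpha * kappa) + 1.
have k0 : 0 < k by rewrite ltr_wpDl// divr_ge0 ?(ltW ak)// !mulr_ge0 ?sqr_ge0// ltW.
have at0 : 0 < alpha * tau by rewrite mulr_gt0.
have at20 : 0 < alpha * tau ^+ 2 by rewrite mulr_gt0// exprn_gt0.
have ka0 : 0 < k * alpha by rewrite mulr_gt0.
(* [beta >= q] makes [k * beta] at least the sum of its two required lower bounds, so both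
   conditions follow at once. *)
pose q := (8 * P + 32 * (alpha * tau ^+ 2)) / k.
have q0 : 0 < q by rewrite divr_gt0// addr_gt0// mulr_gt0.
have kq : k * q = 8 * P + 32 * (alpha * tau ^+ 2) by rewrite mulrC divfK// gt_eqF.
exists (16 * (k * alpha) + q + 8 * (alpha * tau) + 1); first by lra.
move=> beta hb; have b0 : 0 < beta by lra.
have kb : k * q <= k * beta by rewrite ler_wpM2l ?(ltW k0)//; lra.
have h1 : 8 * (4 * ell ^+ 2) <= k * beta by rewrite -/P; lra.
have h2 : 8 * (alpha * tau) <= beta by lra.
have h3 : 16 * k * alpha <= beta by rewrite -mulrA; lra.
have h4 : 32 * (alpha * tau ^+ 2) <= k * beta by lra.
have h5 : 4 * gamma ^+ 2 * (4 * ell ^+ 2) <= k * (alpha * kappa).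
  by rewrite -/P [k * _]mulrDl divfK ?gt_eqF// lerDl mul1r ltW.
have [C [a0 [C0 a00 stab]]] := exponential_stability alpha_gt0 b0 gamma_gt0 kappa_gt0
  tau_gt0 ell_gt0 xi_gt0 k0 h1 h2 h3 h4 h5.
by exists C, a0; split=> // S gen u0 u1 f0 theta0 U0 hU0 E t t0; exact: stab.
Qed.
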